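(* Let $M$ and $N$ be two compact smooth Riemannian manifolds without boundary, $n=\dim M\ge 2$, and let $P$ be a Young function such that (i) $\int_1^\infty \frac{P(t)}{t^{n+1}}\,dt=\infty$; (ii) $P(t)=o(t^n)$ as $t\to\infty$; (iii) there exists $K>0$ such that $P(2t)\le K\,P(t)$ for all $t\ge 0$; (iv) for some $\alpha>n-1$ the function $t\mapsto t^{-\alpha}P(t)$ is non-decreasing. (a) If $\pi_n(N)=0$, then the homotopy classes are well defined in $W^{1,P}(M,N)$, that is: for every $u\in W^{1,P}(M,N)$ there is $\varepsilon>0$ such that if $u_1,u_2\in C^\infty(M,N)$ and $\|u-u_i\|_{1,P}<\varepsilon$ for $i=1,2$, then $u_1$ and $u_2$ are homotopic. (b) If $\pi_n(N)\ne0$, then the homotopy classes cannot be well defined in $W^{1,P}(S^n,N)$, that is: there is a sequence $u_k\in C^\infty(S^n,N)$ that converges to a constant mapping in the norm of $W^{1,P}$ and such that no $u_k$ is homotopic to a constant mapping.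
   Context: A Young function is a convex, strictly increasing function $P:[0,\infty)\to[0,\infty)$ with $P(0)=0$. Under the doubling condition (iii), the Orlicz space $L^P(X)$ on a measure space $(X,\mu)$ is the class of measurable functions $f$ with $\int_X P(|f|)\,d\mu<\infty$, a Banach space under the Luxemburg norm $\|f\|_P=\inf\{k>0:\int_X P(|f|/k)\,d\mu\le 1\}$. For an open set $\Omega\subset\mathbb{R}^n$, the Orlicz-Sobolev space $W^{1,P}(\Omega)$ consists of the weakly differentiable functions with finite norm $\|f\|_{1,P}=\|f\|_{L^1}+\sum_{i=1}^n\|D_if\|_P$; the definition is extended to compact Riemannian manifolds $M$ (and to vector-valued functions) by means of coordinate maps. $N$ is assumed to be isometrically embedded in some Euclidean space $\mathbb{R}^k$, and $W^{1,P}(M,N)$ is the set of $u\in W^{1,P}(M,\mathbb{R}^k)$ with $u(x)\in N$ for a.e. $x\in M$, equipped with the metric inherited from the norm $\|\cdot\|_{1,P}$. If $N$ is not connected, $\pi_n(N)=0$ means that $\pi_n(N,x)=0$ for every base point $x\in N$. *)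

(* Defs.v *)
From HB Require Import structures.
From mathcomp Require Import all_boot all_order all_algebra.
From mathcomp Require Import all_classical all_reals all_analysis.
From mathcomp Require Import ring.

Set Implicit Arguments.
Unset Strict Implicit.
Unset Printing Implicit Defensive.

Import Order.TTheory GRing.Theory Num.Theory.
Import numFieldNormedType.Exports.

Local Open Scope classical_set_scope.
Local Open Scope ring_scope.

Section lebesgue_rV.
Context {R : realType} {n : nat}.
Local Open Scope ereal_scope.

(* [None] is the empty cell; it is needed only when n = 0, where every
   product of intervals is the one-point space. *)
Definition cell := option ('rV[R]_n * 'rV[R]_n).

Definition cell_set (c : cell) : set 'rV[R]_n :=
  if c is Some ab then
    [set x | forall i, (ab.1 ord0 i <= x ord0 i < ab.2 ord0 i)%R]
  else set0.

Definition cell_vol (c : cell) : \bar R :=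
  if c is Some ab then
    (\prod_(i < n) Num.max 0 (ab.2 ord0 i - ab.1 ord0 i))%R%:E
  else 0.

Definition cell_cover (A : set 'rV[R]_n) : set (nat -> cell) :=
  [set c | A `<=` \bigcup_k cell_set (c k)].

Definition leb_outer (A : set 'rV[R]_n) : \bar R :=
  ereal_inf [set \sum_(k <oo) cell_vol (c k) | c in cell_cover A].

Lemma cell_vol_ge0 c : 0 <= cell_vol c.
Proof.
by case: c => //= ab; rewrite lee_fin prodr_ge0// => i _; rewrite le_max lexx.
Qed.

Lemma leb_outer_ge0 A : 0 <= leb_outer A.
Proof.
by apply: le_ereal_inf_tmp => _ [c _ <-]; apply: nneseries_ge0 => k _ _;
  exact: cell_vol_ge0.
Qed.

Lemma leb_outer0 : leb_outer set0 = 0.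
Proof.
apply/eqP; rewrite eq_le leb_outer_ge0 andbT; apply: ereal_inf_lbound.
by exists (fun=> None) => //=; rewrite eseries0.
Qed.

Lemma le_leb_outer : {homo leb_outer : A B / A `<=` B >-> A <= B}.
Proof.
move=> A B AB; apply/ereal_inf_le_tmp => _ [c Bc <-].
by exists c => //; exact: subset_trans AB Bc.
Qed.

Lemma leb_outer_sigma_subadditive : sigma_subadditive leb_outer.
Proof.
move=> A; have [[i ioo]|] := pselect (exists i, leb_outer (A i) = +oo).
  rewrite (eseries_pinfty _ _ ioo) ?leey// => k _.
  by rewrite -ltNye (lt_le_trans _ (leb_outer_ge0 _)).
rewrite -forallNE => Aoo.
suff add2e (e : {posnum R}) :
    leb_outer (\bigcup_k A k) <= \sum_(i <oo) leb_outer (A i) + e%:num%:E.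
  by apply/lee_addgt0Pr => _/posnumP[].
rewrite (le_trans _ (epsilon_trick _ _ _))//; last first.
  by move=> k; exact: leb_outer_ge0.
pose P k (B : nat -> cell) := cell_cover (A k) B /\
  \sum_(j <oo) cell_vol (B j) <= leb_outer (A k) + (e%:num / (2 ^ k.+1)%:R)%:E.
have [G PG] : {G : nat -> nat -> cell & forall k, P k (G k)}.
  apply: (@choice _ _ P) => k; rewrite /P /leb_outer.
  set S := (X in ereal_inf X); move infS : (ereal_inf S) => iS.
  case: iS infS => [r Sr|Soo|Soo].
  - have en1 : (0 < e%:num / (2 ^ k.+1)%:R)%R by [].
    have /(lb_ereal_inf_adherent en1) : ereal_inf S \is a fin_num by rewrite Sr.
    move=> [x [B AkB muBx] xS].
    by exists B; split => //; rewrite muBx -Sr; exact/ltW.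
  - by have := Aoo k; rewrite /leb_outer Soo.
  - have := leb_outer_ge0 (A k); rewrite /leb_outer -/S Soo.
    by rewrite leeNy_eq.
have G0 x : 0 <= (cell_vol \o uncurry G) x by exact: cell_vol_ge0.
apply: (@le_trans _ _ (\esum_(i in setT) (cell_vol \o uncurry G) i)).
  apply: ereal_inf_lbound => /=.
  have /card_esym/ppcard_eqP[f] := card_nat2.
  exists (uncurry G \o f).
    move=> t [i _] /((PG i).1) -[j _ Gij]; exists (f^-1%FUN (i, j)) => //=.
    by rewrite invK ?inE.
  rewrite -(esum_pred_image (cell_vol \o uncurry G) _ xpredT) ?[fun=> _]set_true//.
  by rewrite image_eq.
rewrite (_ : esum _ _ = \sum_(i <oo) \sum_(j <oo) cell_vol (G i j)); last first.
  pose J : nat -> set (nat * nat) := fun i => [set (i, j) | j in setT].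
  rewrite (_ : setT = \bigcup_k J k); last first.
    by rewrite predeqE => -[a b]; split => // _; exists a => //; exists b.
  rewrite esum_bigcupT /=; last 2 first.
    - apply/trivIsetP => i j _ _ ij.
      rewrite predeqE => -[k m] /=; split => //= -[] [_] _ [<-{k} _].
      by move=> [m' _] [] /esym/eqP; rewrite (negbTE ij).
    - by move=> /= [k m]; exact: cell_vol_ge0.
  rewrite -(image_id [set: nat]) -fun_true esum_pred_image//; last first.
    by move=> k _; apply: esum_ge0 => x _; exact: G0.
  apply: eq_eseriesr => /= j _.
  rewrite -(esum_pred_image (cell_vol \o uncurry G) (pair j) predT)//=; last first.
    by move=> ? ? _ _; exact: (@can_inj _ _ _ snd).
    by move=> k _; exact: cell_vol_ge0.
  by congr esum; rewrite predeqE => -[a b]; split; move=> [i _ <-]; exists i.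
apply: lee_lim.
- apply: is_cvg_nneseries => k *.
  by apply: nneseries_ge0 => m *; exact: (G0 (k, m)).
- by apply: is_cvg_nneseries => k *; apply: adde_ge0 => //; exact: leb_outer_ge0.
- by near=> k; apply: lee_sum => i _; exact: (PG i).2.
Unshelve. all: by end_near. Qed.

HB.instance Definition _ := isOuterMeasure.Build R 'rV[R]_n leb_outer
  leb_outer0 leb_outer_ge0 le_leb_outer leb_outer_sigma_subadditive.

End lebesgue_rV.

Definition lebesgue_outer (R : realType) (n : nat) :
  {outer_measure set 'rV[R]_n -> \bar R} := leb_outer.

Notation lebT R n := (caratheodory_type (lebesgue_outer R n)).

(* Lebesgue measure on R^n, on the sigma-algebra of Lebesgue (Caratheodory)
   measurable sets. *)
Definition leb (R : realType) (n : nat) : {measure set (lebT R n) -> \bar R} :=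
  (lebesgue_outer R n : set (lebT R n) -> \bar R).

Section smooth.
Context {R : realType} {n : nat}.

Definition partial (W : normedModType R) (i : 'I_n) (f : 'rV[R]_n -> W) :
    'rV[R]_n -> W :=
  'D_(delta_mx ord0 i) f.

Fixpoint Ck_on (W : normedModType R) (r : nat) (U : set 'rV[R]_n)
    (f : 'rV[R]_n -> W) : Prop :=
  {within U, continuous f} /\
  if r is r'.+1 then
    forall i : 'I_n, (forall x, U x -> derivable f x (delta_mx ord0 i)) /\
      Ck_on r' U (partial i f)
  else True.

Definition smooth_on (W : normedModType R) (U : set 'rV[R]_n)
    (f : 'rV[R]_n -> W) : Prop :=
  forall r, Ck_on r U f.

(* Row i is the i-th partial derivative. *)
Definition jac k (f : 'rV[R]_n -> 'rV[R]_k) (y : 'rV[R]_n) : 'M[R]_(n, k) :=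
  \matrix_(i < n) partial i f y.

Definition gram k (f : 'rV[R]_n -> 'rV[R]_k) (y : 'rV[R]_n) : 'M[R]_n :=
  jac f y *m (jac f y)^T.

End smooth.

Section orlicz_sobolev.
Context {R : realType} {n : nat}.
Implicit Types (V : set 'rV[R]_n) (f g : 'rV[R]_n -> R) (P : R -> R).
Local Open Scope ereal_scope.

Definition loc_integrable V f : Prop :=
  measurable_fun (V : set (lebT R n)) (f : lebT R n -> R) /\
  forall K : set 'rV[R]_n, compact K -> K `<=` V ->
    \int[leb R n]_(x in K) `|f x|%:E < +oo.

Definition test_function V (phi : 'rV[R]_n -> R) : Prop :=
  smooth_on setT phi /\
  exists K : set 'rV[R]_n,
    [/\ compact K, K `<=` V & forall x, ~ K x -> phi x = 0%R].

Definition is_weak_partial V (i : 'I_n) f g : Prop :=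
  loc_integrable V g /\
  forall phi, test_function V phi ->
    \int[leb R n]_(x in V) (f x * partial i phi x)%:E =
    - \int[leb R n]_(x in V) (g x * phi x)%:E.

Definition weakly_differentiable V f : Prop :=
  loc_integrable V f /\ forall i, exists g, is_weak_partial V i f g.

(* Weak derivatives are unique up to null sets; the default value 0 is never
   reached when f is weakly differentiable. *)
Definition weak_partial V (i : 'I_n) f : 'rV[R]_n -> R :=
  xget (fun=> 0%R) [set g | is_weak_partial V i f g].

Definition luxemburg P V f : \bar R :=
  ereal_inf [set k%:E | k in [set k : R | (0 < k)%R /\
    \int[leb R n]_(x in V) (P (`|f x| / k)%R)%:E <= 1]].

Definition W1P_norm P V f : \bar R :=
  \int[leb R n]_(x in V) `|f x|%:E +
  \sum_(i < n) luxemburg P V (weak_partial V i f).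

Definition in_W1P P V f : Prop :=
  weakly_differentiable V f /\ W1P_norm P V f < +oo.

End orlicz_sobolev.

Section riemannian_manifold.
Context {R : realType}.

(* [chart_param] is the inverse of [chart_coord] on the open set
   [chart_img]; the values of the two maps elsewhere are irrelevant. *)
Record chart (X : topologicalType) (n : nat) := Chart {
  chart_dom : set X;
  chart_coord : X -> 'rV[R]_n;
  chart_param : 'rV[R]_n -> X }.

Definition chart_img X n (c : chart X n) : set 'rV[R]_n :=
  chart_coord c @` chart_dom c.

Definition is_chart X n (c : chart X n) : Prop :=
  [/\ open (chart_dom c), open (chart_img c),
      {in chart_dom c, cancel (chart_coord c) (chart_param c)},
      {within chart_dom c, continuous (chart_coord c)} &
      {within chart_img c, continuous (chart_param c)}].

Definition transition X n (c d : chart X n) : 'rV[R]_n -> 'rV[R]_n :=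
  chart_coord d \o chart_param c.

Definition transition_dom X n (c d : chart X n) : set 'rV[R]_n :=
  chart_coord c @` (chart_dom c `&` chart_dom d).

(* Data of a Riemannian manifold of dimension n; [metric c y] is the matrix
   (g_ij) of the metric in the chart c at the point with coordinates y. *)
Record riemData (n : nat) := RiemData {
  carrier :> topologicalType;
  atlas : set (chart carrier n);
  metric : chart carrier n -> 'rV[R]_n -> 'M[R]_n }.
Arguments atlas {n} r.
Arguments metric {n} r.

(* Axioms of a compact smooth Riemannian manifold without boundary (second
   countability follows from compactness). *)
Record compact_riemannian n (M : riemData n) : Prop := CompactRiemannian {
  mfd_hausdorff : hausdorff_space M;
  mfd_compact : compact [set: M];
  mfd_chart : forall c, atlas M c -> is_chart c;
  mfd_cover : \bigcup_(c in atlas M) chart_dom c = [set: M];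
  mfd_smooth : forall c d, atlas M c -> atlas M d ->
    smooth_on (transition_dom c d) (transition c d);
  metric_smooth : forall c, atlas M c -> smooth_on (chart_img c) (metric M c);
  metric_sym : forall c y, atlas M c -> chart_img c y ->
    (metric M c y)^T = metric M c y;
  metric_pos : forall c y (v : 'rV[R]_n), atlas M c -> chart_img c y -> v != 0 ->
    0 < (v *m metric M c y *m v^T) ord0 ord0;
  metric_change : forall c d y, atlas M c -> atlas M d ->
    transition_dom c d y ->
    metric M c y = jac (transition c d) y *m metric M d (transition c d y) *m
                   (jac (transition c d) y)^T }.

Definition smooth_map n m (M : riemData n) (N : riemData m) (f : M -> N) : Prop :=
  continuous f /\
  forall c d, atlas M c -> atlas N d ->
    smooth_on (chart_coord c @` (chart_dom c `&` f @^-1` chart_dom d))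
              (chart_coord d \o f \o chart_param c).

Record isometric_embedding m k (N : riemData m) (j : N -> 'rV[R]_k) : Prop :=
  IsometricEmbedding {
    emb_smooth : forall c, atlas N c ->
      smooth_on (chart_img c) (j \o chart_param c);
    emb_isometric : forall c y, atlas N c -> chart_img c y ->
      gram (j \o chart_param c) y = metric N c y;
    emb_inj : injective j;
    emb_continuous : continuous j;
    emb_open : forall A : set N, open A ->
      exists2 B : set 'rV[R]_k, open B & A = j @^-1` B }.

End riemannian_manifold.
Arguments riemData R n : clear implicits.
Arguments atlas {R n} r.
Arguments metric {R n} r.

Section manifold_sobolev.
Context {R : realType} {n : nat} (M : riemData R n).

(* Finitely many coordinate patches, relatively compact in the domains of
   charts of the atlas and covering M. On a compact manifold two such families
   define the same space W^{1,P}, with equivalent norms. *)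
Record coord_cover := CoordCover {
  cover_size : nat;
  cover_chart : 'I_cover_size -> chart M n;
  cover_patch : 'I_cover_size -> set 'rV[R]_n;
  cover_atlas : forall j, atlas M (cover_chart j);
  cover_open : forall j, open (cover_patch j);
  cover_compact : forall j, compact (closure (cover_patch j));
  cover_sub : forall j, closure (cover_patch j) `<=` chart_img (cover_chart j);
  cover_all : \bigcup_j (chart_param (cover_chart j) @` cover_patch j) = setT }.

Definition W1P_normM (C : coord_cover) (P : R -> R) k (u : M -> 'rV[R]_k) : \bar R :=
  (\sum_(j < cover_size C) \sum_(a < k) W1P_norm P (cover_patch j)
     (fun y => u (chart_param (cover_chart j) y) ord0 a))%E.

Definition in_W1PM (C : coord_cover) (P : R -> R) k (u : M -> 'rV[R]_k) : Prop :=
  forall (j : 'I_(cover_size C)) (a : 'I_k), in_W1P P (cover_patch j)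
     (fun y => u (chart_param (cover_chart j) y) ord0 a).

Definition null_set (A : set M) : Prop :=
  forall c, atlas M c -> (leb R n).-negligible (chart_coord c @` (A `&` chart_dom c)).

Definition in_W1PMN (C : coord_cover) (P : R -> R) m k (N : riemData R m)
    (j : N -> 'rV[R]_k) (u : M -> 'rV[R]_k) : Prop :=
  in_W1PM C P u /\ null_set [set x | ~ range j (u x)].

End manifold_sobolev.

Section homotopy.
Context (R : realType).

Definition homotopic_rel (X Y : topologicalType) (A B : set X) (f g : X -> Y) :=
  exists H : R * X -> Y,
    [/\ {within (`[0, 1] : set R) `*` A, continuous H},
        forall x, A x -> H (0, x) = f x,
        forall x, A x -> H (1, x) = g x &
        forall t x, 0 <= t <= 1 -> B x -> H (t, x) = f x].

Definition homotopic (X Y : topologicalType) (f g : X -> Y) :=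
  homotopic_rel setT set0 f g.

Definition cube (n : nat) : set 'rV[R]_n := [set x | forall i, 0 <= x ord0 i <= 1].

Definition cube_boundary (n : nat) : set 'rV[R]_n :=
  [set x | @cube n x /\ exists i, x ord0 i = 0 \/ x ord0 i = 1].

(* Maps (I^n, dI^n) -> (Y, y); only their restrictions to I^n matter. *)
Definition nloop (n : nat) (Y : topologicalType) (y : Y) (f : 'rV[R]_n -> Y) :=
  {within @cube n, continuous f} /\ forall x, @cube_boundary n x -> f x = y.

Definition pi_trivial_at (n : nat) (Y : topologicalType) (y : Y) : Prop :=
  forall f : 'rV[R]_n -> Y, nloop y f ->
    homotopic_rel (@cube n) (@cube_boundary n) f (cst y).

Definition pi_trivial (n : nat) (Y : topologicalType) : Prop :=
  forall y : Y, pi_trivial_at n y.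

End homotopy.

Section sphere.
Context (R : realType) (n : nat).

Definition sqnorm k (x : 'rV[R]_k) : R := \sum_(i < k) x ord0 i ^+ 2.

Definition unit_sphere : set 'rV[R]_n.+1 := [set x | sqnorm x = 1].

(* Inverse of the stereographic projection from the pole ((-1)^s, 0, ..., 0)
   onto the hyperplane x_0 = 0. *)
Definition stereo_inv_val (s : bool) (y : 'rV[R]_n) : 'rV[R]_n.+1 :=
  \row_i (if unlift ord0 i is Some j then 2 * y ord0 j / (sqnorm y + 1)
          else (-1) ^+ s * (sqnorm y - 1) / (sqnorm y + 1)).

Lemma stereo_inv_subproof s y : unit_sphere (stereo_inv_val s y).
Proof.
have d0 : sqnorm y + 1 != 0.
  by rewrite gt_eqF// ltr_wpDl// sumr_ge0// => i _; rewrite sqr_ge0.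
rewrite /unit_sphere /= {1}/sqnorm big_ord_recl mxE unlift_none.
under eq_bigr => i _ do rewrite mxE liftK -mulrA mulrCA exprMn.
rewrite -big_distrl /= -/(sqnorm y) !exprMn sqrr_sign mul1r exprVn.
rewrite mulrA -mulrDl -[RHS](mulfV (expf_neq0 2 d0)); congr (_ / _).
by rewrite sqrrB sqrrD !mulr1 !expr1n -mulr_natr; ring.
Qed.

Definition stereo_inv (s : bool) (y : 'rV[R]_n) : unit_sphere :=
  exist _ (stereo_inv_val s y) (mem_set (stereo_inv_subproof s y)).

Definition stereo_chart (s : bool) : chart unit_sphere n :=
  let v (x : unit_sphere) : 'rV[R]_n.+1 := set_val x in {|
  chart_dom := [set x | v x ord0 ord0 != (-1) ^+ s];
  chart_coord := fun x => \row_i (v x ord0 (lift ord0 i) /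
                                  (1 - (-1) ^+ s * v x ord0 ord0));
  chart_param := stereo_inv s |}.

Definition sphere : riemData R n := {|
  carrier := unit_sphere;
  atlas := range stereo_chart;
  metric := fun c => gram (fun y => set_val (chart_param c y)) |}.

End sphere.

Section young.
Context {R : realType}.

(* Only the restriction of P to [0, +oo[ is meaningful; P >= 0 there follows
   from P 0 = 0 and monotonicity. *)
Definition young_function (P : R -> R) : Prop :=
  [/\ P 0 = 0,
      {in >= 0 &, forall x y, x < y -> P x < P y} &
      convex_function (`[0, +oo[%classic : set R) P].

End young.

(* Main.v *)
(* (a) If two smooth maps are close to u in W^{1,P}, their difference g in a
   chart has small Orlicz energy. On the boundary of the cubes {|x - y| = r},
   for a suitable r in [r0, 2 r0], this makes g uniformly small: nested
   intervals yield a radius r near which the energy decays geometrically, and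
   then the means of g over shrinking cubes around a boundary point telescope;
   the growth P(t) >= c t^alpha with alpha > n - 1 makes the series converge.
   So u1 and u2 are close on the boundaries of finitely many coordinate cubes
   covering M. A short homotopy makes them equal there, and since pi_n(N) = 0
   one map can be deformed into the other inside each cube, one after another.
   (b) A homotopically nontrivial map R^n -> N, constant outside a ball, is
   smoothed and concentrated by x |-> k x at a point of S^n; since
   P(t) = o(t^n), its energy k^-n P(Lk/e) tends to 0. *)

(* The exponent n is critical for continuity in dimension n and P lies below it, so closeness in
   W^{1,P} gives no uniform closeness on open sets; on the (n - 1)-dimensional boundary of a cube
   the critical exponent is n - 1 < alpha. No measure on the boundary and no trace enters: energy is
   measured in dimension n only, and a boundary is good if the energy of the layers of width m^-j
   around it decays like (m - 2)^-j, almost as fast as their width. The gap alpha > n - 1 absorbs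
   the loss from m to m - 2 once m is large. The map u has no values on such boundaries; it only
   serves to bound the difference of u1 and u2, which is C^1 in charts. The norm is built from an
   arbitrarily chosen weak derivative, so it speaks about C^1 functions only through almost
   everywhere uniqueness; this is the reason for the measure theory at the start. In (b) a free
   null-homotopy of a map of the sphere must be turned into one relative to the complement of a
   disk, because pi_n is based; extending the map over the ball achieves this. *)
Require Import Defs.
From HB Require Import structures.
From mathcomp Require Import all_boot all_order all_algebra.
From mathcomp Require Import all_classical all_reals all_analysis.
From mathcomp Require Import ring lra measurable_realfun.

Set Implicit Arguments.
Unset Strict Implicit.
Unset Printing Implicit Defensive.

Import Order.TTheory GRing.Theory Num.Theory.
Import numFieldNormedType.Exports.

Local Open Scope classical_set_scope.
Local Open Scope ring_scope.

(** * Lebesgue measure of open sets and dilations *)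

Section row_norm.
Context {R : realType} {n : nat}.
Implicit Types (x y : 'rV[R]_n) (r : R).

Lemma row_coord_le x i : `|x ord0 i| <= `|x|.
Proof.
rewrite [leRHS]/Num.norm/= mx_normrE.
exact: (le_bigmax _ (fun ij : 'I_1 * 'I_n => `|x ij.1 ij.2|) (ord0, i)).
Qed.

Lemma row_norm_leP x r : 0 <= r -> (`|x| <= r) <-> (forall i, `|x ord0 i| <= r).
Proof.
move=> r0; split=> [xr i|xr]; first exact: le_trans (row_coord_le x i) xr.
rewrite [leLHS]/Num.norm/= mx_normrE; apply: bigmax_le => // -[i j] _ /=.
by rewrite ord1.
Qed.

Lemma row_norm_ltP x r : 0 < r -> (`|x| < r) <-> (forall i, `|x ord0 i| < r).
Proof.
move=> r0; split=> [xr i|xr]; first exact: le_lt_trans (row_coord_le x i) xr.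
rewrite [ltLHS]/Num.norm/= mx_normrE; apply: bigmax_lt => // -[i j] _ /=.
by rewrite ord1.
Qed.

Lemma ball_rowE x r : ball x r = [set y | `|x - y| < r].
Proof. by rewrite -ball_normE. Qed.

Lemma row_continuous (T : topologicalType) (f : T -> 'rV[R]_n) (t : T) :
  (forall i, {for t, continuous (fun s => f s ord0 i)}) -> {for t, continuous f}.
Proof.
move=> cf; apply/cvgrPdist_lt => e e0.
have : \forall s \near t, forall i, `|f t ord0 i - f s ord0 i| < e.
  by apply: filter_forall => i; move/cvgrPdist_lt : (cf i); exact.
by apply: filterS => s H; apply/row_norm_ltP => // i; rewrite !mxE.
Qed.

Lemma row_coord_continuous i : continuous (fun x : 'rV[R]_n => x ord0 i).
Proof. by move=> x; exact: coord_continuous. Qed.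

End row_norm.

Section leb_measurable.
Context {R : realType} {n : nat}.
Local Open Scope ereal_scope.

Definition row_set (a : 'rV[R]_n) (i : 'I_n) (c : R) : 'rV[R]_n :=
  \row_j (if j == i then c else a ord0 j).

(** The [min] and [max] make the cut valid for every position of [c], also when the hyperplane
    misses the cell; additivity is an identity between the i-th factors of the products. *)
Lemma cell_vol_split (a b : 'rV[R]_n) i (c : R) :
  cell_vol (Some (a, row_set b i (Num.min (b ord0 i) c))) +
  cell_vol (Some (row_set a i (Num.max (a ord0 i) c), b)) =
  cell_vol (Some (a, b)).
Proof.
rewrite /= -EFinD; congr (_%:E).
rewrite (bigD1 i)//= [X in (_ + X)%R](bigD1 i)//= [RHS](bigD1 i)//=.
rewrite !mxE !eqxx.
rewrite (eq_bigr (fun j => Num.max 0 (b ord0 j - a ord0 j))%R); last first.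
  by move=> j ji; rewrite mxE (negbTE ji).
rewrite [X in (_ + _ * X)%R](eq_bigr (fun j =>
    Num.max 0 (b ord0 j - a ord0 j))%R); last first.
  by move=> j ji; rewrite mxE (negbTE ji).
rewrite -mulrDl; congr (_ * _)%R.
move: (a ord0 i) (b ord0 i) => x y.
by case: (leP y c) => ?; case: (leP x c) => ?; do ![case: leP => ?]; lra.
Qed.

(** Cutting every cell of a cover of X along the hyperplane gives covers of the two parts of X with
    the same total volume, which is Caratheodory's criterion. *)
Lemma halfspace_measurable (i : 'I_n) (c : R) :
  measurable ([set x | x ord0 i < c]%R : set (lebT R n)).
Proof.
apply: le_caratheodory_measurable => X.
apply: le_ereal_inf_tmp => _ [C XC <-].
pose lo (k : nat) : cell := if C k is Some ab then
  Some (ab.1, row_set ab.2 i (Num.min (ab.2 ord0 i) c)) else None.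
pose hi (k : nat) : cell := if C k is Some ab then
  Some (row_set ab.1 i (Num.max (ab.1 ord0 i) c), ab.2) else None.
have -> : \sum_(k <oo) cell_vol (C k) =
    \sum_(k <oo) cell_vol (lo k) + \sum_(k <oo) cell_vol (hi k).
  rewrite -nneseriesD; last 2 first.
    by move=> k _ _; exact: cell_vol_ge0.
    by move=> k _ _; exact: cell_vol_ge0.
  apply: eq_eseriesr => k _; rewrite /lo /hi; case: (C k) => [[a b]|].
    exact/esym/cell_vol_split.
  by rewrite /= adde0.
apply: leeD; apply: ereal_inf_lbound.
  exists lo => // x [Xx xc]; have [k _ Ckx] := XC _ Xx; exists k => //.
  move: Ckx; rewrite /lo; case: (C k) => //= -[a b] /= H j; rewrite mxE.
  by case: eqP => [->|_]; rewrite ?lt_min ?xc ?andbT; exact: H.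
exists hi => // x [Xx /negP xc]; have [k _ Ckx] := XC _ Xx; exists k => //.
move: xc; rewrite -leNgt => xc.
move: Ckx; rewrite /hi; case: (C k) => //= -[a b] /= H j; rewrite mxE.
by case: eqP => [->|_]; rewrite ?ge_max ?xc ?andbT; exact: H.
Qed.

Lemma measurable_row_coord (i : 'I_n) :
  measurable_fun setT (fun x : lebT R n => (x : 'rV[R]_n) ord0 i).
Proof.
apply: (measurability _ (@RGenOInfty.measurableE R)) => /= _ [_ [c ->] <-].
rewrite setTI.
(* The half-spaces at hand are x_i < c, so x_i > c is the complement of the intersection of the
   half-spaces x_i < c + 1 / (k + 1). *)
rewrite (_ : _ @^-1` _ = ~` (\bigcap_k [set x : 'rV[R]_n |
    x ord0 i < c + k.+1%:R^-1]%R)).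
  apply: measurableC; apply: bigcapT_measurable => k.
  exact: halfspace_measurable.
apply/seteqP; split => x /=; rewrite in_itv/= andbT.
  move=> cx /(_ (Num.truncn (x ord0 i - c)^-1) I) /=.
  apply/negP; rewrite -leNgt -lerBrDl.
  have xc : (0 < x ord0 i - c)%R by rewrite subr_gt0.
  rewrite -[leRHS]invrK lef_pV2 ?posrE ?invr_gt0//.
  exact/ltW/truncnS_gt.
apply: contra_notT; rewrite -leNgt => xc k _ /=.
by rewrite (le_lt_trans xc)// ltrDl invr_gt0.
Qed.

Lemma ball_leb_measurable (x : 'rV[R]_n) (r : R) :
  measurable (ball x r : set (lebT R n)).
Proof.
have [r0|r0] := ltP 0%R r; last first.
  rewrite (_ : ball x r = set0)//; apply/seteqP; split => // y.
  by rewrite ball_rowE/= => /(le_lt_trans (normr_ge0 _)); rewrite ltNge r0.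
rewrite (_ : ball x r = \bigcap_(i in [set: 'I_n])
  ((fun z : 'rV[R]_n => z ord0 i) @^-1` `]x ord0 i - r, x ord0 i + r[)%R).
  apply: fin_bigcap_measurable; first exact: finite_finset.
  by move=> i _; rewrite -[X in measurable X]setTI;
    apply: measurable_row_coord => //; exact: measurable_itv.
apply/seteqP; split => y; rewrite ball_rowE/=.
  move=> /(row_norm_ltP _ r0) + i _ => /(_ i).
  by rewrite /= in_itv/= !mxE ltr_norml => /andP[? ?]; apply/andP; split; lra.
move=> H; apply/(row_norm_ltP _ r0) => i; move: (H i I) => /=.
by rewrite in_itv/= !mxE ltr_norml => /andP[? ?]; apply/andP; split; lra.
Qed.

(** Balls of the sup norm are boxes, hence measurable; those inside U with rational centre and
    radius 1 / (k + 1) are countably many and fill U. *)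
Lemma open_leb_measurable (U : set 'rV[R]_n) : open U ->
  measurable (U : set (lebT R n)).
Proof.
move=> oU.
pose B (qk : 'rV[rat]_n * nat) : set (lebT R n) :=
  ball (map_mx ratr qk.1 : 'rV[R]_n) (qk.2.+1%:R^-1)%R.
pose F qk := if `[< B qk `<=` U >] then B qk else set0.
rewrite (_ : U = \bigcup_qk F qk).
  apply: countable_bigcupT_measurable => // qk; rewrite /F.
  by case: ifP => // _; exact: ball_leb_measurable.
apply/seteqP; split => [x Ux|x [qk _]]; last first.
  by rewrite /F; case: ifPn => // /asboolP; apply.
have /nbhs_ballP[e /= e0 xeU] := open_nbhs_nbhs (conj oU Ux).
pose k := Num.truncn (2 / e)%R.
have ke : (k.+1%:R^-1 * 2 <= e)%R.
  rewrite -ler_pdivlMr// -[leRHS]invrK lef_pV2 ?posrE ?invr_gt0 ?divr_gt0//.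
  by rewrite invf_div; exact/ltW/truncnS_gt.
have k0 : (0 < k.+1%:R^-1 :> R)%R by rewrite invr_gt0.
have qP i : exists q : rat, (`|ratr q - x ord0 i| < k.+1%:R^-1)%R.
  have /rat_in_itvoo[q] : (x ord0 i - k.+1%:R^-1 < x ord0 i + k.+1%:R^-1)%R.
    by rewrite ltrBlDr -addrA ltrDl addr_gt0.
  by rewrite in_itv/= => q12; exists q; rewrite ltr_distl.
have [q qx] := choice qP.
exists (\row_i q i, k) => //; rewrite /F ifT.
  rewrite /B/= ball_rowE/=; apply/(row_norm_ltP _ k0) => i; rewrite !mxE.
  exact: qx.
apply/asboolP => y; rewrite /B/= => By; apply: xeU.
rewrite ball_rowE/=; apply: lt_le_trans ke.
rewrite ball_rowE/= in By.
rewrite mulr_natr mulr2n -(subrKA (map_mx ratr (\row_i q i))).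
apply: (le_lt_trans (ler_normD _ _)); apply: ltrD => //.
by apply/(row_norm_ltP _ k0) => i; rewrite !mxE distrC; exact: qx.
Qed.

Lemma continuous_leb_measurable (U : set 'rV[R]_n) (f : 'rV[R]_n -> R) :
  open U -> (forall x, U x -> {for x, continuous f}) ->
  measurable_fun (U : set (lebT R n)) (f : lebT R n -> R).
Proof.
move=> oU fU.
apply: (measurability _ (@RGenOInfty.measurableE R)) => /= _ [_ [c ->] <-].
apply: open_leb_measurable; rewrite openE => x [Ux].
rewrite /= in_itv/= andbT => cfx.
apply: filterI; first exact: open_nbhs_nbhs.
apply: filterS (cvgr_gt _ (fU x Ux) _ cfx) => y.
by rewrite /= in_itv/= andbT.
Qed.

End leb_measurable.

(** * Behaviour of the measure under dilations *)

Section leb_affine.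
Context {R : realType} {n : nat}.
Local Open Scope ereal_scope.
Implicit Types (x z : 'rV[R]_n) (d : R) (A : set 'rV[R]_n).

Definition dilate x d z : 'rV[R]_n := (x + d *: z)%R.

Lemma dilateK x d : d != 0%R -> cancel (dilate x d) (dilate (- (d^-1 *: x)) d^-1).
Proof.
move=> d0 z; rewrite /dilate scalerDr scalerA mulVf// scale1r addrA.
by rewrite addNr add0r.
Qed.

Lemma dilateVK x d : d != 0%R -> cancel (dilate (- (d^-1 *: x)) d^-1) (dilate x d).
Proof.
move=> d0 z; rewrite /dilate scalerDr scalerN !scalerA mulfV// !scale1r addrA.
by rewrite subrr add0r.
Qed.

Lemma leb_outer_dilate_le x d A : (0 < d)%R ->
  leb_outer (dilate x d @` A) <= (d ^+ n)%:E * leb_outer A.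
Proof.
move=> d0; rewrite -lee_pdivrMl ?exprn_gt0//.
apply: le_ereal_inf_tmp => _ [C AC <-].
rewrite lee_pdivrMl ?exprn_gt0//.
pose C' k : cell := if C k is Some ab then
  Some (dilate x d ab.1, dilate x d ab.2) else None.
rewrite -nneseriesZl; last by move=> k _; exact: cell_vol_ge0.
apply: ereal_inf_lbound; exists C'.
  move=> _ [z Az <-]; have [k _ Ckz] := AC _ Az; exists k => //.
  move: Ckz; rewrite /C'; case: (C k) => //= -[a b] /= H j; rewrite !mxE.
  have /andP[azj zbj] := H j.
  by rewrite lerD2l ltrD2l ler_pM2l// ltr_pM2l// azj.
apply: eq_eseriesr => k _; rewrite /C'; case: (C k) => [[a b]|]/=; last first.
  by rewrite mule0.
rewrite -EFinM; congr (_%:E).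
under eq_bigr do rewrite !mxE.
have -> : (d ^+ n = \prod_(i < n) d)%R by rewrite prodr_const card_ord.
rewrite -big_split/=.
apply: eq_bigr => i _.
rewrite opprD addrACA subrr add0r -mulrBr -[X in Num.max X _](mulr0 d).
by rewrite maxr_pMr// ltW.
Qed.

(** The bound for images is applied twice, to the dilation and to its inverse, which gives the two
    inequalities. *)
Lemma leb_outer_dilate x d A : (0 < d)%R ->
  leb_outer (dilate x d @^-1` A) = ((d ^+ n)^-1)%:E * leb_outer A.
Proof.
move=> d0; have dn0 := lt0r_neq0 d0; have dd0 : (0 < d^-1)%R by rewrite invr_gt0.
have AE : dilate x d @^-1` A = dilate (- (d^-1 *: x))%R d^-1 @` A.
  apply/seteqP; split => [z Az|_ [z Az <-]]; last by rewrite /= dilateVK.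
  by exists (dilate x d z) => //; rewrite dilateK.
apply/eqP; rewrite eq_le; apply/andP; split.
  by rewrite AE -exprVn; exact: leb_outer_dilate_le.
rewrite lee_pdivrMl ?exprn_gt0//.
apply: le_trans (leb_outer_dilate_le x _ d0); apply: le_leb_outer => z Az.
by exists (dilate (- (d^-1 *: x))%R d^-1 z); rewrite /= dilateVK.
Qed.

(** With T the inverse dilation, Caratheodory's criterion for A on the test set T^-1(X) is d^n times
    the criterion for the preimage of A on the test set X. *)
Lemma measurable_dilate x d : (0 < d)%R ->
  measurable_fun setT (dilate x d : lebT R n -> lebT R n).
Proof.
move=> d0 _ A mA; rewrite setTI.
have dn0 := lt0r_neq0 d0.
have dd0 : (0 < d^-1)%R by rewrite invr_gt0.
pose T := dilate (- (d^-1 *: x))%R d^-1.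
move=> X; have := mA (T @^-1` X).
have E B : lebesgue_outer R n (T @^-1` B) = (d ^+ n)%:E * lebesgue_outer R n B.
  by rewrite /T [LHS]leb_outer_dilate// exprVn invrK.
have E1 : T @^-1` X `&` A = T @^-1` (X `&` dilate x d @^-1` A).
  by apply/seteqP; split => z /=; rewrite /T dilateVK.
have E2 : T @^-1` X `&` ~` A = T @^-1` (X `&` ~` (dilate x d @^-1` A)).
  by apply/seteqP; split => z /=; rewrite /T dilateVK.
rewrite /= in E1 E2 *; rewrite E1 E2 !E.
rewrite -ge0_muleDr// => /(congr1 (mule (d ^+ n)^-1%:E)).
by rewrite !muleA -!EFinM mulVf ?expf_neq0// !mul1e.
Qed.

Lemma integral_dilate x d (D : set 'rV[R]_n) (f : 'rV[R]_n -> R) : (0 < d)%R ->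
  measurable (D : set (lebT R n)) ->
  measurable_fun (D : set (lebT R n)) (f : lebT R n -> R) ->
  (forall y, D y -> 0 <= f y)%R ->
  \int[leb R n]_(y in D) (f y)%:E =
  (d ^+ n)%:E * \int[leb R n]_(z in dilate x d @^-1` D) (f (dilate x d z))%:E.
Proof.
move=> d0 mD mf f0.
have dn0 := lt0r_neq0 d0.
have mdl := @measurable_dilate x d d0.
have := @ge0_integral_pushforward _ _ _ _ _ _ mdl (leb R n) D (EFin \o f) mD.
move=> H; rewrite -H; last 2 first.
- exact/measurable_EFinP.
- by move=> y /set_mem Dy; rewrite /= lee_fin; exact: f0.
have dne : (0 <= (d ^+ n)^-1)%R by rewrite invr_ge0 exprn_ge0// ltW.
have -> : \int[pushforward (leb R n) (dilate x d : lebT R n -> lebT R n)]_(y in D)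
    (EFin \o f) y =
  \int[mscale (NngNum dne) (leb R n)]_(y in D) (EFin \o f) y.
  apply: eq_measure_integral => A mA AD; rewrite /pushforward /mscale/=.
  exact: leb_outer_dilate.
rewrite ge0_integral_mscale//; last exact/measurable_EFinP.
by rewrite muleA -EFinM mulfV ?expf_neq0// mul1e.
Qed.

End leb_affine.

(** * The measure is positive and finite on balls *)

Section leb_cube.
Context {R : realType}.
Local Open Scope ereal_scope.

(* Integrating over the first coordinate: for each t in [0, 1] the slices at t
   of the cells cover the cube of dimension n. *)
Lemma unit_cube_cover_vol n (C : nat -> @cell R n) :
  [set x : 'rV[R]_n | forall i, 0 <= x ord0 i <= 1]%R `<=`
    \bigcup_k cell_set (C k) ->
  1 <= \sum_(k <oo) cell_vol (C k).
Proof.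
elim: n C => [|n IH] C cov.
  (* In dimension 0 the single point lies in some cell other than [None], whose volume is the empty
     product 1. *)
  have [k _ Ck] := cov 0%R (fun i => match i with Ordinal _ Hi =>
    match notF Hi with end end).
  rewrite (le_trans _ (nneseries_lim_ge k.+1 _))//; last first.
    by move=> j _ _; exact: cell_vol_ge0.
  rewrite big_nat_recr//= (@le_trans _ _ (cell_vol (C k)))//.
    by move: Ck; case: (C k) => //= ab _; rewrite big_ord0.
  rewrite leeDr// sume_ge0// => j _; exact: cell_vol_ge0.
pose lc (a : 'rV[R]_n.+1) : 'rV[R]_n := \row_i a ord0 (lift ord0 i).
pose S (t : R) k : cell := if C k is Some ab then
  if (ab.1 ord0 ord0 <= t < ab.2 ord0 ord0)%R then Some (lc ab.1, lc ab.2)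
  else None else None.
pose v k : \bar R := if C k is Some ab then cell_vol (Some (lc ab.1, lc ab.2))
  else 0.
pose I k : set R := if C k is Some ab then
  `[ab.1 ord0 ord0, ab.2 ord0 ord0[%classic else set0.
have v0 k : 0 <= v k by rewrite /v; case: (C k) => // ab; exact: cell_vol_ge0.
have mI k : measurable (I k) by rewrite /I; case: (C k) => // ab.
have vfin k : v k \is a fin_num by rewrite /v; case: (C k).
have SE t k : cell_vol (S t k) = v k * (\1_(I k) t)%:E.
  rewrite /S /v /I; case: (C k) => [[a b]|]; last by rewrite mul0e.
  rewrite /= indicE; case: ifPn => ab.
    by rewrite mem_set ?mule1//= in_itv.
  by rewrite memNset ?mule0//= in_itv; exact/negP.
have S1 (t : R) : (0 <= t <= 1)%R -> 1 <= \sum_(k <oo) v k * (\1_(I k) t)%:E.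
  move=> t01; under eq_eseriesr do rewrite -SE.
  apply: IH => y y01.
  pose x : 'rV[R]_n.+1 := \row_i (if unlift ord0 i is Some j then y ord0 j else t).
  have [i|k _ Ckx] := cov x.
    by rewrite mxE; case: unliftP => [j _|_].
  exists k => //; move: Ckx; rewrite /S; case: (C k) => [[a b]|//] /= H.
  have := H ord0; rewrite !mxE unlift_none => -> /= j.
  by have := H (lift ord0 j); rewrite !mxE liftK.
have m01 : measurable (`[0%R, 1%R] : set R) by [].
have mfk k : measurable_fun (`[0%R, 1%R] : set R)
    (fun t : R => v k * (\1_(I k) t)%:E).
  apply: emeasurable_funM => //.
  by apply/measurable_EFinP; exact: measurable_indic.
have -> : (1 : \bar R) = \int[@lebesgue_measure R]_(t in `[0%R, 1%R]) cst 1 t.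
  by rewrite integral_cst//= lebesgue_measure_itv/= lte_fin ltr01 mul1e sube0.
apply: (@le_trans _ _
  (\int[lebesgue_measure]_(t in `[0%R, 1%R]) (\sum_(k <oo) v k * (\1_(I k) t)%:E))).
  apply: ge0_le_integral => //.
  - apply: ge0_emeasurable_sum => [k t _ _|k _]; last exact: mfk.
    by rewrite mule_ge0// lee_fin.
rewrite integral_nneseries//; last by move=> k t _; rewrite mule_ge0// lee_fin.
apply: lee_nneseries => [k _ _|k _].
  by apply: integral_ge0 => t _; rewrite mule_ge0// lee_fin.
have mind : measurable_fun (`[0%R, 1%R] : set R) (\1_(I k) : R -> R).
  exact: measurable_indic.
rewrite -(fineK (vfin k)) ge0_integralZl//; last 2 first.
- exact/measurable_EFinP.
- by rewrite fineK.
have -> := @integral_indic _ _ R lebesgue_measure _ m01 _ (mI k).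
rewrite (fineK (vfin k)).
apply: (@le_trans _ _ (v k * lebesgue_measure (I k))).
  apply: lee_wpmul2l => //; apply: le_measure; [| |exact: subIsetl].
    exact: (mem_set (measurableI _ _ (mI k) m01)).
  exact: mem_set (mI k).
rewrite /v /I; case: (C k) => [[a b]|]; last by rewrite mul0e.
rewrite [X in _ * X]lebesgue_measure_itv/= lte_fin.
rewrite [leRHS]/= big_ord_recl/=.
have -> : (\prod_(i < n) Num.max 0 (lc b ord0 i - lc a ord0 i) =
  \prod_(i < n) Num.max 0 (b ord0 (lift ord0 i) - a ord0 (lift ord0 i)))%R.
  by apply: eq_bigr => i _; rewrite !mxE.
case: ifPn => ab; last first.
  by rewrite mule0 lee_fin mulr_ge0 ?prodr_ge0// => *; rewrite le_max lexx.
rewrite -EFinB -EFinM lee_fin mulrC ler_wpM2r ?le_max ?lexx ?orbT//.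
by rewrite prodr_ge0// => i _; rewrite le_max lexx.
Qed.

Context {n : nat}.

Lemma leb_bounded (x : 'rV[R]_n) (r : R) : leb R n (ball x r) < +oo.
Proof.
have [r0|r0] := ltP 0%R r; last first.
  rewrite (_ : ball x r = set0) ?measure0//; apply/seteqP; split => // y.
  by rewrite ball_rowE/= => /(le_lt_trans (normr_ge0 _)); rewrite ltNge r0.
pose c : cell := Some (x - const_mx r, x + const_mx r)%R.
apply: (@le_lt_trans _ _ (cell_vol c)); last by rewrite ltry.
apply: ereal_inf_lbound; exists (fun k => if k == 0%N then c else None).
  move=> y; rewrite ball_rowE/= => /(row_norm_ltP _ r0) H; exists 0%N => //= i.
  have := H i; rewrite !mxE ltr_norml => /andP[? ?]; apply/andP; split; lra.
rewrite (@nneseriesD1 _ _ 0%N xpredT)//= ?eseries0 ?adde0//.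
  by move=> [|k].
by move=> k _; exact: cell_vol_ge0.
Qed.

Lemma leb_unit_ball_gt0 : 0 < leb R n (ball (0%R : 'rV[R]_n) 1%R).
Proof.
have h0 : (0 < 4^-1 :> R)%R by rewrite invr_gt0.
(* The preimage is the ball of radius 2. It contains the unit cube, so by [unit_cube_cover_vol]
   every cover of it has volume at least 1; scaling back loses only the factor 4^n. *)
have : 0 < leb R n (dilate (0%R : 'rV[R]_n) 4^-1%R @^-1`
    (ball (0%R : 'rV[R]_n) 2^-1%R)).
  apply: (@lt_le_trans _ _ 1) => //.
  apply: le_ereal_inf_tmp => _ [C AC <-]; apply: unit_cube_cover_vol.
  apply: subset_trans AC => x x01 /=; rewrite ball_rowE/= sub0r normrN.
  rewrite /dilate add0r; apply/row_norm_ltP; first by rewrite invr_gt0.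
  move=> i; rewrite !mxE normrM gtr0_norm// ger0_norm; last by case/andP: (x01 i).
  by have /andP[? ?] := x01 i; lra.
rewrite [X in _ < X -> _]leb_outer_dilate// => H.
have : 0 < leb R n (ball (0%R : 'rV[R]_n) 2^-1%R).
  rewrite ltNge; apply/negP => le0; move: H; rewrite ltNge => /negP; apply.
  by rewrite mule_ge0_le0// lee_fin invr_ge0 exprn_ge0// ltW.
move=> /lt_le_trans; apply; apply: le_outer_measure => y.
by rewrite !ball_rowE/= => /lt_trans; apply; lra.
Qed.

End leb_cube.

(** * Functions of class C^k *)

Section derive_extra.
Context {R : realType}.

Lemma cvg_is_derive (V W : normedModType R) (f : V -> W) a v l :
  h^-1 *: (f (h *: v + a) - f a) @[h --> 0^'] --> l -> is_derive a v f l.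
Proof.
by move=> fl; apply: DeriveDef; [apply/cvg_ex; exists l | exact/cvg_lim].
Qed.

Lemma is_derive_cvg (V W : normedModType R) (f : V -> W) a v l :
  is_derive a v f l -> h^-1 *: (f (h *: v + a) - f a) @[h --> 0^'] --> l.
Proof. by move=> [+ <-]. Qed.

Lemma line_is_derive (V W : normedModType R) (f : V -> W) z v (s : R) l :
  is_derive (z + s *: v) v f l -> is_derive s 1 (fun t : R => f (z + t *: v)) l.
Proof.
move=> /is_derive_cvg fl; apply: cvg_is_derive.
rewrite (_ : (fun h => _) =
  (fun h => h^-1 *: (f (h *: v + (z + s *: v)) - f (z + s *: v))))//.
apply/funext => h.
have -> : z + (h%:A + s) *: v = h *: v + (z + s *: v); last by [].
by rewrite scalerDl [h%:A]mulr1 addrCA.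
Qed.

Lemma derivable_line_cvg (V W : normedModType R) (f : V -> W) a v :
  derivable f a v -> f (h *: v + a) @[h --> 0^'] --> f a.
Proof.
move=> /derivableP/is_derive_cvg fl.
have h0 : h @[h --> (0 : R)^'] --> (0 : R) by exact: cvg_within.
have : h *: (h^-1 *: (f (h *: v + a) - f a)) + f a @[h --> 0^'] -->
    0 *: 'D_v f a + f a.
  by apply: cvgD; [exact: cvgZ|exact: cvg_cst].
rewrite scale0r add0r; apply: cvg_trans; apply: near_eq_cvg; near=> h.
have hn0 : h != 0 by near: h; exact: nbhs_dnbhs_neq.
by rewrite scalerA mulfV// scale1r subrK.
Unshelve. all: by end_near. Qed.

(** The sign of [s] is arbitrary, so the intermediate parameter is located by absolute values; the
    proof treats the two orientations of the segment separately. *)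
Lemma line_MVT (V : normedModType R) (g : V -> R) z v (s : R) :
  (forall t : R, `|t| <= `|s| -> derivable g (z + t *: v) v) ->
  exists2 t : R, `|t| <= `|s| & g (z + s *: v) - g z = s * 'D_v g (z + t *: v).
Proof.
move=> dg.
pose phi t := g (z + t *: v).
have dphi (t : R) : `|t| <= `|s| -> is_derive t 1 phi ('D_v g (z + t *: v)).
  by move=> /dg/derivableP; exact: line_is_derive.
have cphi (a b : R) : `|a| <= `|s| -> `|b| <= `|s| ->
    {within `[a, b], continuous phi}.
  move=> as_ bs; apply: continuous_in_subspaceT => t; rewrite inE/= in_itv/=.
  move=> /andP[at_ tb]; apply/differentiable_continuous/derivable1_diffP.
  have /dphi[] // : `|t| <= `|s|.
  move: as_ bs; rewrite !ler_norml => /andP[? ?] /andP[? ?].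
  by apply/andP; split; lra.
have phi0 : phi 0 = g z by rewrite /phi scale0r addr0.
have [s0|s0] := leP 0 s.
  have [t|t|t tI E] := @MVT_segment R phi (fun t => 'D_v g (z + t *: v)) 0 s s0.
  - rewrite in_itv/= => /andP[t0 ts]; apply: dphi.
    by rewrite !ger0_norm ?(ltW ts)// ltW.
  - by apply: cphi; rewrite ?normr0.
  - exists t; first by move: tI; rewrite in_itv/= => /andP[? ?]; rewrite !ger0_norm.
    by rewrite -phi0 -/(phi s) E subr0 mulrC.
have [t|t|t tI E] := @MVT_segment R phi (fun t => 'D_v g (z + t *: v)) s 0 (ltW s0).
- rewrite in_itv/= => /andP[ts t0]; apply: dphi.
  by rewrite !ler0_norm ?lerN2 ?(ltW ts) ?(ltW t0)// ltW.
- by apply: cphi; rewrite ?normr0.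
- exists t.
    by move: tI; rewrite in_itv/= => /andP[? ?]; rewrite !ler0_norm ?lerN2// ltW.
  by rewrite -phi0 -/(phi s) -opprB E sub0r mulrN opprK mulrC.
Qed.

End derive_extra.

Section C1_chain.
Context {R : realType} {m : nat}.
Implicit Types (g : 'rV[R]_m -> R) (y z : 'rV[R]_m).

Local Notation e_ i := (delta_mx ord0 i : 'rV[R]_m).

(** The coordinates are changed one at a time along the staircase from [tr 0 = y] to [tr m = z]. In
    the sup norm no point of the staircase is farther from y than z is, so derivability in the ball
    suffices. *)
Lemma row_MVT g y (e : R) :
  (forall w i, `|w - y| < e -> derivable g w (e_ i)) ->
  forall z, `|z - y| < e -> exists2 w : 'I_m -> 'rV[R]_m,
    forall l, `|w l - y| <= `|z - y| &
    g z - g y = \sum_l (z ord0 l - y ord0 l) * partial l g (w l).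
Proof.
move=> dg z zy.
pose tr (l : nat) : 'rV[R]_m := \row_j (if (j < l)%N then z ord0 j else y ord0 j).
have tr0 : tr 0%N = y by apply/rowP => j; rewrite mxE.
have trm : tr m = z by apply/rowP => j; rewrite mxE ltn_ord.
have trS (l : 'I_m) : tr l.+1 = tr l + (z ord0 l - y ord0 l) *: e_ l.
  apply/rowP => j; rewrite !mxE eqxx/= ltnS leq_eqVlt val_eqE.
  by have [->|jl] := eqVneq j l; rewrite /= ?ltnn ?mulr1 ?mulr0 ?addr0// subrKC.
have tr_le (l : 'I_m) t : `|t| <= `|z ord0 l - y ord0 l| ->
    `|tr l + t *: e_ l - y| <= `|z - y|.
  move=> tl; apply/row_norm_leP => // j; rewrite !mxE eqxx/=.
  have [->|jl] := eqVneq j l.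
    rewrite ltnn mulr1 addrAC subrr add0r (le_trans tl)//.
    by have := row_coord_le (z - y) l; rewrite !mxE.
  rewrite mulr0 addr0; case: ifP => _; last by rewrite subrr normr0.
  by have := row_coord_le (z - y) j; rewrite !mxE.
have wP (l : 'I_m) : exists w, `|w - y| <= `|z - y| /\
    g (tr l.+1) - g (tr l) = (z ord0 l - y ord0 l) * partial l g w.
  have [|t tl E] := @line_MVT R _ g (tr l) (e_ l) (z ord0 l - y ord0 l).
    by move=> t tl; apply: dg; exact: le_lt_trans (tr_le l t tl) zy.
  by exists (tr l + t *: e_ l); split; [exact: tr_le|rewrite trS].
have [w wE] := choice wP.
exists w => [l|]; first by have [] := wE l.
under eq_bigr do rewrite -(proj2 (wE _)).
by rewrite -{1}trm -{1}tr0 -(telescope_sumr (fun l => g (tr l)))// big_mkord.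
Qed.

(* The increment of g is written with the partial derivatives at intermediate
   points, which converge to f a. *)
Lemma is_derive_C1_comp (V : normedModType R) g (f : V -> 'rV[R]_m) a v
    (U : set 'rV[R]_m) :
  open U -> U (f a) -> Ck_on 1 U g -> derivable f a v ->
  is_derive a v (g \o f)
    (\sum_l partial l g (f a) * 'D_v (fun x => f x ord0 l) a).
Proof.
move=> oU Ufa [_ gU] dfa.
have dg l w : U w -> derivable g w (e_ l) by move=> ?; apply: (gU l).1.
have cg l : {for f a, continuous (partial l g)}.
  have := (gU l).2.1; rewrite continuous_open_subspace// => /(_ (f a)).
  by apply; rewrite inE.
have /nbhs_ballP[e /= e0 eU] := open_nbhs_nbhs (conj oU Ufa).
have wP z : exists w : 'I_m -> 'rV[R]_m, `|z - f a| < e ->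
    (forall l, `|w l - f a| <= `|z - f a|) /\
    g z - g (f a) = \sum_l (z ord0 l - f a ord0 l) * partial l g (w l).
  have [ze|ze] := pselect (`|z - f a| < e); last by exists (fun=> z).
  have [|w w1 w2] := @row_MVT g (f a) e _ z ze; last by exists w.
  by move=> w i wfa; apply/dg/eU; rewrite ball_rowE/= distrC.
have [w wE] := choice wP.
have fcvg := derivable_line_cvg dfa.
have fe : \forall h \near 0^', `|f (h *: v + a) - f a| < e.
  by move/cvgrPdist_lt : fcvg => /(_ e e0); apply: filterS => h; rewrite distrC.
have wcvg l : w (f (h *: v + a)) l @[h --> 0^'] --> f a.
  apply/cvgrPdist_lt => d d0; move/cvgrPdist_lt : fcvg => /(_ d d0) fd.
  near=> h.
  have /wE[/(_ l) wl _] : `|f (h *: v + a) - f a| < e by near: h.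
  rewrite distrC (le_lt_trans wl)// distrC; near: h; exact: fd.
have dfl l : is_derive a v (fun x => f x ord0 l) ('D_v (fun x => f x ord0 l) a).
  by apply/derivableP; move/derivable_mxP : dfa; exact.
apply: cvg_is_derive.
apply: (@cvg_trans _ (\sum_l partial l g (w (f (h *: v + a)) l) *
    (h^-1 *: (f (h *: v + a) ord0 l - f a ord0 l)) @[h --> 0^'])).
  apply: near_eq_cvg; near=> h.
  have /wE[_ /= E] : `|f (h *: v + a) - f a| < e by near: h.
  rewrite E scaler_sumr; apply: eq_bigr => l _.
  by rewrite mulrC -scalerAl.
apply: cvg_big => [|l _]; first exact: add_continuous.
apply: cvgM; last exact: is_derive_cvg.
exact: (cvg_comp _ _ (wcvg l) (cg l)).
Unshelve. all: by end_near. Qed.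

End C1_chain.

Section Ck_theory.
Context {R : realType} {n : nat}.
Implicit Types (U V : set 'rV[R]_n) (r : nat).

Local Notation e_ i := (delta_mx ord0 i : 'rV[R]_n).

Section normed_target.
Context {W : normedModType R}.
Implicit Types (f g : 'rV[R]_n -> W).

Lemma Ck_on_continuous r U f x : open U -> Ck_on r U f -> U x ->
  {for x, continuous f}.
Proof.
move=> oU Uf Ux; have : {within U, continuous f} by case: r Uf => [[]|r []].
by rewrite continuous_open_subspace// => /(_ x); apply; rewrite inE.
Qed.

Lemma Ck_on_derivable r U f i x : Ck_on r.+1 U f -> U x -> derivable f x (e_ i).
Proof. by move=> [_ /(_ i)[+ _]]; exact. Qed.

Lemma Ck_onS r U f i : Ck_on r.+1 U f -> Ck_on r U (partial i f).
Proof. by move=> [_ /(_ i)[]]. Qed.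

Lemma Ck_on_open0 U f : open U -> (forall x, U x -> {for x, continuous f}) ->
  {within U, continuous f}.
Proof.
by move=> oU H; rewrite continuous_open_subspace// => x; rewrite inE; exact: H.
Qed.

Lemma Ck_on_intro r U f : open U -> (forall x, U x -> {for x, continuous f}) ->
  (forall i x, U x -> derivable f x (e_ i)) ->
  (forall i, Ck_on r U (partial i f)) -> Ck_on r.+1 U f.
Proof.
move=> oU cf df pf; split; first exact: Ck_on_open0.
by move=> i; split; [exact: df|exact: pf].
Qed.

(** The formula [df i] is known on U only, whereas [partial i f] is a total function; hence the last
    hypothesis ranges over all functions that agree with [df i] on U. *)
Lemma Ck_on_intro_derive r U f (df : 'I_n -> 'rV[R]_n -> W) : open U ->
  (forall x, U x -> {for x, continuous f}) ->
  (forall i x, U x -> is_derive x (e_ i) f (df i x)) ->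
  (forall i, (forall g, (forall x, U x -> g x = df i x) -> Ck_on r U g)) ->
  Ck_on r.+1 U f.
Proof.
move=> oU cf fdf Udf; apply: Ck_on_intro => // [i x Ux|i].
  by have [] := fdf i x Ux.
by apply: (Udf i) => x Ux; have [_ <-] := fdf i x Ux.
Qed.

Lemma Ck_on_local r U f : open U ->
  (forall x, U x -> exists V, [/\ open V, V x & Ck_on r V f]) -> Ck_on r U f.
Proof.
elim: r f => [|r IH] f oU H.
  split=> //; apply: Ck_on_open0 => // x /H[V [oV Vx [cV _]]].
  exact: (@Ck_on_continuous 0%N V).
apply: Ck_on_intro => //.
- by move=> x /H[V [oV Vx Vf]]; exact: (Ck_on_continuous oV Vf Vx).
- by move=> i x /H[V [oV Vx Vf]]; exact: (Ck_on_derivable Vf Vx).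
- move=> i; apply: IH => // x /H[V [oV Vx Vf]]; exists V; split => //.
  exact: Ck_onS.
Qed.

Lemma Ck_on_sub r U V f : open V -> V `<=` U -> open U -> Ck_on r U f ->
  Ck_on r V f.
Proof.
elim: r f => [|r IH] f oV VU oU Uf.
  split => //; apply: Ck_on_open0 => // x Vx.
  exact: (Ck_on_continuous oU Uf (VU _ Vx)).
apply: Ck_on_intro => //.
- by move=> x Vx; exact: (Ck_on_continuous oU Uf (VU _ Vx)).
- by move=> i x Vx; exact: (Ck_on_derivable Uf (VU _ Vx)).
- by move=> i; apply: IH => //; exact: Ck_onS.
Qed.

Lemma open_eq_near U f g x : open U -> (forall y, U y -> f y = g y) -> U x ->
  \near x, f x = g x.
Proof. by move=> oU fg Ux; apply: filterS (open_nbhs_nbhs (conj oU Ux)). Qed.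

Lemma near_eq_continuous (S T : topologicalType) (f g : S -> T) (x : S) :
  (\near x, f x = g x) -> {for x, continuous f} -> {for x, continuous g}.
Proof.
move=> fg cf; have E := nbhs_singleton fg; rewrite /prop_for /continuous_at -E.
exact: cvg_trans (near_eq_cvg fg) cf.
Qed.

Lemma Ck_on_eq r U f g : open U -> (forall x, U x -> f x = g x) ->
  Ck_on r U f -> Ck_on r U g.
Proof.
elim: r f g => [|r IH] f g oU fg Uf.
all: have cg : forall x, U x -> {for x, continuous g} by
  move=> x Ux; apply: near_eq_continuous (Ck_on_continuous oU Uf Ux);
  exact: (open_eq_near oU fg Ux).
  by split => //; exact: Ck_on_open0.
apply: Ck_on_intro => // [i x Ux|i].
  apply: near_eq_derivable (Ck_on_derivable Uf Ux).
  exact: (open_eq_near oU fg Ux).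
apply: (IH (partial i f)) => //; last exact: Ck_onS.
by move=> x Ux; apply: near_eq_derive; exact: (open_eq_near oU fg Ux).
Qed.

Lemma Ck_on_le r r' U f : (r <= r')%N -> Ck_on r' U f -> Ck_on r U f.
Proof.
elim: r r' f => [|r IH] [|r'] f //= rr' [Uf H]; split => // i.
by have [? ?] := H i; split => //; exact: (IH r').
Qed.

Lemma Ck_on_cst r U (w : W) : open U -> Ck_on r U (cst w).
Proof.
elim: r w => [|r IH] w oU; first by split => //; exact: cst_continuous.
apply: (@Ck_on_intro_derive _ _ _ (fun _ => cst 0)) => //.
- by move=> x _; exact: cst_continuous.
- move=> i g gE; apply: (@Ck_on_eq _ _ (cst 0)) => //; last exact: IH.
  by move=> x Ux; rewrite gE.
Qed.

Lemma Ck_onD r U f g : open U -> Ck_on r U f -> Ck_on r U g ->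
  Ck_on r U (f \+ g).
Proof.
elim: r f g => [|r IH] f g oU Uf Ug.
all: have cfg : forall x, U x -> {for x, continuous (f \+ g)} by
  move=> x Ux; apply: continuousD;
   [exact: (Ck_on_continuous oU Uf Ux)|exact: (Ck_on_continuous oU Ug Ux)].
  by split => //; exact: Ck_on_open0.
apply: (@Ck_on_intro_derive _ _ _ (fun i => partial i f \+ partial i g)) => //.
- move=> i x Ux; apply: is_deriveD; apply/derivableP.
  + exact: (Ck_on_derivable Uf Ux).
  + exact: (Ck_on_derivable Ug Ux).
- move=> i h hE; apply: (@Ck_on_eq _ _ (partial i f \+ partial i g)) => //.
    by move=> x Ux; rewrite hE.
  by apply: IH => //; exact: Ck_onS.
Qed.

Lemma Ck_on_sum r U (I : finType) (f : I -> 'rV[R]_n -> W) : open U ->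
  (forall i, Ck_on r U (f i)) -> Ck_on r U (fun x => \sum_i f i x).
Proof.
move=> oU Uf; elim: (index_enum I) => [|i s IH].
  by apply: (@Ck_on_eq _ _ (cst 0)) => [//|x _|]; [rewrite big_nil|exact: Ck_on_cst].
apply: (@Ck_on_eq _ _ (f i \+ (fun x => \sum_(i <- s) f i x))) => //.
  by move=> x _; rewrite big_cons.
exact: Ck_onD.
Qed.

End normed_target.

Section real_target.
Implicit Types (f g : 'rV[R]_n -> R).

Lemma Ck_onM r U f g : open U -> Ck_on r U f -> Ck_on r U g ->
  Ck_on r U (f \* g).
Proof.
elim: r f g => [|r IH] f g oU Uf Ug.
all: have cfg : forall x, U x -> {for x, continuous (f \* g)} by
  move=> x Ux; apply: continuousM;
   [exact: (Ck_on_continuous oU Uf Ux)|exact: (Ck_on_continuous oU Ug Ux)].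
  by split => //; exact: Ck_on_open0.
have Uf' := Ck_on_le (leqnSn r) Uf; have Ug' := Ck_on_le (leqnSn r) Ug.
apply: (@Ck_on_intro_derive _ _ _ _
  (fun i => (f \* partial i g) \+ (g \* partial i f))) => //.
- move=> i x Ux; apply: is_deriveM; apply/derivableP.
  + exact: (Ck_on_derivable Uf Ux).
  + exact: (Ck_on_derivable Ug Ux).
- move=> i h hE.
  apply: (@Ck_on_eq _ _ _ ((f \* partial i g) \+ (g \* partial i f))) => //.
    by move=> x Ux; rewrite hE.
  by apply: Ck_onD => //; apply: IH => //; exact: Ck_onS.
Qed.

Lemma Ck_on_coord r U (l : 'I_n) : open U ->
  Ck_on r U (fun x : 'rV[R]_n => x ord0 l).
Proof.
move=> oU; case: r => [|r].
  split => //; apply: Ck_on_open0 => // x _; exact: coord_continuous.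
apply: (@Ck_on_intro_derive _ _ _ _ (fun i => cst (e_ i ord0 l))) => //.
- by move=> x _; exact: coord_continuous.
- move=> i x _; have /derivable_mxP/(_ ord0 l) H := @derivable_id _ _ x (e_ i).
  apply: DeriveDef => //; have := derive_id x (e_ i).
  by rewrite derive_mx; [move=> /matrixP/(_ ord0 l); rewrite mxE|exact: derivable_id].
- move=> i g gE; apply: (@Ck_on_eq _ _ _ (cst (e_ i ord0 l))) => //.
    by move=> x Ux; rewrite gE.
  exact: Ck_on_cst.
Qed.

(** The derivative is a witness rather than a computed function, so a family closed under
    derivation, such as [flat], satisfies the predicate by induction. *)
Fixpoint Ck1 r (D : set R) (h : R -> R) : Prop :=
  (forall t, D t -> {for t, continuous h}) /\
  if r is r'.+1 then
    exists2 h', forall t, D t -> is_derive t 1 h (h' t) & Ck1 r' D h'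
  else True.

(** Along the line t -> x + t v the statement becomes the chain rule for functions of one
    variable. *)
Lemma is_derive_comp1 (h : R -> R) f x v dh df :
  is_derive (f x) 1 h dh -> is_derive x v f df -> is_derive x v (h \o f) (df * dh).
Proof.
move=> hfx fx; have [dfx <-] := fx.

pose phi (t : R) := f (t *: v + x).
have phi0 : phi 0 = f x by rewrite /phi scale0r add0r.
have dphi : is_derive (0 : R) 1 phi ('D_v f x).
  apply: cvg_is_derive.
  rewrite (_ : (fun t => _) = (fun t => t^-1 *: (f (t *: v + x) - f x))).
    exact: is_derive_cvg (derivableP dfx).
  by apply/funext => t; rewrite /phi addr0 scale0r add0r [_%:A]mulr1.
have : is_derive (0 : R) 1 (h \o phi) ('D_v f x * dh).
  by rewrite mulrC; apply: is_derive1_comp; rewrite ?phi0.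
move=> /is_derive_cvg H; apply: cvg_is_derive.
rewrite (_ : (fun t => _) =
    (fun t => t^-1 *: ((h \o phi) (t *: 1 + 0) - (h \o phi) 0)))//.
by apply/funext => t; rewrite /phi/= addr0 scale0r add0r [_%:A]mulr1.
Qed.

Lemma Ck_on_comp1 r U (D : set R) (h : R -> R) f : open U ->
  (forall x, U x -> D (f x)) -> Ck1 r D h -> Ck_on r U f -> Ck_on r U (h \o f).
Proof.
elim: r f h => [|r IH] f h oU UD Dh Uf.
all: have chf : forall x, U x -> {for x, continuous (h \o f)} by
  move=> x Ux; apply: continuous_comp; [exact: (Ck_on_continuous oU Uf Ux)|];
  case: Dh => + _; apply; exact: UD.
  by split => //; exact: Ck_on_open0.
have [_ [h' hh' Dh']] := Dh.
apply: (@Ck_on_intro_derive _ _ _ _ (fun i => partial i f \* (h' \o f))) => //.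
- move=> i x Ux; apply: is_derive_comp1; first exact/hh'/UD.
  apply/derivableP; exact: (Ck_on_derivable Uf Ux).
- move=> i g gE; apply: (@Ck_on_eq _ _ _ (partial i f \* (h' \o f))) => //.
    by move=> x Ux; rewrite gE.
  apply: Ck_onM => //; first exact: Ck_onS.
  by apply: IH => //; exact: Ck_on_le Uf.
Qed.

End real_target.

Lemma Ck_on_row_coord r U k (f : 'rV[R]_n -> 'rV[R]_k) a : open U ->
  Ck_on r U f -> Ck_on r U (fun x => f x ord0 a).
Proof.
move=> oU; elim: r f => [|r IH] f Uf.
all: have cf : forall x, U x -> {for x, continuous (fun x => f x ord0 a)} by
  move=> x Ux; apply: (@continuous_comp _ _ _ f (fun y : 'rV_k => y ord0 a));
  [exact: (Ck_on_continuous oU Uf Ux)|exact: coord_continuous].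
  by split => //; exact: Ck_on_open0.
have df i x : U x -> derivable f x (e_ i) by move=> Ux; exact: (Ck_on_derivable Uf).
apply: (@Ck_on_intro_derive _ _ _ _ (fun i x => partial i f x ord0 a)) => //.
  move=> i x Ux; have /derivable_mxP/(_ ord0 a) H := df i x Ux.
  by apply: DeriveDef => //; rewrite /partial derive_mx ?mxE//; exact: df.
move=> i g gE; apply: (@Ck_on_eq _ _ _ (fun x => partial i f x ord0 a)) => //.
  by move=> x Ux; rewrite gE.
by apply: IH; exact: Ck_onS.
Qed.

Lemma Ck_on_row r U k (f : 'rV[R]_n -> 'rV[R]_k) : open U ->
  (forall a, Ck_on r U (fun x => f x ord0 a)) -> Ck_on r U f.
Proof.
move=> oU; elim: r f => [|r IH] f Uf.
all: have cf : forall x, U x -> {for x, continuous f} by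
  move=> x Ux; apply: row_continuous => a;
  exact: (Ck_on_continuous oU (Uf a) Ux).
  by split => //; exact: Ck_on_open0.
have df i x : U x -> derivable f x (e_ i).
  move=> Ux; apply/derivable_mxP => j a; rewrite ord1.
  exact: (Ck_on_derivable (Uf a) Ux).
apply: Ck_on_intro => // i; apply: IH => a.
apply: (@Ck_on_eq _ _ _ (partial i (fun x => f x ord0 a))) => //.
  by move=> x Ux; rewrite /partial derive_mx ?mxE//; exact: df.
exact: Ck_onS.
Qed.

End Ck_theory.

Section Ck_comp.
Context {R : realType} {n m : nat}.

Lemma Ck_on_comp_real r (U : set 'rV[R]_n) (V : set 'rV[R]_m) (f : 'rV[R]_n -> 'rV[R]_m)
    (g : 'rV[R]_m -> R) : open U -> open V ->
  (forall x, U x -> V (f x)) -> Ck_on r V g -> Ck_on r U f -> Ck_on r U (g \o f).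
Proof.
elim: r f g => [|r IH] f g oU oV UV Vg Uf.
all: have cgf : forall x, U x -> {for x, continuous (g \o f)} by
  move=> x Ux; apply: continuous_comp;
  [exact: (Ck_on_continuous oU Uf Ux)|exact: (Ck_on_continuous oV Vg (UV _ Ux))].
  by split => //; exact: Ck_on_open0.
apply: (@Ck_on_intro_derive _ _ _ _ _ _ (fun i x =>
    \sum_l partial l g (f x) * partial i (fun x => f x ord0 l) x)) => //.
- move=> i x Ux; apply: (@is_derive_C1_comp _ _ _ _ _ _ _ V) => //.
  + exact: UV.
  + exact: Ck_on_le Vg.
  + exact: (Ck_on_derivable Uf Ux).
- move=> i h hE; apply: (@Ck_on_eq _ _ _ _ _ (fun x =>
    \sum_l partial l g (f x) * partial i (fun x => f x ord0 l) x)) => //.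
    by move=> x Ux; rewrite hE.
  apply: Ck_on_sum => // l; apply: (@Ck_onM _ _ _ _ (partial l g \o f)) => //.
    apply: IH => //; first exact: Ck_onS.
    exact: Ck_on_le Uf.
  by apply: Ck_onS; exact: Ck_on_row_coord.
Qed.

Lemma Ck_on_comp r k (U : set 'rV[R]_n) (V : set 'rV[R]_m) (f : 'rV[R]_n -> 'rV[R]_m)
    (g : 'rV[R]_m -> 'rV[R]_k) : open U -> open V ->
  (forall x, U x -> V (f x)) -> Ck_on r V g -> Ck_on r U f -> Ck_on r U (g \o f).
Proof.
move=> oU oV UV Vg Uf; apply: Ck_on_row => // a.
apply: (@Ck_on_comp_real r U V f (fun y => g y ord0 a)) => //.
exact: Ck_on_row_coord.
Qed.

End Ck_comp.

(** * Bump functions *)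

Section flat_function.
Context {R : realType}.
Implicit Types (p : {poly R}) (t : R).

(** The polynomial is a parameter because the derivative of p(1/t) exp(-1/t) has the same form: with
    s = 1/t it is s^2 (p(s) - p'(s)) exp(-s). The family is therefore closed under derivation, and
    the case p = 1 is smooth. *)
Definition flat p t : R := if 0 < t then p.[t^-1] * expR (- t^-1) else 0.

Lemma exprn_le_expR (s : R) k : 0 <= s -> s ^+ k.+1 <= k.+1`!%:R * expR s.
Proof.
move=> s0; have := expR_ge1Dxn k s0.
have f0 : 0 < k.+1`!%:R :> R by rewrite ltr0n fact_gt0.
rewrite -ler_pdivrMl// => H; apply: le_trans H.
by rewrite mulrC lerDr.
Qed.

(** A quadratic bound forces the difference quotient at 0 to tend to 0. It comes from s^(i+2) <=
    (i+2)! exp(s) at s = 1/t, applied to each monomial of p. *)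
Lemma flat_le_sqr p : exists2 C, 0 <= C & forall t, `|flat p t| <= C * t ^+ 2.
Proof.
exists (\sum_(i < size p) `|p`_i| * (i.+2)`!%:R).
  by apply: sumr_ge0 => i _; rewrite mulr_ge0.
move=> t; rewrite /flat; case: ifPn => t0; last first.
  rewrite normr0 mulr_ge0 ?sqr_ge0//.
  by apply: sumr_ge0 => i _; rewrite mulr_ge0.
set s := t^-1; have s0 : 0 < s by rewrite invr_gt0.
rewrite normrM (ger0_norm (expR_ge0 _)) expRN.
rewrite ler_pdivrMr ?expR_gt0//.
rewrite -[t]invrK -/s exprVn mulrAC ler_pdivlMr ?exprn_gt0//.
rewrite horner_coef (le_trans (ler_wpM2r _ (ler_norm_sum _ _ _))) ?exprn_ge0 ?(ltW s0)//.
rewrite !mulr_suml; apply: ler_sum => i _.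
rewrite normrM normrX (gtr0_norm s0) -!mulrA ler_wpM2l//.
by rewrite -exprD addn2; apply: exprn_le_expR; exact: ltW.
Qed.

Lemma is_derive_horner p t : is_derive t 1 (horner p) p^`().[t].
Proof.
by apply: DeriveDef; [exact: derivable_horner|rewrite -derive1E derivE].
Qed.

Lemma flat_is_derive p t : is_derive t 1 (flat p) (flat ('X^2 * (p - p^`())) t).
Proof.
have [t0|t0|<-] := ltgtP 0 t; last first.
- have [C C0 CP] := flat_le_sqr p.
  rewrite [X in is_derive _ _ _ X]/flat ltxx; apply: cvg_is_derive.
  rewrite /flat ltxx.
  apply/cvgrPdist_le => e e0; near=> h.
  rewrite sub0r normrN subr0 addr0 [_%:A]mulr1 -/(flat p h).
  have h0 : h != 0 by near: h; exact: nbhs_dnbhs_neq.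
  rewrite normrM normfV ler_pdivrMl ?normr_gt0//.
  rewrite (le_trans (CP h))// -[h ^+ 2]ger0_norm ?sqr_ge0// normrX expr2.
  rewrite mulrCA ler_wpM2l//.
  have : `|h| < e / (C + 1).
    by near: h; apply: dnbhs0_lt; rewrite divr_gt0// ltr_wpDl.
  rewrite ltr_pdivlMr ?ltr_wpDl// => /ltW; apply: le_trans.
  by rewrite mulrC ler_wpM2l// lerDl.
- rewrite [X in is_derive _ _ _ X]/flat ltNge (ltW t0)/=.
  apply: (@near_eq_is_derive _ _ _ (cst 0)).
  near=> s; rewrite /flat ltNge.
  suff -> : s <= 0 by [].
  by apply: ltW; near: s; exact: lt_nbhsl.
- rewrite [X in is_derive _ _ _ X]/flat t0.
  have tn0 : t != 0 by rewrite gt_eqF.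
  apply: (@near_eq_is_derive _ _ _ (fun t => p.[t^-1] * expR (- t^-1))).
    by near=> s; rewrite /flat ifT//; near: s; exact: lt_nbhsr.
  have dV : is_derive t 1 (fun s : R => s^-1) (- t ^- 2).
    by apply: is_derive_eq; [exact: (is_deriveV tn0 (is_derive_id t 1))|rewrite [_ *: _]mulr1].
  have dp := @is_derive1_comp _ (horner p) _ t _ _ (is_derive_horner p t^-1) dV.
  have dN : is_derive t 1 (fun s : R => - s^-1) (t ^- 2).
    by rewrite -[X in is_derive _ _ _ X]opprK; exact: is_deriveN.
  have de := @is_derive1_comp _ expR _ t _ _ (is_derive_expR (- t^-1)) dN.
  have [dd E] := is_deriveM dp de.
  apply: DeriveDef; first exact: dd.
  by rewrite [LHS]E /= !hornerE /= /GRing.scale/= exprVn; ring.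
Unshelve. all: by end_near. Qed.

Lemma flat_Ck1 p r : Ck1 r setT (flat p).
Proof.
elim: r p => [|r IH] p /=; split => //.
- move=> t _; apply/differentiable_continuous/derivable1_diffP.
  by case: (flat_is_derive p t).
- move=> t _; apply/differentiable_continuous/derivable1_diffP.
  by case: (flat_is_derive p t).
- by exists (flat ('X^2 * (p - p^`()))) => // t _; exact: flat_is_derive.
Qed.

Definition bump1 t : R := flat 1 t.

Lemma bump1_ge0 t : 0 <= bump1 t.
Proof. by rewrite /bump1 /flat; case: ifP => // _; rewrite hornerE mul1r expR_ge0. Qed.

Lemma bump1_gt0 t : (0 < bump1 t) = (0 < t).
Proof.
by rewrite /bump1 /flat; case: ifP => _; rewrite ?ltxx// hornerE mul1r expR_gt0.
Qed.

Lemma bump1_le0 t : t <= 0 -> bump1 t = 0.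
Proof. by rewrite /bump1 /flat leNgt => /negbTE ->. Qed.

Lemma bump1_le1 t : bump1 t <= 1.
Proof.
rewrite /bump1 /flat; case: ifP => // t0; rewrite hornerE mul1r -expR0 ler_expR.
by rewrite oppr_le0 invr_ge0 ltW.
Qed.

End flat_function.

Section smooth_cutoff.
Context {R : realType} {n : nat}.
Implicit Types (U : set 'rV[R]_n) (f g : 'rV[R]_n -> R) (c x : 'rV[R]_n).

Lemma Ck_onV r U f : open U -> (forall x, U x -> f x != 0) -> Ck_on r U f ->
  Ck_on r U (fun x => (f x)^-1).
Proof.
elim: r f => [|r IH] f oU f0 Uf.
all: have cV : forall x, U x -> {for x, continuous (fun x => (f x)^-1)} by
  move=> x Ux; apply: continuousV; [exact: f0|exact: (Ck_on_continuous oU Uf Ux)].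
  by split => //; exact: Ck_on_open0.
have UfV := IH _ oU f0 (Ck_on_le (leqnSn r) Uf).
pose df i := (fun x => - 1 * (partial i f x)) \* ((fun x => (f x)^-1) \* (fun x => (f x)^-1)).
apply: (@Ck_on_intro_derive _ _ _ _ _ _ df) => //.
- move=> i x Ux; have dfx := Ck_on_derivable Uf Ux.
  apply: DeriveDef; first exact: derivableV (f0 _ Ux) (dfx _).
  rewrite deriveV//; last exact: f0.
  by rewrite /df/= [LHS]/GRing.scale/= !mulNr mul1r -invfM -expr2 mulrC.
- move=> i h hE; apply: (@Ck_on_eq _ _ _ _ _ (df i)) => //.
    by move=> x Ux; rewrite hE.
  apply: Ck_onM => //; last exact: Ck_onM.
  by apply: (@Ck_onM _ _ _ _ (cst (-1))) => //; [exact: Ck_on_cst|exact: Ck_onS].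
Qed.

Lemma Ck_on_prod r U (I : finType) (f : I -> 'rV[R]_n -> R) : open U ->
  (forall i, Ck_on r U (f i)) -> Ck_on r U (fun x => \prod_i f i x).
Proof.
move=> oU Uf; elim: (index_enum I) => [|i s IH].
  apply: (@Ck_on_eq _ _ _ _ _ (cst 1 : 'rV[R]_n -> R)) => //.
    by move=> x _; rewrite big_nil.
  exact: Ck_on_cst.
apply: (@Ck_on_eq _ _ _ _ _ (f i \* (fun x => \prod_(i <- s) f i x))) => //.
  by move=> x _; rewrite big_cons.
exact: Ck_onM.
Qed.

Lemma Ck_on_affine_coord r U (l : 'I_n) (a b : R) : open U ->
  Ck_on r U (fun x => a * x ord0 l + b).
Proof.
move=> oU; apply: (@Ck_onD _ _ _ _ _ (fun x => a * x ord0 l) (cst b)) => //.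
  apply: (@Ck_onM _ _ _ _ (cst a)) => //; first exact: Ck_on_cst.
  exact: Ck_on_coord.
exact: Ck_on_cst.
Qed.

Lemma Ck_on_bump1 r U f : open U -> Ck_on r U f -> Ck_on r U (bump1 \o f).
Proof.
by move=> oU Uf; apply: (@Ck_on_comp1 _ _ _ _ setT) => //; exact: flat_Ck1.
Qed.

Definition cube_bump c (d : R) x : R :=
  \prod_l (bump1 (x ord0 l + (d - c ord0 l)) * bump1 (- x ord0 l + (d + c ord0 l))).

Lemma cube_bump_smooth c d U : open U -> smooth_on U (cube_bump c d).
Proof.
move=> oU r; apply: Ck_on_prod => // l.
apply: (@Ck_onM _ _ _ _ (fun x => bump1 (x ord0 l + (d - c ord0 l)))
    (fun x => bump1 (- x ord0 l + (d + c ord0 l)))) => //.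
- apply: (@Ck_on_bump1 _ _ (fun x => x ord0 l + (d - c ord0 l))) => //.
  apply: (@Ck_on_eq _ _ _ _ _ (fun x => 1 * x ord0 l + (d - c ord0 l))) => //.
    by move=> x _; rewrite mul1r.
  exact: Ck_on_affine_coord.
- apply: (@Ck_on_bump1 _ _ (fun x => - x ord0 l + (d + c ord0 l))) => //.
  apply: (@Ck_on_eq _ _ _ _ _ (fun x => -1 * x ord0 l + (d + c ord0 l))) => //.
    by move=> x _; rewrite mulN1r.
  exact: Ck_on_affine_coord.
Qed.

Lemma cube_bump_ge0 c d x : 0 <= cube_bump c d x.
Proof. by apply: prodr_ge0 => l _; rewrite mulr_ge0 ?bump1_ge0. Qed.

Lemma cube_bump_gt0 c d x : 0 < d -> (0 < cube_bump c d x) <-> `|x - c| < d.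
Proof.
move=> d0; rewrite (row_norm_ltP _ d0); split=> [+ l|H].
  rewrite /cube_bump (bigD1 l)//= => H.
  have {}H : 0 < bump1 (x ord0 l + (d - c ord0 l)) * bump1 (- x ord0 l + (d + c ord0 l)).
    rewrite lt_neqAle mulr_ge0 ?bump1_ge0// andbT; apply/eqP => E.
    by move: H; rewrite -E mul0r ltxx.
  rewrite !mxE ltr_norml; apply/andP; split.
    move: H; have [t0|] := leP (x ord0 l + (d - c ord0 l)) 0; last by move=> *; lra.
    by rewrite (bump1_le0 t0) mul0r ltxx.
  move: H; have [t0|] := leP (- x ord0 l + (d + c ord0 l)) 0; last by move=> *; lra.
  by rewrite (bump1_le0 t0) mulr0 ltxx.
apply: prodr_gt0 => l _; have := H l; rewrite !mxE ltr_norml => /andP[? ?].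
by rewrite mulr_gt0// bump1_gt0; lra.
Qed.

Lemma cube_bump_eq0 c d x : 0 < d -> d <= `|x - c| -> cube_bump c d x = 0.
Proof.
move=> d0 dx; apply/eqP; rewrite eq_le cube_bump_ge0 andbT leNgt; apply/negP.
by move=> /(cube_bump_gt0 _ _ d0); rewrite ltNge dx.
Qed.

Definition step1 (t : R) : R := bump1 t / (bump1 t + bump1 (1 - t)).

Lemma step1_den (t : R) : 0 < bump1 t + bump1 (1 - t).
Proof.
have [t0|t0] := ltP 0 t; first by rewrite ltr_pwDl ?bump1_gt0 ?bump1_ge0.
by rewrite ltr_wpDl ?bump1_ge0// bump1_gt0; lra.
Qed.

Lemma step1_itv (t : R) : 0 <= step1 t <= 1.
Proof.
rewrite /step1 divr_ge0 ?bump1_ge0 ?(ltW (step1_den t))//=.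
by rewrite ler_pdivrMr ?step1_den// mul1r lerDl bump1_ge0.
Qed.

Lemma step1_0 (t : R) : t <= 0 -> step1 t = 0.
Proof. by move=> t0; rewrite /step1 bump1_le0// mul0r. Qed.

Lemma step1_1 (t : R) : 1 <= t -> step1 t = 1.
Proof.
move=> t1; rewrite /step1 (@bump1_le0 _ (1 - t)) ?subr_le0// addr0 divff//.
by rewrite gt_eqF// bump1_gt0; lra.
Qed.

Lemma Ck_on_step1 r U f : open U -> Ck_on r U f -> Ck_on r U (step1 \o f).
Proof.
move=> oU Uf; apply: (@Ck_onM _ _ _ _ (bump1 \o f)
   (fun x => (bump1 (f x) + bump1 (1 - f x))^-1)) => //.
  exact: Ck_on_bump1.
apply: Ck_onV => //; first by move=> x _; rewrite gt_eqF// step1_den.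
apply: (@Ck_onD _ _ _ _ _ (bump1 \o f) (bump1 \o (fun x => 1 - f x))) => //.
  exact: Ck_on_bump1.
apply: Ck_on_bump1 => //.
apply: (@Ck_on_eq _ _ _ _ _ (cst 1 \+ (cst (-1) \* f))) => //.
  by move=> x _ /=; rewrite mulN1r.
apply: Ck_onD => //; first exact: Ck_on_cst.
by apply: Ck_onM => //; exact: Ck_on_cst.
Qed.

(** The arguments are 2 + (x_l - c_l) / d and 2 - (x_l - c_l) / d, in the affine form that
    [Ck_on_affine_coord] expects. *)
Definition cutoff c (d : R) x : R :=
  \prod_l (step1 (d^-1 * x ord0 l + (2 - d^-1 * c ord0 l)) *
           step1 (- d^-1 * x ord0 l + (2 + d^-1 * c ord0 l))).

Lemma cutoff_smooth c d U : open U -> smooth_on U (cutoff c d).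
Proof.
move=> oU r; apply: Ck_on_prod => // l.
apply: (@Ck_onM _ _ _ _ (fun x => step1 (d^-1 * x ord0 l + (2 - d^-1 * c ord0 l)))
    (fun x => step1 (- d^-1 * x ord0 l + (2 + d^-1 * c ord0 l)))) => //.
- apply: (@Ck_on_step1 _ _ (fun x => d^-1 * x ord0 l + (2 - d^-1 * c ord0 l))) => //.
  exact: Ck_on_affine_coord.
- apply: (@Ck_on_step1 _ _ (fun x => - d^-1 * x ord0 l + (2 + d^-1 * c ord0 l))) => //.
  exact: Ck_on_affine_coord.
Qed.

Lemma cutoff_itv c d x : 0 <= cutoff c d x <= 1.
Proof.
have s01 l : 0 <= step1 (d^-1 * x ord0 l + (2 - d^-1 * c ord0 l)) *
   step1 (- d^-1 * x ord0 l + (2 + d^-1 * c ord0 l)) <= 1.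
  have /andP[? ?] := step1_itv (d^-1 * x ord0 l + (2 - d^-1 * c ord0 l)).
  have /andP[? ?] := step1_itv (- d^-1 * x ord0 l + (2 + d^-1 * c ord0 l)).
  by rewrite mulr_ge0//= mulr_ile1.
rewrite prodr_ge0/=; last by move=> l _; case/andP: (s01 l).
by apply: prodr_ile1 => l _; exact: s01.
Qed.

Lemma cutoff_1 c d x : 0 < d -> `|x - c| <= d -> cutoff c d x = 1.
Proof.
move=> d0 xd; apply: big1 => l _.
have := le_trans (row_coord_le (x - c) l) xd.
rewrite !mxE -[X in _ <= X]mulr1 -ler_pdivrMl//.
rewrite -[d^-1 in X in X -> _](gtr0_norm (x := d^-1)) ?invr_gt0// -normrM.
rewrite ler_norml mulrBr => /andP[h1 h2].
by rewrite !step1_1 ?mulr1// ?mulNr; lra.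
Qed.

Lemma cutoff_0 c d x : 0 < d -> 2 * d <= `|x - c| -> cutoff c d x = 0.
Proof.
move=> d0 xd; apply/eqP/negPn/negP => c0.
have : `|x - c| < 2 * d; last by rewrite ltNge xd.
apply/row_norm_ltP; first by rewrite mulr_gt0.
move=> l; rewrite !mxE; move: c0; rewrite /cutoff (bigD1 l)//= mulf_eq0 negb_or.
rewrite mulf_eq0 negb_or => /andP[/andP[h1 h2] _].
have {}h1 : 0 < d^-1 * x ord0 l + (2 - d^-1 * c ord0 l).
  by rewrite ltNge; apply: contra h1 => /step1_0 ->.
have {}h2 : 0 < - d^-1 * x ord0 l + (2 + d^-1 * c ord0 l).
  by rewrite ltNge; apply: contra h2 => /step1_0 ->.
rewrite mulrC -ltr_pdivrMl//.
rewrite -[d^-1](gtr0_norm (x := d^-1)) ?invr_gt0// -normrM ltr_norml mulrBr.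
by move: h2; rewrite mulNr => h2; apply/andP; split; lra.
Qed.

End smooth_cutoff.

(** * Integration by parts *)

Section compact_extra.
Context {R : realType}.

Lemma compact_fun_bounded (T : topologicalType) (K : set T) (f : T -> R) :
  compact K -> {within K, continuous f} ->
  exists2 C : R, 0 < C & forall x, K x -> `|f x| <= C.
Proof.
move=> cK cf.
have [K0|/set0P/negP/negPn/eqP ->] := pselect (K !=set0); last by exists 1.
have [|c Kc cP] := compact_EVT_max K0 cK (f := fun x => `|f x|).
  by move=> x; apply: cvg_norm; exact: cf.
exists (`|f c| + 1); first by rewrite ltr_wpDl.
by move=> x Kx; rewrite ler_wpDr// cP// inE.
Qed.

Lemma closed_cube_compact n (c : 'rV[R]_n) (r : R) : compact [set x | `|x - c| <= r].
Proof.
have [r0|r0] := ltP r 0.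
  rewrite (_ : [set x | _] = set0); first exact: compact0.
  by apply/seteqP; split => // x /= /(le_trans (normr_ge0 _)); rewrite leNgt r0.
have := @rV_compact R n (fun i => `[c ord0 i - r, c ord0 i + r]%classic)
  (fun i => @segment_compact R _ _).
congr compact; apply/seteqP; split => x /=.
  move=> H; apply/row_norm_leP => // i; rewrite !mxE ler_distl.
  by have := H i; rewrite /= in_itv.
move=> /(row_norm_leP _ r0) H i; rewrite /= in_itv/=.
by have := H i; rewrite !mxE ler_distl.
Qed.

Lemma shift_continuous (W : normedModType R) (v : W) : continuous (fun x => x + v).
Proof. by move=> x; apply: cvgD; [exact: cvg_id|exact: cvg_cst]. Qed.

Lemma compact_sub_ball n (K : set 'rV[R]_n) : compact K ->
  exists2 r : R, 0 < r & forall x, K x -> `|x| < r.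
Proof.
move=> cK; have := @compact_fun_bounded _ K (fun x : 'rV[R]_n => `|x|) cK.
case=> [|C C0 CP]; first by apply: continuous_subspaceT; exact: norm_continuous.
exists (C + 1); first by rewrite addr_gt0.
by move=> x /CP; rewrite normr_id => /le_lt_trans; apply; rewrite ltrDl.
Qed.

Lemma compact_leb_measurable n (K : set 'rV[R]_n) : compact K ->
  measurable (K : set (lebT R n)).
Proof.
move=> cK; rewrite -[K]setCK; apply: measurableC; apply: open_leb_measurable.
by apply: closed_openC; apply: compact_closed => //; exact: norm_hausdorff.
Qed.

Lemma compact_leb_lty n (K : set 'rV[R]_n) : compact K -> (leb R n K < +oo)%E.
Proof.
move=> /compact_sub_ball[r r0 Kr]; apply: le_lt_trans (leb_bounded 0 r).
by apply: le_outer_measure => x Kx; rewrite ball_rowE/= sub0r normrN; exact: Kr.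
Qed.

Lemma adde_eq0_fin (x y : \bar R) : x \is a fin_num -> y \is a fin_num ->
  (x + y = 0 -> x = - y)%E.
Proof.
by case: x => // r; case: y => // s _ _ [] /eqP; rewrite addr_eq0 => /eqP ->.
Qed.

End compact_extra.

Section compact_support.
Context {R : realType} {n : nat}.
Implicit Types (V K : set 'rV[R]_n) (f g F : 'rV[R]_n -> R).
Local Notation mu := (leb R n).

Lemma integrable_compact K f : compact K ->
  measurable_fun (K : set (lebT R n)) (f : lebT R n -> R) ->
  (exists C, forall x, K x -> `|f x| <= C) ->
  mu.-integrable (K : set (lebT R n)) (EFin \o (f : lebT R n -> R)).
Proof.
move=> cK mf [C fC]; apply: measurable_bounded_integrable => //.
- exact: compact_leb_measurable.
- exact: compact_leb_lty.
- by exists C; split; [exact: num_real|move=> M CM x Kx; exact: le_trans (fC _ Kx) (ltW CM)].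
Qed.

Lemma integrable_compact_supp V K f : open V -> compact K -> K `<=` V ->
  (forall x, V x -> {for x, continuous f}) -> (forall x, ~ K x -> f x = 0) ->
  mu.-integrable (V : set (lebT R n)) (EFin \o (f : lebT R n -> R)).
Proof.
move=> oV cK KV cf f0.
have mK := compact_leb_measurable cK; have mV := open_leb_measurable oV.
have mf := continuous_leb_measurable oV cf.
have cfK : {within K, continuous f}.
  by apply: continuous_in_subspaceT => x; rewrite inE => Kx; exact/cf/KV.
have [C C0 CP] := compact_fun_bounded cK cfK.
have : mu.-integrable (K : set (lebT R n)) (EFin \o (f : lebT R n -> R)).
  apply: integrable_compact => //; last by exists C.
  exact: measurable_funS mf.
move=> /(integrable_mkcond _ mK) H.
have {}H := integrableS measurableT mV (@subsetT _ _) H.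
apply: eq_integrable H => // x _; rewrite /= patchE.
by case: ifPn => // /negP; rewrite inE => /f0 ->.
Qed.

Lemma continuous_loc_integrable V f : open V ->
  (forall x, V x -> {for x, continuous f}) -> loc_integrable V f.
Proof.
move=> oV cf; have mf := continuous_leb_measurable oV cf; split => // K cK KV.
have cfK : {within K, continuous f}.
  by apply: continuous_in_subspaceT => x; rewrite inE => Kx; exact/cf/KV.
have [C C0 CP] := compact_fun_bounded cK cfK.
have /integrableP[] : mu.-integrable (K : set (lebT R n)) (EFin \o (f : lebT R n -> R)).
  apply: integrable_compact => //; last by exists C.
  by apply: measurable_funS mf => //; exact: open_leb_measurable.
by [].
Qed.

Lemma loc_integrable_test V f phi : open V -> loc_integrable V f ->
  (exists K, [/\ compact K, K `<=` V & forall x, ~ K x -> phi x = 0]) ->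
  continuous phi ->
  mu.-integrable (V : set (lebT R n))
    (EFin \o ((fun x => f x * phi x) : lebT R n -> R)).
Proof.
move=> oV [mf fK] [K [cK KV phi0]] cphi.
have mK := compact_leb_measurable cK; have mV := open_leb_measurable oV.
have mphi : measurable_fun (V : set (lebT R n)) (phi : lebT R n -> R).
  by apply: continuous_leb_measurable => // x _; exact: cphi.
have [C C0 CP] := compact_fun_bounded cK (continuous_subspaceT cphi (A := K)).
have fint : mu.-integrable (K : set (lebT R n)) (EFin \o (f : lebT R n -> R)).
  apply/integrableP; split; last exact: fK.
  by apply/measurable_EFinP; exact: measurable_funS mf.
have : mu.-integrable (K : set (lebT R n))
    (EFin \o ((fun x => f x * phi x) : lebT R n -> R)).
  apply: (@le_integrable _ _ _ mu _ mK _ (fun x => C%:E * (f x)%:E)%E).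
  - apply/measurable_EFinP; apply: measurable_funM.
      exact: measurable_funS mf.
    exact: measurable_funS mphi.
  - move=> x Kx; rewrite abseM /= -EFinM lee_fin normrM mulrC ler_wpM2r//.
    by rewrite (gtr0_norm C0); exact: CP.
  - exact: integrableZl.
move=> /(integrable_mkcond _ mK) H.
have {}H := integrableS measurableT mV (@subsetT _ _) H.
apply: eq_integrable H => // x _; rewrite /= patchE.
by case: ifPn => // /negP; rewrite inE => /phi0 ->; rewrite mulr0.
Qed.

Lemma partial_eq0 i (W : normedModType R) (U : set 'rV[R]_n) (f : 'rV[R]_n -> W) x :
  open U -> U x -> (forall y, U y -> f y = 0) -> partial i f x = 0.
Proof.
move=> oU Ux f0; rewrite /partial (@near_eq_derive _ _ _ f (cst 0)).
  by rewrite derive_cst.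
by apply: open_eq_near Ux.
Qed.

Lemma integral_translate (v : 'rV[R]_n) F :
  measurable_fun setT (F : lebT R n -> R) ->
  mu.-integrable setT (EFin \o ((fun x => F (x + v)) : lebT R n -> R)) ->
  (\int[mu]_x (F (x + v))%:E = \int[mu]_x (F x)%:E)%E.
Proof.
move=> mF iF.
have mT : measurable_fun setT (dilate v 1 : lebT R n -> lebT R n).
  exact: measurable_dilate.
have E : (fun x : 'rV[R]_n => F (dilate v 1 x)) = (fun x => F (x + v)).
  by apply/funext => x; rewrite /dilate scale1r addrC.
have := @integral_pushforward _ _ _ _ _ _ mT mu setT (EFin \o F).
rewrite preimage_setT -[(EFin \o F) \o _]/(EFin \o (fun x => F (dilate v 1 x))) E.
move=> /(_ _ iF measurableT) H.
rewrite -[LHS]H; last exact/measurable_EFinP.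
apply: eq_measure_integral => A mA _; rewrite /pushforward.
by have := leb_outer_dilate v A (@ltr01 R); rewrite expr1n invr1 mul1e.
Qed.

(* The integral of F (x + t e_i) does not depend on t; differentiate under the
   integral sign at t = 0. *)
Lemma integral_partial_eq0 i F K : Ck_on 1 setT F -> compact K ->
  (forall x, ~ K x -> F x = 0) -> (\int[mu]_x (partial i F x)%:E = 0)%E.
Proof.
move=> CF cK F0.
set e : 'rV[R]_n := delta_mx ord0 i.
have oT : open [set: 'rV[R]_n] := openT.
have cF x : {for x, continuous F} by exact: (Ck_on_continuous oT CF).
have cdF x : {for x, continuous (partial i F)}.
  exact: (Ck_on_continuous oT (Ck_onS i CF)).
have oK : open (~` K).
  by apply: closed_openC; apply: compact_closed => //; exact: norm_hausdorff.
have dF0 x : ~ K x -> partial i F x = 0.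
  by move=> Kx; apply: (@partial_eq0 _ _ (~` K)) => // y; exact: F0.
have [r r0 Kr] := compact_sub_ball cK.
have cfK : {within K, continuous (partial i F)}.
  by apply: continuous_in_subspaceT => x _; exact: cdF.
have [C C0 CP] := compact_fun_bounded cK cfK.
have dFC x : `|partial i F x| <= C.
  by have [/CP//|/dF0 ->] := pselect (K x); rewrite normr0 ltW.
have mF : measurable_fun setT (F : lebT R n -> R).
  by apply: continuous_leb_measurable => // x _; exact: cF.
have e1 (t : R) : `|t *: e| <= `|t|.
  rewrite normrZ ler_piMr//; apply/row_norm_leP => // j.
  by rewrite mxE eqxx/=; case: (j == i); rewrite ?normr1 ?normr0.
(* This ball contains the supports of all translates with [|t| < 1], so that differentiation under
   the integral sign takes place over one set of finite measure. *)
pose B : set 'rV[R]_n := ball 0 (r + 1).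
have mB : measurable (B : set (lebT R n)) by exact: ball_leb_measurable.
have FB (t : R) y : `|t| < 1 -> ~ B y -> F (y + t *: e) = 0.
  move=> t1 By; apply: F0 => /Kr; rewrite ltNge => /negP; apply.
  have : r + 1 <= `|y|.
    by rewrite leNgt; apply/negP => yr; apply: By; rewrite /B ball_rowE/= sub0r normrN.
  move=> ry; have := lerB_normD y (t *: e); have := e1 t; lra.
have int (t : R) : mu.-integrable setT
    (EFin \o ((fun x => F (x + t *: e)) : lebT R n -> R)).
  apply: (@integrable_compact_supp _ ((fun x => x - t *: e) @` K)) => //.
  - apply: continuous_compact => //; apply: continuous_subspaceT.
    exact: shift_continuous.
  - move=> x _; have : {for x, continuous (F \o (fun x => x + t *: e))}; last by [].
    by apply: continuous_comp; [exact: shift_continuous|exact: cF].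
  - by move=> x Kx; apply: F0 => KF; apply: Kx; exists (x + t *: e); rewrite ?addrK.
have intB (t : R) : `|t| < 1 ->
    (\int[mu]_(x in B) (F (x + t *: e))%:E = \int[mu]_x (F x)%:E)%E.
  move=> t1; rewrite -(integral_translate mF (int t)) [LHS]integral_mkcond.
  apply: eq_integral => x _; rewrite patchE.
  by case: ifPn => // /negP; rewrite inE => Bx; rewrite (FB t x t1 Bx).
have I0 : (`](-1 : R), 1[%classic : set R) 0 by rewrite /= in_itv/= ltrN10 ltr01.
pose f (t : R) (x : lebT R n) : R := F ((x : 'rV[R]_n) + t *: e).
have derf (t : R) (x : 'rV[R]_n) : is_derive t 1 (f ^~ x) (partial i F (x + t *: e)).
  by apply: line_is_derive; apply/derivableP; exact: (Ck_on_derivable CF).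
pose I (t : R) : R := Rintegral mu (B : set (lebT R n)) (f t).
have cv : h^-1 *: (I (h + 0) - I 0) @[h --> 0^'] -->
    Rintegral mu (B : set (lebT R n)) (partial1of2 f 0).
  apply: (@cvg_differentiation_under_integral R _ _ mu f B mB 0 (-1) 1 I0 _ _ (cst C)).
  - by move=> t _; apply: (integrableS measurableT mB) => //; exact: int.
  - by move=> t x _ _; case: (derf t x).
  - by move=> x; exact: ltW.
  - apply: measurable_bounded_integrable => //; first exact: leb_bounded.
    by exists C; split; [exact: num_real|move=> M CM x _; rewrite /= ger0_norm ?ltW].
  - by move=> t x _ _; rewrite partial1of2E; have [_ ->] := derf t x; exact: dFC.
have IE (t : R) : `|t| < 1 -> I t = fine (\int[mu]_x (F x)%:E)%E.
  by move=> t1; rewrite /I /Rintegral intB.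
have cv0 : h^-1 *: (I (h + 0) - I 0) @[h --> 0^'] --> (0 : R).
  apply: cvg_near_cst; near=> h.
  rewrite !IE ?normr0// ?subrr ?scaler0// addr0.
  by near: h; apply: dnbhs0_lt.
have : Rintegral mu (B : set (lebT R n)) (partial1of2 f 0) = 0.
  exact: (cvg_unique _ cv cv0).
have -> : partial1of2 f 0 = partial i F.
  apply/funext => x; rewrite partial1of2E; have [_ ->] := derf 0 x.
  by rewrite scale0r addr0.
have int' : mu.-integrable setT (EFin \o (partial i F : lebT R n -> R)).
  by apply: (@integrable_compact_supp _ K) => // x _; exact: cdF.
have -> : (\int[mu]_x (partial i F x)%:E =
    \int[mu]_(x in B) (partial i F x)%:E)%E.
  rewrite [RHS]integral_mkcond; apply: eq_integral => x _; rewrite patchE.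
  case: ifPn => // /negP; rewrite inE => Bx; rewrite dF0// => /Kr xr.
  by apply: Bx; rewrite /B ball_rowE/= sub0r normrN; lra.
rewrite /Rintegral => E; rewrite -[LHS]fineK ?E//.
by apply: integrable_fin_num => //; exact: (integrableS measurableT mB) int'.
Unshelve. all: by end_near. Qed.

Lemma partial_mul i (U : set 'rV[R]_n) f g x : open U -> U x ->
  Ck_on 1 U f -> Ck_on 1 U g ->
  partial i (fun y => f y * g y) x = f x * partial i g x + partial i f x * g x.
Proof.
move=> oU Ux Uf Ug; rewrite /partial deriveM; last 2 first.
- exact: (Ck_on_derivable Uf Ux).
- exact: (Ck_on_derivable Ug Ux).
by rewrite /GRing.scale/= [X in _ + X]mulrC.
Qed.

Lemma test_continuous V phi : test_function V phi -> continuous phi.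
Proof. by move=> [/(_ 0%N) S _] x; exact: (Ck_on_continuous openT S). Qed.

Lemma test_partial_supp V phi i : test_function V phi ->
  exists K, [/\ compact K, K `<=` V,
    forall x, ~ K x -> phi x = 0 & forall x, ~ K x -> partial i phi x = 0].
Proof.
move=> [_ [K [cK KV phi0]]]; exists K; split => // x Kx.
apply: (@partial_eq0 _ _ (~` K)) => //.
by apply: closed_openC; apply: compact_closed => //; exact: norm_hausdorff.
Qed.

Lemma C1_weak_partial V i F : open V -> Ck_on 1 V F ->
  is_weak_partial V i F (partial i F).
Proof.
move=> oV VF; split.
  apply: continuous_loc_integrable => // x Vx.
  exact: (Ck_on_continuous oV (Ck_onS i VF) Vx).
move=> phi tphi; have [sphi _] := tphi.
have [K [cK KV phi0 dphi0]] := test_partial_supp i tphi.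
have oK : open (~` K).
  by apply: closed_openC; apply: compact_closed => //; exact: norm_hausdorff.
have mV := open_leb_measurable oV.
have cphi := test_continuous tphi.
have cdphi x : {for x, continuous (partial i phi)}.
  exact: (Ck_on_continuous openT (Ck_onS i (sphi 1%N))).
have phi1 U : open U -> Ck_on 1 U phi.
  by move=> oU; apply: (@Ck_on_sub _ _ _ _ setT) => //; exact: openT.
(* F is controlled inside V only. Extended by 0, the product is C^1 on the whole space: every point
   lies in V, where it equals F phi, or in the open complement of K, where it vanishes. *)
pose Psi := (fun x => F x * phi x) \_ V.
have PsiV x : V x -> F x * phi x = Psi x by move=> Vx; rewrite /Psi patchE mem_set.
have PsiK x : ~ K x -> Psi x = 0.
  by move=> Kx; rewrite /Psi patchE phi0// mulr0 if_same.
have CPsi : Ck_on 1 setT Psi.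
  apply: Ck_on_local; first exact: openT.
  move=> x _; have [Kx|Kx] := pselect (K x).
    exists V; split; [exact: oV|exact: KV|].
    by apply: (Ck_on_eq oV PsiV); apply: (Ck_onM oV VF); exact: phi1.
  exists (~` K); split; [exact: oK|exact: Kx|].
  by apply: (Ck_on_eq oK _ (Ck_on_cst 1 0 oK)) => y Ky; rewrite PsiK.
have := integral_partial_eq0 i CPsi cK PsiK.
have -> : (\int[mu]_x (partial i Psi x)%:E =
   \int[mu]_(x in V) ((F x * partial i phi x)%:E + (partial i F x * phi x)%:E))%E.
  rewrite [RHS]integral_mkcond; apply: eq_integral => x _; rewrite patchE.
  case: ifPn => [|/negP]; rewrite inE => Vx.
    rewrite -EFinD -(partial_mul i oV Vx VF (phi1 _ oV)); congr (_%:E).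
    by rewrite /partial; apply/esym/near_eq_derive; exact: open_eq_near Vx.
  rewrite (@partial_eq0 _ _ (~` K))//; first by move=> /KV.
have int1 : mu.-integrable (V : set (lebT R n))
    (EFin \o ((fun x => F x * partial i phi x) : lebT R n -> R)).
  apply: (integrable_compact_supp oV cK KV).
    move=> x Vx; apply: continuousM; first exact: (Ck_on_continuous oV VF Vx).
    exact: cdphi.
  by move=> x Kx; rewrite dphi0// mulr0.
have int2 : mu.-integrable (V : set (lebT R n))
    (EFin \o ((fun x => partial i F x * phi x) : lebT R n -> R)).
  apply: (integrable_compact_supp oV cK KV).
    move=> x Vx; apply: continuousM; last exact: cphi.
    exact: (Ck_on_continuous oV (Ck_onS i VF) Vx).
  by move=> x Kx; rewrite phi0// mulr0.
rewrite (integralD_EFin mV int1 int2).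
by apply: adde_eq0_fin; apply: integrable_fin_num => //.
Qed.

End compact_support.

(** * The fundamental lemma of the calculus of variations *)

Section outer_regularity.
Context {R : realType} {n : nat}.
Local Open Scope ereal_scope.

Lemma near_box (T : topologicalType) (f : T -> 'rV[R]_n) (t : T) (a b : 'I_n -> R) :
  {for t, continuous f} -> (forall i, a i < f t ord0 i < b i)%R ->
  \forall s \near t, forall i, (a i < f s ord0 i < b i)%R.
Proof.
move=> cf H; apply: filter_forall => i; have /andP[h1 h2] := H i.
have cfi : f s ord0 i @[s --> t] --> f t ord0 i.
  exact: (cvg_comp _ _ cf (@coord_continuous _ _ _ ord0 i (f t))).
near=> s; apply/andP; split; near: s; [exact: cvgr_gt cfi _ h1|exact: cvgr_lt cfi _ h2].
Unshelve. all: by end_near. Qed.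

Lemma leb_outer_cell (c : @cell R n) : leb_outer (cell_set c) <= cell_vol c.
Proof.
apply: ereal_inf_lbound; exists (fun k => if k == 0%N then c else None).
  by move=> y cy; exists 0%N.
rewrite (@nneseriesD1 _ _ 0%N xpredT)//= ?eseries0 ?adde0//.
  by move=> [|k].
by move=> k _; exact: cell_vol_ge0.
Qed.

Lemma cell_open_approx (c : @cell R n) (e : R) : (0 < e)%R ->
  exists O : set 'rV[R]_n, [/\ open O, cell_set c `<=` O &
    leb_outer O <= cell_vol c + e%:E].
Proof.
move=> e0; case: c => [[a b]|]; last first.
  exists set0; split => //.
  by rewrite /= leb_outer0 add0e lee_fin ltW.
have [[i bai]|ab] := pselect (exists i, b ord0 i <= a ord0 i)%R.
  exists set0; split; first exact: open0.
    move=> x /(_ i) /=; rewrite ltNge => /andP[ax /negP]; apply.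
    exact: le_trans ax.
  by rewrite leb_outer0 adde_ge0 ?cell_vol_ge0// lee_fin ltW.
have {}ab i : (a ord0 i < b ord0 i)%R.
  by rewrite ltNge; apply/negP => ?; apply: ab; exists i.
(* Cells already omit their upper faces, so only the lower faces have to be moved outwards, by [t];
   [v t] is the volume after this move. *)
pose v (t : R) : R := (\prod_(i < n) (b ord0 i - (a ord0 i - t)))%R.
have cv : v t @[t --> (0 : R)%R] --> v 0%R.
  apply: cvg_big; first exact: mul_continuous.
  move=> i _; apply: cvgB; first exact: cvg_cst.
  by apply: cvgB; [exact: cvg_cst|exact: cvg_id].
have [t t0 vt] : exists2 t, (0 < t)%R & (v t <= v 0 + e)%R.
  move/cvgrPdist_lt : cv => /(_ e e0)/nbhs_ballP[d /= d0 dP].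
  exists (d / 2)%R; first by rewrite divr_gt0.
  have : ball (0 : R)%R d (d / 2)%R.
    by rewrite -ball_normE/= sub0r normrN gtr0_norm ?divr_gt0//; lra.
  by move=> /dP; rewrite ltr_norml => /andP[? ?]; lra.
exists [set x | forall i, (a ord0 i - t < x ord0 i < b ord0 i)%R]; split.
- rewrite openE => x H.
  exact: (@near_box _ id x (fun i => a ord0 i - t)%R (fun i => b ord0 i)).
- move=> x /= H i; have /andP[h1 ->] := H i; rewrite andbT.
  by rewrite (lt_le_trans _ h1)// ltrBlDr ltrDl.
- apply: (@le_trans _ _ (cell_vol (Some (a - const_mx t, b)%R))).
    apply: le_trans (leb_outer_cell _); apply: le_leb_outer => x /= H i.
    by have /andP[h1 ->] := H i; rewrite !mxE (ltW h1).
  rewrite /= -EFinD lee_fin.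
  rewrite (eq_bigr (fun i => b ord0 i - (a ord0 i - t))%R) => [|i _]; last first.
    by rewrite !mxE max_r//; have := ab i; lra.
  rewrite [X in (_ <= X + _)%R](eq_bigr (fun i => b ord0 i - (a ord0 i - 0))%R).
    exact: vt.
  by move=> i _; rewrite subr0 max_r// subr_ge0 ltW.
Qed.

(** Half of [e] is spent on a nearly optimal cover by cells, the other half on replacing its cells
    by open sets. *)
Lemma leb_outer_open_approx (E : set 'rV[R]_n) (e : R) : (0 < e)%R ->
  leb_outer E < +oo ->
  exists O : set 'rV[R]_n, [/\ open O, E `<=` O & leb_outer O <= leb_outer E + e%:E].
Proof.
move=> e0 Eoo; have e20 : (0 < e / 2)%R by rewrite divr_gt0.
have Efin : leb_outer E \is a fin_num by rewrite ge0_fin_numE ?leb_outer_ge0.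
have [_ [C EC <-] Clt] := lb_ereal_inf_adherent e20 Efin.
have e2k k : (0 < (e / 2) / (2 ^ k.+1)%:R)%R.
  by rewrite divr_gt0// ltr0n expn_gt0.
have [G GP] := choice (fun k => cell_open_approx (C k) (e2k k)).
exists (\bigcup_k G k); split.
- by apply: bigcup_open => k _; case: (GP k).
- by move=> x /EC[k _ Ckx]; exists k => //; have [_ + _] := GP k; exact.
- apply: le_trans (leb_outer_sigma_subadditive _) _.
  apply: (@le_trans _ _ (\sum_(k <oo) (cell_vol (C k) + ((e / 2) / (2 ^ k.+1)%:R)%:E))).
    apply: lee_nneseries => k _; first by move=> _; exact: leb_outer_ge0.
    by case: (GP k).
  apply: (le_trans (epsilon_trick _ _ _)); first by move=> k; exact: cell_vol_ge0.
    exact: ltW.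
  rewrite [in leRHS](splitr e) EFinD addeA leeD2r//.
  exact: ltW.
Qed.

Lemma open_ball_seq (U : set 'rV[R]_n) : open U -> U !=set0 ->
  exists (c : nat -> 'rV[R]_n) (d : nat -> R), [/\ forall k, (0 < d k)%R,
    forall k, [set x | `|x - c k| <= d k]%R `<=` U &
    forall x, U x -> exists k, (`|x - c k| < d k)%R].
Proof.
move=> oU [u Uu].
have ballU x : U x -> exists2 e : R, (0 < e)%R & [set y | `|y - x| <= e]%R `<=` U.
  move=> Ux; have /nbhs_ballP[e /= e0 eU] := open_nbhs_nbhs (conj oU Ux).
  exists (e / 2)%R; first by rewrite divr_gt0.
  move=> y /= xy; apply: eU; rewrite ball_rowE/= distrC (le_lt_trans xy)//; lra.
have [eu eu0 euU] := ballU u Uu.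
pose B (qk : 'rV[rat]_n * nat) : set 'rV[R]_n :=
  [set y | `|y - map_mx ratr qk.1| <= qk.2.+1%:R^-1]%R.
(* Codes that do not describe a ball inside U are sent to one fixed ball, which keeps all radii
   positive and all closed balls inside U. *)
pose p k : 'rV[R]_n * R := if unpickle k is Some qk then
  if `[< B qk `<=` U >] then (map_mx ratr qk.1, qk.2.+1%:R^-1)%R else (u, eu)
  else (u, eu).
exists (fun k => (p k).1), (fun k => (p k).2); split.
- by move=> k; rewrite /p; case: unpickle => // qk; case: ifP => //= _; rewrite invr_gt0.
- by move=> k; rewrite /p; case: unpickle => // qk; case: ifPn => // /asboolP.
- move=> x Ux; have [e e0 xeU] := ballU x Ux.
  pose k := Num.truncn (2 / e)%R.
  have ke : (k.+1%:R^-1 * 2 <= e)%R.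
    rewrite -ler_pdivlMr// -[leRHS]invrK lef_pV2 ?posrE ?invr_gt0 ?divr_gt0//.
    by rewrite invf_div; exact/ltW/truncnS_gt.
  have k0 : (0 < k.+1%:R^-1 :> R)%R by rewrite invr_gt0.
  have qP i : exists q : rat, (`|ratr q - x ord0 i| < k.+1%:R^-1)%R.
    have /rat_in_itvoo[q] : (x ord0 i - k.+1%:R^-1 < x ord0 i + k.+1%:R^-1)%R.
      by rewrite ltrBlDr -addrA ltrDl addr_gt0.
    by rewrite in_itv/= => q12; exists q; rewrite ltr_distl.
  have [q qx] := choice qP.
  have BU : B (\row_i q i, k) `<=` U.
    move=> y; rewrite /B/= => By; apply: xeU; apply: le_trans ke.
    rewrite mulr_natr mulr2n -(subrKA (map_mx ratr (\row_i q i))).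
    apply: (le_trans (ler_normD _ _)); apply: lerD => //; apply: ltW.
    by apply/(row_norm_ltP _ k0) => i; rewrite !mxE; exact: qx.
  exists (pickle (\row_i q i, k)); rewrite /p pickleK ifT; last exact/asboolP.
  by apply/(row_norm_ltP _ k0) => i; rewrite !mxE distrC; exact: qx.
Qed.

End outer_regularity.

Section fundamental_lemma.
Context {R : realType} {n : nat}.
Implicit Types (V K : set 'rV[R]_n) (h : 'rV[R]_n -> R).
Local Notation mu := (leb R n).

Lemma ecvg_cst0 (f : nat -> \bar R) l : f j @[j --> \oo] --> l ->
  (forall j, f j = 0%E) -> l = 0%E.
Proof.
move=> fl f0; rewrite -(cvg_lim (@ereal_hausdorff R) fl).
by rewrite (_ : f = cst 0%E) ?lim_cst//; apply/funext.
Qed.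

Definition test_null V h := forall phi, test_function V phi ->
  (\int[mu]_(x in V) (h x * phi x)%:E = 0)%E.

(* The test functions j s_j / (1 + j s_j), where s_j is the sum of the first j
   bumps of a sequence of balls filling O, increase to the indicator of O. *)
Lemma test_null_open V K h O : open V -> loc_integrable V h -> test_null V h ->
  compact K -> K `<=` V -> open O -> O `<=` K ->
  (\int[mu]_(x in O) (h x)%:E = 0)%E.
Proof.
move=> oV hloc hnull cK KV oO OK.
have [neO|] := pselect (O !=set0); last first.
  by move=> /set0P/negP/negPn/eqP ->; rewrite integral_set0.
have [c [d [d0 dO Od]]] := open_ball_seq oO neO.
have mV := open_leb_measurable oV; have mO := open_leb_measurable oO.
have mK := compact_leb_measurable cK.
pose s (j : nat) (x : 'rV[R]_n) : R := \sum_(k < j) cube_bump (c k) (d k) x.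
have s0 j x : 0 <= s j x by apply: sumr_ge0 => k _; exact: cube_bump_ge0.
pose phi (j : nat) (x : 'rV[R]_n) : R := (j%:R * s j x) / (1 + j%:R * s j x).
have den j x : 0 < 1 + j%:R * s j x by rewrite ltr_pwDl// mulr_ge0.
have sO j x : ~ O x -> s j x = 0.
  move=> Ox; apply: big1 => k _; apply: cube_bump_eq0 => //.
  by rewrite leNgt; apply/negP => /ltW xk; apply: Ox; exact: (dO k).
have ssm j r : Ck_on r setT (s j).
  apply: Ck_on_sum; first exact: openT.
  by move=> k; apply: cube_bump_smooth; exact: openT.
have jsm j r : Ck_on r setT (fun x => j%:R * s j x).
  apply: (Ck_onM openT _ (ssm j r)); exact: Ck_on_cst openT.
have phism j : smooth_on setT (phi j).
  move=> r; apply: (Ck_onM openT (jsm j r)).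
  apply: (Ck_onV openT); first by move=> x _; rewrite gt_eqF.
  exact: (Ck_onD openT (Ck_on_cst _ _ openT) (jsm j r)).
have phitest j : test_function V (phi j).
  split; first exact: phism.
  exists K; split => // x Kx; rewrite /phi sO ?mulr0 ?mul0r//.
  by move=> /OK.
have phi01 j x : 0 <= phi j x <= 1.
  rewrite /phi divr_ge0 ?mulr_ge0// ?(ltW (den j x))//=.
  by rewrite ler_pdivrMr// mul1r lerDr.
have hK : mu.-integrable (K : set (lebT R n)) (EFin \o (h : lebT R n -> R)).
  apply/integrableP; split; last exact: (hloc.2 K cK KV).
  by apply/measurable_EFinP; apply: measurable_funS (hloc.1) => //.
have hO : mu.-integrable (O : set (lebT R n)) (EFin \o (h : lebT R n -> R)).
  exact: integrableS hK.
have hphi j : (\int[mu]_(x in O) (h x * phi j x)%:E = 0)%E.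
  rewrite -[RHS](hnull _ (phitest j)) [LHS]integral_mkcond [RHS]integral_mkcond.
  apply: eq_integral => x _; rewrite !patchE.
  case: ifPn => [|/negP]; rewrite inE => Ox.
    by rewrite mem_set//; exact/KV/OK.
  by rewrite [phi j x]/phi sO// mulr0 mul0r mulr0 if_same.
have := @dominated_cvg _ _ _ mu _ mO (fun j x => (h x * phi j x)%:E)
  (fun x => (h x)%:E) (fun x => `|h x|%:E).
move=> H; have {}H : (\int[mu]_(x in O) (h x * phi j x)%:E @[j --> \oo] -->
    \int[mu]_(x in O) (h x)%:E)%E.
  apply: H.
  - move=> j; apply/measurable_EFinP; apply: measurable_funM.
      by apply/measurable_EFinP; case/integrableP : hO.
    apply: continuous_leb_measurable => // x _.
    exact: (Ck_on_continuous openT (phism j 0%N)).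
  - move=> x Ox; apply: cvg_EFin; first exact: nearW.
    rewrite -[X in _ --> X]mulr1; apply: cvgM; first exact: cvg_cst.
    have [k xk] := Od x Ox.
    have bk : 0 < cube_bump (c k) (d k) x by exact/cube_bump_gt0.
    have sk j : (k < j)%N -> cube_bump (c k) (d k) x <= s j x.
      move=> kj; rewrite /s (bigD1 (Ordinal kj))//= lerDl.
      by apply: sumr_ge0 => l _; exact: cube_bump_ge0.
    have phiE j : phi j x = 1 - (1 + j%:R * s j x)^-1.
      by rewrite /phi -[X in X / _](addKr 1) mulrDl divff ?gt_eqF// mulN1r addrC.
    rewrite (_ : phi ^~ x = fun j => 1 - (1 + j%:R * s j x)^-1); last first.
      by apply/funext => j; exact: phiE.
    have : 1 - (1 + j%:R * s j x)^-1 @[j --> \oo] --> 1 - (0 : R); last by rewrite subr0.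
    apply: cvgB; first exact: cvg_cst.
    apply/cvgrPdist_lt => e e0; near=> j.
    have kj : (k < j)%N by near: j; exact: nbhs_infty_gt.
    rewrite sub0r normrN gtr0_norm ?invr_gt0//.
    rewrite -[ltRHS]invrK ltf_pV2 ?posrE ?invr_gt0//.
    have : e^-1 / cube_bump (c k) (d k) x < j%:R by near: j; exact: nbhs_infty_gtr.
    rewrite ltr_pdivrMr// => /lt_le_trans; apply.
    by rewrite ler_wpDl// ler_wpM2l// sk.
  - by [].
  - apply/integrableP; have /integrableP[mh hoo] := hO; split.
      by apply/measurable_EFinP; apply: measurableT_comp => //; exact/measurable_EFinP.
    by under eq_integral do rewrite /= normr_id.
  - move=> j x Ox; rewrite abse_EFin lee_fin normrM ler_piMr//.
    by have /andP[? ?] := phi01 j x; rewrite ger0_norm.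
exact: ecvg_cst0 H hphi.
Unshelve. all: by end_near. Qed.

(** By outer regularity E lies in a decreasing sequence of open subsets of the ball whose
    intersection differs from E by a null set. The integrals over these open sets vanish, and
    dominated convergence carries this to the intersection. *)
Lemma test_null_set V h (c : 'rV[R]_n) (d : R) (E : set 'rV[R]_n) :
  open V -> loc_integrable V h -> test_null V h ->
  [set x | `|x - c| <= d] `<=` V -> measurable (E : set (lebT R n)) ->
  E `<=` ball c d -> (\int[mu]_(x in E) (h x)%:E = 0)%E.
Proof.
move=> oV hloc hnull KV mE EB.
set B : set 'rV[R]_n := ball c d in EB *.
have mB : measurable (B : set (lebT R n)) by exact: ball_leb_measurable.
have oB : open B by exact: ball_open.
have BK : B `<=` [set x | `|x - c| <= d].
  by move=> x; rewrite /B ball_rowE/= distrC => /ltW.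
have cK := @closed_cube_compact R n c d; have mK := compact_leb_measurable cK.
have Boo : (mu B < +oo)%E := leb_bounded c d.
have Eoo : (leb_outer E < +oo)%E by apply: le_lt_trans Boo; exact: le_leb_outer.
have hB : mu.-integrable (B : set (lebT R n)) (EFin \o (h : lebT R n -> R)).
  apply: (integrableS mK) => //; apply/integrableP; split; last exact: (hloc.2 _ cK KV).
  apply/measurable_EFinP; apply: measurable_funS (hloc.1) => //.
  exact: open_leb_measurable.
have e0 j : 0 < j.+1%:R^-1 :> R by rewrite invr_gt0.
have [U UP] := choice (fun j => leb_outer_open_approx (e0 j) Eoo).
(* Intersecting the first j + 1 approximations makes the sequence decreasing, and intersecting with
   B keeps it inside a compact subset of V. *)
pose G j : set 'rV[R]_n := B `&` \big[setI/setT]_(i < j.+1) U i.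
have oG j : open (G j).
  apply: openI => //; apply: (big_ind (fun A : set 'rV[R]_n => open A)).
  - exact: openT.
  - exact: openI.
  - by move=> i _; case: (UP i).
have GE j x : G j x <-> B x /\ forall i, (i <= j)%N -> U i x.
  by rewrite /G -bigcap_mkord; split=> [[Bx H]|[Bx H]]; split => // i; exact: H.
have EG j : E `<=` G j.
  by move=> x Ex; apply/GE; split; [exact: EB|move=> i _; have [_ + _] := UP i; exact].
have mG j : measurable (G j : set (lebT R n)) by exact: open_leb_measurable.
have hG j : (\int[mu]_(x in B) ((h x)%:E * (\1_(G j) x)%:E) = 0)%E.
  rewrite -[RHS](@test_null_open V _ h (G j) oV hloc hnull cK KV (oG j)); last first.
    by move=> x /GE[/BK].
  rewrite [LHS]integral_mkcond [RHS]integral_mkcond; apply: eq_integral => x _.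
  rewrite !patchE indicE; have [Gx|Gx] := boolP (x \in G j).
    by rewrite mem_set ?mule1//; move: Gx; rewrite inE => /GE[].
  by rewrite mule0 if_same.
pose Goo : set 'rV[R]_n := \bigcap_j G j.
have mGoo : measurable (Goo : set (lebT R n)) by exact: bigcapT_measurable.
have EGoo : E `<=` Goo by move=> x Ex j _; exact: EG.
have GooB : Goo `<=` B by move=> x /(_ 0%N I)/GE[].
have lim0 : (\int[mu]_(x in B) ((h x)%:E * (\1_Goo x)%:E) = 0)%E.
  have mh : measurable_fun (B : set (lebT R n)) (EFin \o (h : lebT R n -> R)).
    by case/integrableP : hB.
  have H : (\int[mu]_(x in B) ((h x)%:E * (\1_(G j) x)%:E) @[j --> \oo] -->
      \int[mu]_(x in B) ((h x)%:E * (\1_Goo x)%:E))%E.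
    apply: (@dominated_cvg _ _ _ mu _ mB _ _ (fun x => `|h x|%:E)).
    - move=> j; apply: emeasurable_funM => //.
      by apply/measurable_EFinP; exact: measurable_indic.
    - move=> x Bx; have [Gx|] := pselect (Goo x).
        apply: cvg_near_cst; near=> j; rewrite !indicE !mem_set//.
        exact: Gx.
      move=> /existsNP[j /not_implyP[_ Gjx]].
      apply: cvg_near_cst; near=> k; rewrite !indicE !memNset//.
        by move=> /(_ j I).
      move=> /GE[_ Gk]; apply: Gjx; apply/GE; split => // i ij; apply: Gk.
      by apply: (leq_trans ij); near: k; exact: nbhs_infty_ge.
    - by [].
    - apply/integrableP; have /integrableP[_ hoo] := hB; split.
        by apply/measurable_EFinP; apply: measurableT_comp => //; exact/measurable_EFinP.
      by under eq_integral do rewrite /= normr_id.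
    - move=> j x Bx; rewrite -EFinM abse_EFin lee_fin normrM ler_piMr// indicE.
      by case: (x \in G j); rewrite ?normr1 ?normr0.
  exact: ecvg_cst0 H hG.
have hGoo : mu.-integrable (Goo : set (lebT R n)) (EFin \o (h : lebT R n -> R)).
  exact: (integrableS mB).
have N0 : mu (Goo `\` E) = 0%E.
  have GooE : (leb_outer Goo <= leb_outer E)%E.
    apply/lee_addgt0Pr => e e_gt0.
    have [j je] : exists j, j.+1%:R^-1 <= e :> R.
      exists (Num.truncn e^-1); rewrite -[leRHS]invrK lef_pV2 ?posrE ?invr_gt0//.
      exact/ltW/truncnS_gt.
    have [_ _ Uj] := UP j.
    apply: (@le_trans _ _ (leb_outer (U j))).
      by apply: le_leb_outer => x /(_ j I)/GE[_]; exact.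
    by apply: (le_trans Uj); rewrite leeD2l// lee_fin.
  have Gfin : (mu Goo < +oo)%E by exact: le_lt_trans GooE Eoo.
  apply/eqP; rewrite -measure_le0 measureD// setIidr//.
  rewrite leeBlDr ?add0e//.
  by rewrite ge0_fin_numE.
have -> : E = Goo `\` (Goo `\` E).
  by rewrite setDD setIidr.
rewrite -(negligible_integral (measurableD mGoo mE) mGoo hGoo N0).
rewrite -[RHS]lim0 [LHS]integral_mkcond [RHS]integral_mkcond.
apply: eq_integral => x _; rewrite !patchE indicE.
have [Gx|Gx] := boolP (x \in Goo).
  by rewrite mem_set ?mule1//; move: Gx; rewrite inE => /GooB.
by rewrite mule0 if_same.
Unshelve. all: by end_near. Qed.

(** On each ball of a countable cover the integral of |h| is 0, because [test_null_set] applies both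
    to the part where h >= 0 and to the part where h < 0. *)
Lemma test_null_ae V h : open V -> loc_integrable V h -> test_null V h ->
  {ae mu, forall x, V x -> h x = 0}.
Proof.
move=> oV hloc hnull.
have [neV|] := pselect (V !=set0); last first.
  by move=> /set0P/negP/negPn/eqP ->; apply: aeW.
have [c [d [d0 dV Vd]]] := open_ball_seq oV neV.
have mV := open_leb_measurable oV.
have null k : {ae mu, forall x, ball (c k) (d k) x -> h x = 0}.
  set B := ball (c k) (d k).
  have mB : measurable (B : set (lebT R n)) by exact: ball_leb_measurable.
  have BV : B `<=` V.
    by move=> x; rewrite /B ball_rowE/= distrC => /ltW; exact: dV.
  have mh : measurable_fun (B : set (lebT R n)) (h : lebT R n -> R).
    exact: measurable_funS (hloc.1).
  have mhE : measurable_fun (B : set (lebT R n)) (EFin \o (h : lebT R n -> R)).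
    exact/measurable_EFinP.
  pose Ep : set 'rV[R]_n := B `&` [set x | 0 <= h x].
  pose Em : set 'rV[R]_n := B `&` [set x | h x < 0].
  have mEp : measurable (Ep : set (lebT R n)).
    have := mh mB _ (measurable_itv `[0, +oo[); congr measurable.
    by apply/seteqP; split => x [Bx]; rewrite /= in_itv/= andbT.
  have mEm : measurable (Em : set (lebT R n)).
    by have := mh mB _ (measurable_itv `]-oo, 0[); congr measurable.
  have BE : B = Ep `|` Em.
    rewrite /Ep /Em -setIUr; apply/esym/setIidl => x _ /=.
    by have [|] := leP 0 (h x); [left|right].
  have [H _] := @ae_eq_integral_abs _ _ _ mu B mB (EFin \o h) mhE.
  have : (\int[mu]_(x in B) `|(EFin \o h) x| = 0)%E.
    rewrite BE ge0_integral_setU//; last 2 first.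
    - rewrite -BE; apply: measurableT_comp => //.
    - rewrite disj_set2E; apply/eqP/seteqP; split => // x [[_ /= h0] [_ /=]].
      by rewrite ltNge h0.
    have -> : (\int[mu]_(x in Ep) `|(EFin \o h) x| = \int[mu]_(x in Ep) (h x)%:E)%E.
      by apply: eq_integral => x; rewrite inE => -[_ /= h0]; rewrite ger0_norm.
    have -> : (\int[mu]_(x in Em) `|(EFin \o h) x| = 0)%E.
      transitivity (\int[mu]_(x in Em) (- h x)%:E)%E.
        by apply: eq_integral => x; rewrite inE => -[_ /= h0]; rewrite ltr0_norm.
      apply: oppe_inj; rewrite oppe0 -integral_ge0N; last first.
        by move=> x [_ /= h0]; rewrite lee_fin oppr_ge0 ltW.
      rewrite -[RHS](@test_null_set V h (c k) (d k) Em)//; last by move=> x [].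
      by apply: eq_integral => x _; rewrite -EFinN opprK.
    by rewrite (@test_null_set V h (c k) (d k) Ep)// ?adde0//; move=> x [].
  move=> /H; apply: negligibleS => x /= /not_implyP[Bx hx] H'; apply: hx.
  by have [] := H' Bx.
apply: negligibleS (negligible_bigcup null) => x /= /not_implyP[Vx hx].
have [k xk] := Vd x Vx; exists k => //= H; apply: hx; apply: H.
by rewrite ball_rowE/= distrC.
Qed.

(** [weak_partial] selects an arbitrary weak derivative; for C^1 functions this lemma allows the
    classical one to replace it in every integral. *)
Lemma weak_partial_C1_ae V i (F g : 'rV[R]_n -> R) : open V -> Ck_on 1 V F ->
  is_weak_partial V i F g -> {ae mu, forall x, V x -> g x = partial i F x}.
Proof.
move=> oV VF [gloc gP].
have [dloc dP] := C1_weak_partial i oV VF.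
have mV := open_leb_measurable oV.
have hnull : test_null V (fun x => g x - partial i F x).
  move=> phi tphi; have cphi := test_continuous tphi; have [_ supp] := tphi.
  have int1 := loc_integrable_test oV gloc supp cphi.
  have int2 := loc_integrable_test oV dloc supp cphi.
  under eq_integral do rewrite mulrBl EFinB.
  rewrite (integralB_EFin mV int1 int2).
  have E : (\int[mu]_(x in V) (g x * phi x)%:E =
      \int[mu]_(x in V) (partial i F x * phi x)%:E)%E.
    by apply: oppe_inj; rewrite -gP// -dP.
  by rewrite E subee//; exact: integrable_fin_num int2.
have hloc : loc_integrable V (fun x => g x - partial i F x).
  split; first by apply: measurable_funB; [exact: gloc.1|exact: dloc.1].
  move=> K cK KV; have mK := compact_leb_measurable cK.
  have KE f : loc_integrable V f ->
      mu.-integrable (K : set (lebT R n)) (EFin \o (f : lebT R n -> R)).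
    move=> [mf floc]; apply/integrableP; split; last exact: floc.
    by apply/measurable_EFinP; exact: measurable_funS mf.
  have /integrableP[_] := integrableB mK (KE _ gloc) (KE _ dloc).
  by [].
apply: negligibleS (test_null_ae oV hloc hnull) => x /= /not_implyP[Vx gx] H.
by apply: gx; apply/eqP; rewrite -subr_eq0 H.
Qed.

End fundamental_lemma.

(** * Morrey estimates on good cubes *)

Section good_radius.
Context {R : realType}.

(* Nested intervals of ratio 1/m: at each step one of the m - 2 inner pieces
   carries at most 1/(m - 2) of the increment of Phi, and the limit point stays
   at a distance comparable to its length from the complement of each interval. *)
Lemma good_radius (Phi : R -> R) (a0 l0 E : R) (m : nat) : (3 < m)%N -> 0 < l0 ->
  {homo Phi : x y / x <= y} -> Phi (a0 + l0) - Phi a0 <= E ->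
  exists2 r, a0 <= r <= a0 + l0 & forall j, exists a,
    [/\ a <= r - l0 / m%:R ^+ j.+1, r + l0 / m%:R ^+ j.+1 <= a + l0 / m%:R ^+ j &
        Phi (a + l0 / m%:R ^+ j) - Phi a <= E / (m - 2)%:R ^+ j].
Proof.
move=> m3 l00 Phi_homo PhiE.
have m0 : 0 < m%:R :> R by rewrite ltr0n (leq_trans _ m3).
have m20 : 0 < (m - 2)%:R :> R by rewrite ltr0n subn_gt0 (leq_trans _ m3).
pose l j : R := l0 / m%:R ^+ j.
have l_gt0 j : 0 < l j by rewrite divr_gt0// exprn_gt0.
have lS j : l j = l j.+1 * m%:R.
  by rewrite /l exprSr invfM mulrA mulfVK// gt_eqF.
pose S j a := Phi (a + l j) - Phi a <= E / (m - 2)%:R ^+ j.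
have stepP ja : exists a', S ja.1 ja.2 -> [/\ S ja.1.+1 a', ja.2 + l ja.1.+1 <= a' &
    a' + l ja.1.+1 <= ja.2 + l ja.1 - l ja.1.+1].
  case: ja => j a /=; have [Sja|] := pselect (S j a); last by move=> H; exists 0.
  pose p i := a + i%:R * l j.+1.
  have [[i [i1 im Si]]|H] := pselect (exists i, [/\ (1 <= i)%N, (i < m.-1)%N & S j.+1 (p i)]).
    exists (p i) => _; split => //.
      by rewrite /p lerD2l ler_peMl ?ler1n// ltW.
    have : i%:R + 2 <= m%:R :> R.
      rewrite -natrD ler_nat addn2.
      by move: im; case: (m) m3 => //.
    have := l_gt0 j.+1; rewrite /p (lS j) => ? ?; nra.
  exfalso.
  have pS i : p i.+1 = p i + l j.+1 by rewrite /p -addn1 natrD mulrDl mul1r addrA.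
  have Hi i : (1 <= i < m.-1)%N -> E / (m - 2)%:R ^+ j.+1 < Phi (p i.+1) - Phi (p i).
    move=> /andP[i1 im]; rewrite ltNge; apply/negP => le; apply: H; exists i.
    by split => //; rewrite /S -pS.
  have sum1 : \sum_(1 <= i < m.-1) (Phi (p i.+1) - Phi (p i)) = Phi (p m.-1) - Phi (p 1%N).
    by rewrite telescope_sumr//; move: m3; case: (m) => [|[|[|]]].
  have sum2 : \sum_(1 <= i < m.-1) (E / (m - 2)%:R ^+ j.+1) = E / (m - 2)%:R ^+ j.
    rewrite sumr_const_nat.
    have -> : (m.-1 - 1 = m - 2)%N by move: m3; case: (m) => [|[|[|k]]]//= _; rewrite !subSS subn0.
    by rewrite -[LHS]mulr_natr exprSr invfM mulrA mulfVK// gt_eqF.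
  have : \sum_(1 <= i < m.-1) (E / (m - 2)%:R ^+ j.+1) <
      \sum_(1 <= i < m.-1) (Phi (p i.+1) - Phi (p i)).
    apply: ltr_sum_nat; first by move: m3; case: (m) => [|[|[|]]].
    by move=> i; exact: Hi.
  rewrite sum1 sum2 ltNge => /negP; apply; apply: le_trans Sja.
  apply: lerB; apply: Phi_homo.
    rewrite /p (lS j) lerD2l mulrC ler_wpM2l ?ler_nat ?leq_pred//; exact: ltW.
  by rewrite /p mul1r lerDl ltW.
have [f fP] := choice stepP.
pose a := fix a j := if j is j'.+1 then f (j', a j') else a0.
have aS j : S j (a j).
  elim: j => [|j IH]; first by rewrite /S /l expr0 !divr1.
  by have [] := fP (j, a j) IH.
have aP j : a j + l j.+1 <= a j.+1 /\ a j.+1 + l j.+1 <= a j + l j - l j.+1.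
  by have [] := fP (j, a j) (aS j).
have a_nd : {homo a : i j / (i <= j)%N >-> i <= j}.
  apply: homo_leq => // [x y z|j]; first exact: le_trans.
  by have [h _] := aP j; have := l_gt0 j.+1; lra.
have b_ni : forall i j, (i <= j)%N -> a j + l j <= a i + l i.
  move=> i j; elim: j => [|j IH]; first by rewrite leqn0 => /eqP ->.
  rewrite leq_eqVlt => /orP[/eqP -> //|/IH h].
  by have [_] := aP j; have := l_gt0 j.+1; lra.
have a_ub j k : a k <= a j + l j.
  have [kj|jk] := leqP k j.
    by apply: (le_trans (a_nd _ _ kj)); rewrite lerDl ltW.
  by apply: le_trans (b_ni _ _ (ltnW jk)); rewrite lerDl ltW.
have hs : has_sup (range a).
  by split; [exists (a 0%N), 0%N|exists (a 0%N + l 0%N) => _ [k _ <-]].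
pose r := sup (range a).
have ar j : a j <= r by apply: ub_le_sup; [by case: hs|by exists j].
have rb j : r <= a j + l j.
  by apply: ge_sup; [case: hs|move=> _ [k _ <-]].
exists r.
  by rewrite (ar 0%N)/=; have := rb 0%N; rewrite /l expr0 divr1.
move=> j; exists (a j); rewrite -/(l j) -/(l j.+1).
have [h1 h2] := aP j; have := ar j.+1; have := rb j.+1.
by split; [lra|lra|exact: aS].
Qed.

End good_radius.

(** * Growth of the Young function and choice of the scales *)

Section young_facts.
Context {R : realType}.
Variable P : R -> R.
Hypothesis P_young : young_function P.

Lemma young0 : P 0 = 0. Proof. by case: P_young. Qed.

Lemma young_le (s t : R) : 0 <= s -> s <= t -> P s <= P t.
Proof.
move=> s0; rewrite le_eqVlt => /orP[/eqP -> //|st].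
apply: ltW; have [_ H _] := P_young.
by apply: H; [exact: s0|exact: le_trans s0 (ltW st)|].
Qed.

Lemma young_ge0 (t : R) : 0 <= t -> 0 <= P t.
Proof. by move=> t0; rewrite -young0; exact: young_le. Qed.

Lemma young_gt0 (t : R) : 0 < t -> 0 < P t.
Proof.
move=> t0; rewrite -young0; have [_ H _] := P_young.
by apply: H; [exact: lexx|exact: ltW|].
Qed.

Lemma young_measurable d (T : measurableType d) (D : set T) (f : T -> R) (k : R) :
  0 < k -> measurable_fun D f -> measurable_fun D (fun x => P (`|f x| / k)).
Proof.
move=> k0 mf.
(* P is monotone on nonnegative arguments only; composed with [Num.max 0] it is monotone on the
   whole line, hence measurable. *)
have -> : (fun x => P (`|f x| / k)) =
    (fun t => P (Num.max 0 t)) \o (fun x => `|f x| / k).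
  by apply/funext => x /=; rewrite max_r// divr_ge0// ltW.
apply: measurableT_comp.
  apply: nondecreasing_measurable => // s t st; apply: young_le.
    by rewrite le_max lexx.
  by rewrite ge_max !le_max lexx/= st orbT.
by apply: measurable_funM => //; apply: measurableT_comp.
Qed.

Lemma young_mid (s t : R) : 0 <= s -> 0 <= t -> P ((s + t) / 2) <= (P s + P t) / 2.
Proof.
move=> s0 t0; have [_ _ H] := P_young.
have h01 : (0 <= 2^-1 :> R) && (2^-1 <= 1 :> R) by apply/andP; split; lra.
have := H (Itv01 (proj1 (andP h01)) (proj2 (andP h01))) s t.
rewrite !inE/= !in_itv/= s0 t0 => /(_ isT isT).
rewrite !convRE/= => h; have -> : (s + t) / 2 = 2^-1 * s + (1 - 2^-1) * t by field.
apply: (le_trans h).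
by have -> : (P s + P t) / 2 = 2^-1 * P s + (1 - 2^-1) * P t by field.
Qed.

Context (alpha : R) (alpha_ge1 : 1 <= alpha).
Hypothesis P_iv : forall s t, 0 < s -> s <= t ->
  s `^ (- alpha) * P s <= t `^ (- alpha) * P t.

(** For t > s write t = t^(1-alpha) t^alpha: the first factor is at most s^(1-alpha), and the second
    at most P t / P 1 by (iv). The threshold [s] remains free so that it can grow with the scale. *)
Lemma young_growth (s t : R) : 1 <= s -> 0 <= t ->
  t <= s + s `^ (1 - alpha) / P 1 * P t.
Proof.
move=> s1 t0; have P1 := young_gt0 (@ltr01 R).
have s0 : 0 < s by rewrite (lt_le_trans ltr01).
have [ts|st] := leP t s.
  by rewrite ler_wpDr// mulr_ge0 ?young_ge0// divr_ge0 ?powR_ge0// ltW.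
have tp : 0 < t by exact: lt_trans st.
rewrite ler_wpDl ?(ltW s0)//.
have h1 : P 1 <= t `^ (- alpha) * P t.
  have t1 : 1 <= t by exact: le_trans s1 (ltW st).
  by have := P_iv ltr01 t1; rewrite powR1 mul1r.
have h2 : t `^ alpha * P 1 <= P t.
  by move: h1; rewrite powRN -ler_pdivrMl ?invr_gt0 ?powR_gt0// invrK.
have h3 : t = t `^ (1 - alpha) * t `^ alpha.
  rewrite -powRD ?subrK ?powRr1 ?(ltW tp)//.
  by rewrite oner_eq0.
have h4 : t `^ (1 - alpha) <= s `^ (1 - alpha).
  rewrite -opprB !powRN lef_pV2 ?posrE ?powR_gt0//.
  by apply: ge0_ler_powR; rewrite ?nnegrE ?subr_ge0// ltW.
rewrite {1}h3 mulrAC ler_pdivlMr// -mulrA.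
by apply: ler_pM => //; rewrite ?powR_ge0// mulr_ge0 ?powR_ge0// ltW.
Qed.

(** With threshold b^j at radius of order m^-j, where the energy is of order (m - 2)^-j, the means
    of a function change by at most a multiple of m^-j (b^j + b^(j(1-alpha)) m^(nj) (m - 2)^-j). The
    last inequality bounds this by a multiple of (b / m)^j. It reads b^alpha >= m^n / (m - 2) and
    holds for b^alpha = 2 m^(n-1) and m >= 4; then b < m as soon as m^(alpha-n+1) > 2, and here
    alpha > n - 1 is decisive. *)
Lemma geometric_choice (n : nat) : (0 < n)%N -> n%:R - 1 < alpha ->
  exists (m : nat) (b : R), [/\ (3 < m)%N, 1 <= b, b < m%:R &
    b `^ (1 - alpha) * m%:R ^+ n <= b * (m - 2)%:R].
Proof.
move=> n0 nalpha; pose gam := alpha - (n%:R - 1).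
have gam0 : 0 < gam by rewrite subr_gt0.
have alpha0 : 0 < alpha by exact: lt_le_trans ltr01 _.
(* So m >= 4 and m >= 3^(1/gam), whence m^gam >= 3 > 2. *)
pose m := (4 + Num.truncn (3 `^ gam^-1 : R))%N.
have m3 : (3 < m)%N by [].
have m0 : 0 < m%:R :> R by rewrite ltr0n.
have m2 : 2 < (m%:R : R) `^ gam.
  have h : 3 `^ gam^-1 <= m%:R :> R.
    by apply: (le_trans (ltW (truncnS_gt _))); rewrite ler_nat /m addSn ltnS leq_addl.
  have : (3 `^ gam^-1) `^ gam <= (m%:R : R) `^ gam.
    by apply: ge0_ler_powR; rewrite ?nnegrE ?powR_ge0 ?ler0n// ltW.
  by rewrite -powRrM mulVf ?gt_eqF// powRr1// => ?; lra.
pose b : R := (2 * m%:R ^+ n.-1) `^ alpha^-1.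
have mn1 : 1 <= m%:R ^+ n.-1 :> R by rewrite exprn_ege1// ler1n.
have balpha : b `^ alpha = 2 * m%:R ^+ n.-1.
  by rewrite /b -powRrM mulVf ?gt_eqF// powRr1// mulr_ge0// exprn_ge0.
have b1 : 1 <= b.
  rewrite -[leLHS](powRr0 (2 * m%:R ^+ n.-1)); apply: ler_powR.
    by lra.
  by rewrite invr_ge0 ltW.
have b0 : 0 < b by exact: lt_le_trans b1.
exists m, b; split => //.
- rewrite ltNge; apply/negP => mb.
  have : (m%:R : R) `^ alpha <= b `^ alpha.
    by apply: ge0_ler_powR; rewrite ?nnegrE// ltW.
  rewrite balpha leNgt => /negP; apply.
  have -> : (m%:R : R) `^ alpha = m%:R `^ gam * m%:R ^+ n.-1.
    rewrite -powR_mulrn ?ler0n// -powRD; last by rewrite (gt_eqF m0) implybT.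
    by congr (_ `^ _); rewrite /gam -subn1 natrB//; ring.
  by rewrite ltr_pM2r// (lt_le_trans ltr01).
- have -> : b `^ (1 - alpha) = b / b `^ alpha.
    rewrite powRB; first by rewrite powRr1// ltW.
    by rewrite (gt_eqF b0) implybT.
  rewrite -mulrA ler_pM2l// balpha ler_pdivrMl; last by rewrite mulr_gt0// (lt_le_trans ltr01).
  have -> : m%:R ^+ n = m%:R * m%:R ^+ n.-1 :> R by rewrite -exprS prednK.
  rewrite mulrAC ler_wpM2r// ?(le_trans ler01)// natrB; last by rewrite (leq_trans _ m3).
  have m4 : 4 <= m%:R :> R by rewrite ler_nat.
  lra.
Qed.

End young_facts.

(** * Integral means over cubes as functions of the radius *)

Section cube_mean.
Context {R : realType} {n : nat}.
Implicit Types (V : set 'rV[R]_n) (x y z : 'rV[R]_n) (g f : 'rV[R]_n -> R).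
Local Notation mu := (leb R n).
Local Notation B := (ball (0 : 'rV[R]_n) 1 : set (lebT R n)).

Definition unit_vol : R := fine (mu B).

Lemma unit_volE : mu B = unit_vol%:E.
Proof. by rewrite fineK// ge0_fin_numE// leb_bounded. Qed.

Lemma unit_vol_gt0 : 0 < unit_vol.
Proof. by rewrite -lte_fin -unit_volE; exact: leb_unit_ball_gt0. Qed.

Lemma unit_ballE z : B z <-> `|z| < 1.
Proof. by rewrite ball_rowE/= sub0r normrN. Qed.

Lemma dilate_ball x (t : R) : 0 < t -> dilate x t @^-1` (ball x t) = B.
Proof.
move=> t0; apply/seteqP; split => z; rewrite !ball_rowE/= sub0r normrN.
  by rewrite /dilate opprD addNKr normrN normrZ gtr0_norm// gtr_pMr.
by rewrite /dilate opprD addNKr normrN normrZ gtr0_norm// gtr_pMr.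
Qed.

Lemma affine_continuous (W : normedModType R) (w : W) (t : R) :
  continuous (fun v => w + t *: v).
Proof.
by move=> v; apply: cvgD; [exact: cvg_cst|apply: cvgZr; exact: cvg_id].
Qed.

Lemma dilate_continuous x (t : R) : continuous (dilate x t).
Proof. exact: affine_continuous. Qed.

Lemma dilate_in x (t : R) z : 0 <= t -> `|z| < 1 -> `|dilate x t z - x| <= t.
Proof.
by move=> t0 z1; rewrite /dilate addrAC subrr add0r normrZ ger0_norm// ler_piMr// ltW.
Qed.

Lemma integrable_dilate V x (t T : R) f : open V -> 0 <= t -> t <= T ->
  [set y | `|y - x| <= T] `<=` V -> (forall y, V y -> {for y, continuous f}) ->
  mu.-integrable B (EFin \o ((fun z => f (dilate x t z)) : lebT R n -> R)).
Proof.
move=> oV t0 tT KV cf.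
have cK := @closed_cube_compact R n x T.
have [C C0 CP] : exists2 C : R, 0 < C & forall y, `|y - x| <= T -> `|f y| <= C.
  apply: (compact_fun_bounded cK); apply: continuous_in_subspaceT => y.
  by rewrite inE => Ky; exact/cf/KV.
apply: measurable_bounded_integrable.
- exact: ball_leb_measurable.
- exact: leb_bounded.
- apply: continuous_leb_measurable; first exact: ball_open.
  move=> z /unit_ballE z1.
  apply: (@continuous_comp _ _ _ (dilate x t) f); first exact: dilate_continuous.
  by apply/cf/KV; apply: le_trans (dilate_in x t0 z1) tT.
- exists C; split; first exact: num_real.
  move=> M CM z /unit_ballE z1; apply: le_trans (ltW CM); apply: CP.
  exact: le_trans (dilate_in x t0 z1) tT.
Qed.

(** Up to the factor [unit_vol] this is the mean of g over the cube of radius t about x. Transported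
    to the unit cube, it has a fixed domain of integration and can be differentiated in [t]. *)
Definition cube_mean g x (t : R) : R :=
  Rintegral mu B (fun z => g (dilate x t z)).

Lemma cube_mean_derive V g x (t T : R) : open V -> Ck_on 1 V g ->
  [set y | `|y - x| <= T] `<=` V -> 0 < t -> t < T ->
  is_derive t 1 (cube_mean g x)
    (Rintegral mu B (fun z => \sum_l partial l g (dilate x t z) * (z : 'rV[R]_n) ord0 l)).
Proof.
move=> oV Vg KV t0 tT.
have cK := @closed_cube_compact R n x T.
have inV s z : 0 < s -> s < T -> B z -> V (dilate x s z).
  move=> s0 sT /unit_ballE z1; apply: KV.
  exact: le_trans (dilate_in x (ltW s0) z1) (ltW sT).
have cdg l y : V y -> {for y, continuous (partial l g)}.
  exact: (Ck_on_continuous oV (Ck_onS l Vg)).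
have [C C0 CP] : exists2 C : R, 0 < C & forall l y, `|y - x| <= T -> `|partial l g y| <= C.
  have CPl l : exists C : R, 0 < C /\ forall y, `|y - x| <= T -> `|partial l g y| <= C.
    have [|C C0 CP] := @compact_fun_bounded R _ _ (partial l g) cK; last by exists C.
    by apply: continuous_in_subspaceT => y; rewrite inE => Ky; exact/cdg/KV.
  have [C CP] := choice CPl; exists (\sum_l C l + 1).
    by rewrite ltr_wpDl// sumr_ge0// => l _; apply: ltW; have [] := CP l.
  move=> l y yT; have [_ /(_ y yT) H] := CP l; apply: (le_trans H).
  rewrite (bigD1 l)//= -addrA lerDl addr_ge0// sumr_ge0// => i _.
  by apply: ltW; have [] := CP i.
have der (s : R) z : 0 < s -> s < T -> B z -> is_derive s 1 (fun s => g (dilate x s z))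
    (\sum_l partial l g (dilate x s z) * z ord0 l).
  move=> s0 sT Bz.
  have dl : is_derive s 1 (fun s : R => dilate x s z) z.
    have : is_derive (x + s *: z) z (id : 'rV[R]_n -> 'rV[R]_n) z by exact: is_derive_id.
    exact: line_is_derive.
  have := @is_derive_C1_comp R n _ g (fun s => dilate x s z) s 1 V oV (inV s z s0 sT Bz) Vg.
  case: dl => dd de /(_ dd).
  have -> : \sum_l partial l g (dilate x s z) * 'D_1 (fun x0 : R => dilate x x0 z ord0 l) s =
    \sum_l partial l g (dilate x s z) * z ord0 l; last by [].
  apply: eq_bigr => l _; congr (_ * _).
  by move: de; rewrite derive_mx// => /matrixP/(_ ord0 l); rewrite mxE.
have I0 : (`]0, T[%classic : set R) t by rewrite /= in_itv/= t0.
have mB : measurable B by exact: ball_leb_measurable.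
have := @cvg_differentiation_under_integral R _ _ mu
  (fun s (z : lebT R n) => g (dilate x s z)) B mB t 0 T I0.
move=> H; apply: cvg_is_derive.
rewrite (_ : (fun h => _) = (fun h : R => h^-1 *:
  (Rintegral mu B (fun z => g (dilate x (h + t) z)) -
   Rintegral mu B (fun z => g (dilate x t z))))); last first.
  by apply/funext => h; rewrite /cube_mean [_%:A]mulr1.
have -> : Rintegral mu B (fun z => \sum_l partial l g (dilate x t z) * (z : 'rV[R]_n) ord0 l)
  = Rintegral mu B (partial1of2 (fun s (z : lebT R n) => g (dilate x s z)) t).
  apply: eq_Rintegral => z /set_mem Bz.
  by have [_ <-] := der t z t0 tT Bz; rewrite -derive1E.
apply: (H _ _ (cst (n%:R * C))).
- move=> s; rewrite /= in_itv/= => /andP[s0 sT].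
  apply: (integrable_dilate oV (ltW s0) (ltW sT) KV) => y Vy.
  exact: (Ck_on_continuous oV Vg Vy).
- by move=> s z; rewrite /= in_itv/= => /andP[s0 sT] Bz; case: (der s z s0 sT Bz).
- by move=> z; rewrite mulr_ge0// ltW.
- apply: measurable_bounded_integrable => //; first exact: leb_bounded.
  exists (n%:R * C); split; first exact: num_real.
  by move=> M CM z _; rewrite /= ger0_norm ?mulr_ge0// ltW.
- move=> s z; rewrite /= in_itv/= => /andP[s0 sT] Bz; rewrite partial1of2E.
  have [_ ->] := der s z s0 sT Bz; apply: (le_trans (ler_norm_sum _ _ _)).
  rewrite mulr_natl -[X in C *+ X](card_ord n) -sumr_const; apply: ler_sum => l _.
  have /unit_ballE z1 := Bz.
  rewrite normrM -[leRHS]mulr1; apply: ler_pM => //.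
    by apply: CP; exact: le_trans (dilate_in x (ltW s0) z1) (ltW sT).
  exact: le_trans (row_coord_le z l) (ltW z1).
Qed.

End cube_mean.

(** * From the energy on shrinking cubes to the value at their centre *)

Section morrey.
Context {R : realType} {n : nat}.
Variables (P : R -> R) (alpha : R).
Hypotheses (P_young : young_function P) (alpha_ge1 : 1 <= alpha).
Hypothesis P_iv : forall s t, 0 < s -> s <= t ->
  s `^ (- alpha) * P s <= t `^ (- alpha) * P t.
Implicit Types (V : set 'rV[R]_n) (x y z : 'rV[R]_n) (g f : 'rV[R]_n -> R).
Local Notation mu := (leb R n).
Local Notation B := (ball (0 : 'rV[R]_n) 1 : set (lebT R n)).
Local Notation V0 := (@unit_vol R n).

(** [young_growth] with threshold [s] is applied to |f| / kappa and integrated; the factor (t^n)^-1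
    arises when the energy on the cube of radius t is transported to the unit cube. *)
Lemma mean_young f x (t kappa s Q : R) : 0 < t -> 0 < kappa -> 1 <= s ->
  (forall y, ball x t y -> {for y, continuous f}) ->
  (\int[mu]_(y in ball x t) (P (`|f y| / kappa))%:E <= Q%:E)%E ->
  (\int[mu]_(z in B) `|f (dilate x t z)|%:E <=
   (kappa * (s * V0 + s `^ (1 - alpha) / P 1 * ((t ^+ n)^-1 * Q)))%:E)%E.
Proof.
move=> t0 k0 s1 cf intQ.
have mB : measurable B by exact: ball_leb_measurable.
have mBx : measurable (ball x t : set (lebT R n)) by exact: ball_leb_measurable.
have oBx : open (ball x t) by exact: ball_open.
have P1 := young_gt0 P_young (@ltr01 R).
set c := s `^ (1 - alpha) / P 1.
have c0 : 0 <= c by rewrite divr_ge0 ?powR_ge0// ltW.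
have mf : measurable_fun (ball x t : set (lebT R n)) (f : lebT R n -> R).
  exact: continuous_leb_measurable.
have fd z : B z -> {for z, continuous (fun z => f (dilate x t z))}.
  move=> Bz; apply: (@continuous_comp _ _ _ (dilate x t) f).
    exact: dilate_continuous.
  by apply: cf; move: Bz; rewrite -(dilate_ball x t0).
have mfd : measurable_fun B ((fun z => f (dilate x t z)) : lebT R n -> R).
  by apply: continuous_leb_measurable; [exact: ball_open|exact: fd].
have mPd := young_measurable P_young k0 mfd.
have Pd0 (r : R) : 0 <= P (`|r| / kappa).
  by apply: (young_ge0 P_young); rewrite divr_ge0// ltW.
have E1 : (\int[mu]_(z in B) (P (`|f (dilate x t z)| / kappa))%:E <=
    ((t ^+ n)^-1 * Q)%:E)%E.
  move: intQ; rewrite (@integral_dilate _ _ x t (ball x t)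
     (fun y => P (`|f y| / kappa)) t0 mBx)//; last first.
    exact: (young_measurable P_young k0 mf).
  by rewrite dilate_ball// EFinM -lee_pdivlMl ?exprn_gt0.
have ks0 : 0 <= kappa * s by rewrite mulr_ge0 ?(ltW k0)// (le_trans ler01).
have kc0 : 0 <= kappa * c by rewrite mulr_ge0// ltW.
have mPE : measurable_fun B
    (fun z : lebT R n => (P (`|f (dilate x t z)| / kappa))%:E) by exact/measurable_EFinP.
have mkPE : measurable_fun B (fun z : lebT R n =>
    (kappa * c)%:E * (P (`|f (dilate x t z)| / kappa))%:E)%E.
  by apply: emeasurable_funM; [exact: measurable_cst|exact: mPE].
have PE0 z : B z -> (0 <= (P (`|f (dilate x t z)| / kappa))%:E)%E.
  by move=> _; rewrite lee_fin.
have kPE0 z : B z -> (0 <= (kappa * c)%:E * (P (`|f (dilate x t z)| / kappa))%:E)%E.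
  by move=> Bz; rewrite mule_ge0 ?PE0// lee_fin.
apply: (@le_trans _ _ (\int[mu]_(z in B) ((kappa * s)%:E +
    (kappa * c)%:E * (P (`|f (dilate x t z)| / kappa))%:E))%E).
  apply: (ge0_le_integral mu mB).
  - by move=> z _; rewrite lee_fin.
  - by apply/measurable_EFinP; apply: measurableT_comp.
  - by apply: emeasurable_funD; [exact: measurable_cst|exact: mkPE].
  - move=> z _; rewrite -EFinM -EFinD lee_fin -mulrA -mulrDr.
    rewrite mulrC -ler_pdivrMr//.
    by apply: (young_growth P_young alpha_ge1 P_iv) => //; rewrite divr_ge0// ltW.
rewrite (ge0_integralD mu mB (f1 := cst (kappa * s)%:E) _ _ kPE0 mkPE); last 2 first.
- by move=> z _; rewrite lee_fin.
- exact: measurable_cst.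
rewrite integral_cst// (ge0_integralZl mu mB mPE PE0)//.
rewrite unit_volE -EFinM mulrDr EFinD mulrA; apply: leeD => //.
have -> : kappa * (c * ((t ^+ n)^-1 * Q)) = (kappa * c) * ((t ^+ n)^-1 * Q) by rewrite mulrA.
by rewrite [leRHS]EFinM; apply: lee_wpmul2l; [rewrite lee_fin|exact: E1].
Qed.

(** Mean value theorem in the radius. For all t between d' and d the energy is bounded by that of
    the largest cube and rescaled by the smallest radius, so one bound for the derivative serves the
    whole interval; [n] counts the partial derivatives. *)
Lemma morrey_step V g x (d d' T kappa s Q : R) : open V -> Ck_on 1 V g ->
  [set y | `|y - x| <= T] `<=` V -> 0 < d' -> d' <= d -> d < T ->
  0 < kappa -> 1 <= s -> 0 <= Q ->
  (forall l, \int[mu]_(y in ball x d) (P (`|partial l g y| / kappa))%:E <= Q%:E)%E ->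
  `|cube_mean g x d - cube_mean g x d'| <=
    d * (n%:R * (kappa * (s * V0 + s `^ (1 - alpha) / P 1 * ((d' ^+ n)^-1 * Q)))).
Proof.
move=> oV Vg KV d'0 d'd dT k0 s1 Q0 intQ.
have mB : measurable B by exact: ball_leb_measurable.
have P1 := young_gt0 P_young (@ltr01 R).
set M := kappa * _.
have V00 := @unit_vol_gt0 R n.
have M0 : 0 <= M.
  apply: mulr_ge0; first exact: ltW.
  apply: addr_ge0; first by rewrite mulr_ge0 ?(ltW V00)// (le_trans ler01).
  apply: mulr_ge0; first by rewrite divr_ge0 ?powR_ge0// ltW.
  by rewrite mulr_ge0// invr_ge0 exprn_ge0// ltW.
have der t : d' <= t <= d -> is_derive t 1 (cube_mean g x)
    (Rintegral mu B (fun z => \sum_l partial l g (dilate x t z) * (z : 'rV[R]_n) ord0 l)).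
  move=> /andP[d't td].
  apply: (cube_mean_derive oV Vg KV); first exact: lt_le_trans d't.
  exact: le_lt_trans dT.
have bound t : d' <= t <= d ->
    `|Rintegral mu B (fun z => \sum_l partial l g (dilate x t z) * (z : 'rV[R]_n) ord0 l)|
      <= n%:R * M.
  move=> /andP[d't td].
  have t0 : 0 < t by exact: lt_le_trans d't.
  have tT : t < T by exact: le_lt_trans dT.
  have sub : ball x t `<=` V.
    move=> y; rewrite ball_rowE/= distrC => yt; apply: KV => /=.
    exact: le_trans (ltW yt) (ltW tT).
  have cdg l y : V y -> {for y, continuous (partial l g)}.
    exact: (Ck_on_continuous oV (Ck_onS l Vg)).
  have intd l : mu.-integrable B (EFin \o ((fun z => partial l g (dilate x t z)) : lebT R n -> R)).
    by apply: (integrable_dilate oV (ltW t0) (ltW tT) KV); exact: cdg.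
  have bl l : (\int[mu]_(z in B) `|partial l g (dilate x t z)|%:E <= M%:E)%E.
    apply: (le_trans (@mean_young (partial l g) x t kappa s Q t0 k0 s1 _ _)).
    - by move=> y /sub; exact: cdg.
    - apply: le_trans (intQ l); apply: ge0_subset_integral.
      + exact: ball_leb_measurable.
      + exact: ball_leb_measurable.
      + apply/measurable_EFinP; apply: (young_measurable P_young k0).
        apply: continuous_leb_measurable; first exact: ball_open.
        move=> y; rewrite ball_rowE/= distrC => yd; apply/cdg/KV => /=.
        exact: le_trans (ltW yd) (ltW dT).
      + move=> y _; rewrite lee_fin; apply: (young_ge0 P_young).
        by rewrite divr_ge0// ltW.
      + by move=> y; rewrite !ball_rowE/= => /lt_le_trans; apply.
    - rewrite lee_fin ler_pM2l// lerD2l ler_wpM2l//.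
        by rewrite divr_ge0 ?powR_ge0// ltW.
      by rewrite ler_wpM2r// lef_pV2 ?posrE ?exprn_gt0// lerXn2r// nnegrE ltW.
  have inteq l : mu.-integrable B
     (EFin \o ((fun z => partial l g (dilate x t z) * (z : 'rV[R]_n) ord0 l) : lebT R n -> R)).
    apply: (le_integrable mB _ _ (intd l)).
    - apply/measurable_EFinP; apply: measurable_funM.
        by apply/measurable_EFinP; have /integrableP[] := intd l.
      exact: measurable_funS (measurable_row_coord l).
    - move=> z /unit_ballE z1; rewrite /= lee_fin normrM ler_piMr//.
      exact: le_trans (row_coord_le z l) (ltW z1).
  have -> : Rintegral mu B (fun z => \sum_l partial l g (dilate x t z) * (z : 'rV[R]_n) ord0 l)
     = \sum_l Rintegral mu B (fun z => partial l g (dilate x t z) * (z : 'rV[R]_n) ord0 l).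
    (* Linearity for the finite sum, by induction on the list of indices with integrability carried
       along. *)
    suff H (r : seq 'I_n) : mu.-integrable B (EFin \o ((fun z => \sum_(l <- r)
       partial l g (dilate x t z) * (z : 'rV[R]_n) ord0 l) : lebT R n -> R)) /\
       Rintegral mu B (fun z => \sum_(l <- r) partial l g (dilate x t z) * (z : 'rV[R]_n) ord0 l) =
       \sum_(l <- r) Rintegral mu B (fun z => partial l g (dilate x t z) * (z : 'rV[R]_n) ord0 l).
      exact: (H _).2.
    elim: r => [|l r [IH1 IH2]].
      split.
        apply: eq_integrable (@integrable0 _ _ _ mu B) => // z _.
        by rewrite /= big_nil.
      rewrite big_nil -[RHS](mul0r (fine (mu B))) -(Rintegral_cst mu mB).
      by apply: eq_Rintegral => z _; rewrite big_nil.
    split.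
      apply: eq_integrable (integrableD mB (inteq l) IH1) => // z _.
      by rewrite /= big_cons.
    rewrite big_cons -IH2 -RintegralD//.
    by apply: eq_Rintegral => z _; rewrite big_cons.
  apply: (le_trans (ler_norm_sum _ _ _)).
  rewrite mulr_natl -[X in M *+ X](card_ord n) -sumr_const; apply: ler_sum => l _.
  apply: (le_trans (le_normr_Rintegral mB (inteq l))).
  rewrite -lee_fin; apply: le_trans (bl l); rewrite /Rintegral fineK; last first.
    by apply: integrable_fin_num => //; exact: integrable_norm.
  apply: (ge0_le_integral mu mB).
  - by move=> z _; rewrite lee_fin.
  - by have /integrableP[] := integrable_norm (inteq l).
  - by have /integrableP[] := integrable_norm (intd l).
  - move=> z /unit_ballE z1; rewrite lee_fin /= normrM ler_piMr//.
    exact: le_trans (row_coord_le z l) (ltW z1).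
have [| |c cI ->] := @MVT_segment R (cube_mean g x) (fun t => Rintegral mu B (fun z =>
    \sum_l partial l g (dilate x t z) * (z : 'rV[R]_n) ord0 l)) d' d d'd.
- by move=> t; rewrite in_itv/= => /andP[? ?]; apply: der; rewrite !ltW.
- apply: derivable_within_continuous => t; rewrite in_itv/= => tI.
  by have [] := der t tI.
rewrite normrM mulrC.
have {cI}cI : d' <= c <= d by move: cI; rewrite in_itv.
apply: ler_pM => //; last exact: bound.
by rewrite ger0_norm ?subr_ge0// gerBl ltW.
Qed.


Lemma cube_mean_near V g x (T e : R) : open V -> (forall y, V y -> {for y, continuous g}) ->
  [set y | `|y - x| <= T] `<=` V -> 0 < T -> 0 < e ->
  exists2 d0 : R, 0 < d0 & forall d, 0 < d -> d <= d0 -> `|cube_mean g x d - V0 * g x| <= V0 * e.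
Proof.
move=> oV cg KV T0 e0.
have mB : measurable B by exact: ball_leb_measurable.
have Vx : V x by apply: KV; rewrite /= subrr normr0 ltW.
have /cvgrPdist_lt/(_ _ e0)/nbhs_ballP[d1 /= d10 d1P] := cg x Vx.
exists (Num.min (d1 / 2) T).
  by rewrite lt_min divr_gt0.
move=> d d0; rewrite le_min => /andP[dd1 dT].
have intg := integrable_dilate oV (ltW d0) dT KV cg.
have intc : mu.-integrable B (EFin \o (cst (g x) : lebT R n -> R)).
  apply: measurable_bounded_integrable => //; first exact: leb_bounded.
  exists `|g x|; split; first exact: num_real.
  by move=> M CM z _; exact: ltW.
have -> : V0 * g x = Rintegral mu B (cst (g x)) by rewrite Rintegral_cst// mulrC.
rewrite /cube_mean -RintegralB//.
have intB := integrableB mB intg intc.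
apply: (le_trans (le_normr_Rintegral mB intB)).
have -> : V0 * e = Rintegral mu B (cst e) by rewrite Rintegral_cst// mulrC.
apply: le_Rintegral => //.
- exact: (integrable_norm intB).
- apply: measurable_bounded_integrable => //; first exact: leb_bounded.
  exists e; split; first exact: num_real.
  by move=> M CM z _; rewrite /= gtr0_norm// ltW.
- move=> z /unit_ballE z1; rewrite /= distrC; apply/ltW/d1P.
  rewrite ball_rowE /= distrC; apply: le_lt_trans (dilate_in x (ltW d0) z1) _.
  by apply: (le_lt_trans dd1); rewrite ltr_pdivrMr// ltr_pMr// ltr1n.
Qed.

(** With thresholds b^j at the radii T / m^(j+1) the increments given by [morrey_step] are geometric
    with ratio b / m. The first summand of the bound is the mean over the largest of these cubes,
    controlled by the L^1 norm; the second is the sum of the series. *)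
Lemma morrey_point (m : nat) (b : R) V g x (T kappa E : R) :
  (3 < m)%N -> 1 <= b -> b < m%:R -> b `^ (1 - alpha) * m%:R ^+ n <= b * (m - 2)%:R ->
  open V -> Ck_on 1 V g -> [set y | `|y - x| <= T] `<=` V -> 0 < T ->
  0 < kappa -> 0 <= E ->
  (forall j l, \int[mu]_(y in ball x (T / m%:R ^+ j.+1)) (P (`|partial l g y| / kappa))%:E
     <= (E / (m - 2)%:R ^+ j)%:E)%E ->
  (\int[mu]_(y in V) `|g y|%:E <= kappa%:E)%E ->
  V0 * `|g x| <= kappa * (((T / m%:R) ^+ n)^-1 +
    (T / m%:R) * (n%:R * (V0 + ((T / m%:R ^+ 2) ^+ n)^-1 * E / P 1)) / (1 - b / m%:R)).
Proof.
move=> m3 b1 bm bP oV Vg KV T0 k0 E0 intE intg.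
have m0 : 0 < m%:R :> R by rewrite ltr0n (leq_trans _ m3).
have m1 : 1 < m%:R :> R by rewrite ltr1n (leq_trans _ m3).
have m20 : 0 < (m - 2)%:R :> R by rewrite ltr0n subn_gt0 (leq_trans _ m3).
have P1 := young_gt0 P_young (@ltr01 R).
have V00 := @unit_vol_gt0 R n.
have b0 : 0 < b by exact: lt_le_trans b1.
have mB : measurable B by exact: ball_leb_measurable.
pose d j : R := T / m%:R ^+ j.+1.
have d0 j : 0 < d j by rewrite divr_gt0// exprn_gt0.
have dS j : d j.+1 <= d j.
  by rewrite /d ler_pM2l// lef_pV2 ?posrE ?exprn_gt0// ler_eXn2l.
have dT j : d j < T.
  by rewrite /d ltr_pdivrMr ?exprn_gt0// ltr_pMr// exprn_egt1.
set C0 := T / m%:R * _.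
have C00 : 0 <= C0.
  rewrite /C0 !mulr_ge0 ?ler0n ?invr_ge0 ?(ltW T0) ?(ltW m0)// addr_ge0 ?(ltW V00)//.
  by rewrite !mulr_ge0 ?invr_ge0 ?exprn_ge0 ?mulr_ge0 ?invr_ge0 ?exprn_ge0 ?(ltW T0) ?(ltW P1)// ltW.
pose rho := b / m%:R.
have rho1 : 0 < 1 - rho by rewrite subr_gt0 ltr_pdivrMr// mul1r.
have rho0 : 0 <= rho by rewrite divr_ge0// ltW.
have cg z : V z -> {for z, continuous g} by exact: (Ck_on_continuous oV Vg).
have step j : `|cube_mean g x (d j) - cube_mean g x (d j.+1)| <= kappa * (C0 * rho ^+ j).
  apply: (le_trans (@morrey_step V g x (d j) (d j.+1) T kappa (b ^+ j) (E / (m - 2)%:R ^+ j)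
    oV Vg KV (d0 _) (dS _) (dT _) k0 _ _ _)).
  - by rewrite exprn_ege1.
  - by rewrite divr_ge0// exprn_ge0// ltW.
  - exact: intE.
  have -> : (d j.+1 ^+ n)^-1 = ((T / m%:R ^+ 2) ^+ n)^-1 * (m%:R ^+ n) ^+ j.
    have -> : d j.+1 = T / m%:R ^+ 2 / m%:R ^+ j.
      by rewrite /d -mulrA -invfM -exprD addnC addn2.
    by rewrite expr_div_n invf_div mulrC -!exprM mulnC.
  have -> : (b ^+ j) `^ (1 - alpha) = (b `^ (1 - alpha)) ^+ j.
    by rewrite -(powR_mulrn _ (ltW b0)) -powRrM mulrC powRrM powR_mulrn ?powR_ge0.
  have h : (b `^ (1 - alpha)) ^+ j * (m%:R ^+ n) ^+ j / (m - 2)%:R ^+ j <= b ^+ j.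
    rewrite ler_pdivrMr ?exprn_gt0// -!exprMn.
    by apply: lerXn2r; rewrite ?nnegrE// !mulr_ge0 ?powR_ge0 ?exprn_ge0// ltW.
  set D := ((T / m%:R ^+ 2) ^+ n)^-1.
  have D0 : 0 <= D by rewrite invr_ge0 exprn_ge0// divr_ge0 ?exprn_ge0 ?(ltW T0)// ltW.
  have -> : d j = T / m%:R * (m%:R ^+ j)^-1 by rewrite /d exprS invfM mulrA.
  rewrite /C0 -/D /rho expr_div_n.
  have -> : kappa * (T / m%:R * (n%:R * (V0 + D * E / P 1)) * (b ^+ j / m%:R ^+ j)) =
    T / m%:R / m%:R ^+ j * (n%:R * (kappa * (b ^+ j * V0 + (D * E / P 1) * b ^+ j))) by ring.
  rewrite ler_pM2l; last by rewrite !divr_gt0// exprn_gt0.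
  apply: ler_wpM2l => //; rewrite ler_pM2l// lerD2l.
  have -> : b `^ (1 - alpha) ^+ j / P 1 * (D * (m%:R ^+ n) ^+ j * (E / (m - 2)%:R ^+ j)) =
    (D * E / P 1) * ((b `^ (1 - alpha)) ^+ j * (m%:R ^+ n) ^+ j / (m - 2)%:R ^+ j) by ring.
  by apply: ler_wpM2l => //; rewrite divr_ge0 ?(ltW P1)// mulr_ge0.
have sum J : `|cube_mean g x (d 0%N) - cube_mean g x (d J)| <=
    kappa * (C0 * ((1 - rho ^+ J) / (1 - rho))).
  elim: J => [|J IH]; first by rewrite !subrr normr0 mul0r !mulr0.
  rewrite -(subrKA (cube_mean g x (d J))); apply: (le_trans (ler_normD _ _)).
  apply: (le_trans (lerD IH (step J))).
  rewrite -!mulrDr le_eqVlt; apply/orP; left; apply/eqP; congr (_ * (_ * _)).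
  by rewrite exprSr; field; rewrite gt_eqF.
have mean0 : `|cube_mean g x (d 0%N)| <= kappa * ((T / m%:R) ^+ n)^-1.
  have intd := integrable_dilate oV (ltW (d0 0%N)) (ltW (dT 0%N)) KV cg.
  have subV : ball x (d 0%N) `<=` V.
    move=> y; rewrite ball_rowE/= distrC => yt; apply: KV => /=.
    exact: le_trans (ltW yt) (ltW (dT 0%N)).
  apply: (le_trans (le_normr_Rintegral mB intd)).
  rewrite -lee_fin /Rintegral fineK; last first.
    by apply: integrable_fin_num => //; exact: (integrable_norm intd).
  have mbx : measurable (ball x (d 0%N) : set (lebT R n)) by exact: ball_leb_measurable.
  have mgV : measurable_fun (V : set (lebT R n)) ((fun y => `|g y|) : lebT R n -> R).
    by apply: measurableT_comp => //; exact: continuous_leb_measurable.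
  have : (\int[mu]_(y in ball x (d 0%N)) `|g y|%:E <= kappa%:E)%E.
    apply: le_trans intg; apply: ge0_subset_integral.
    - exact: mbx.
    - exact: open_leb_measurable.
    - by apply/measurable_EFinP.
    - by move=> y _; rewrite lee_fin.
    - exact: subV.
  have mgb : measurable_fun (ball x (d 0%N) : set (lebT R n)) ((fun y => `|g y|) : lebT R n -> R).
    apply: measurable_funS mgV => //; exact: open_leb_measurable.
  rewrite (@integral_dilate _ _ x (d 0%N) (ball x (d 0%N))
     (fun y => `|g y|) (d0 _) mbx mgb (fun _ _ => normr_ge0 _)).
  by rewrite dilate_ball// -lee_pdivlMl ?exprn_gt0// -EFinM mulrC /d expr1.
have -> : V0 * `|g x| = `|V0 * g x| by rewrite normrM gtr0_norm.
apply/ler_addgt0Pr => e e0.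
have [h0 h00 hP] := cube_mean_near oV cg KV T0 (divr_gt0 e0 V00).
have [J dJ] : exists J, d J <= h0.
  exists (Num.truncn (T / h0)); rewrite /d ler_pdivrMr ?exprn_gt0//.
  rewrite mulrC -ler_pdivrMr//; apply: (le_trans (ltW (truncnS_gt _))).
  by rewrite -natrX ler_nat; apply: ltnW; rewrite ltn_expl// (leq_trans _ m3).
have h1 := hP _ (d0 J) dJ; rewrite mulrCA mulfV ?gt_eqF// mulr1 in h1.
have h2 := sum J.
have h3 : kappa * (C0 * ((1 - rho ^+ J) / (1 - rho))) <= kappa * (C0 / (1 - rho)).
  rewrite ler_pM2l// ler_wpM2l// -[leRHS]mul1r.
  by rewrite ler_pM2r ?invr_gt0// gerBl exprn_ge0.
rewrite mulrDr -/rho; move: h1 h2 h3 mean0.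
move: (kappa * _) (kappa * _) (kappa * _) => u v w.
move: (cube_mean _ _ _) (cube_mean _ _ _) => p q.
rewrite !ler_norml => /andP[? ?] /andP[? ?] ? /andP[? ?]; apply/andP; split; lra.
Qed.

End morrey.

(** * Cubes with little energy near their boundary *)

Section good_cube.
Context {R : realType} {n : nat}.
Implicit Types (V : set 'rV[R]_n) (x y z : 'rV[R]_n) (g f : 'rV[R]_n -> R).
Local Notation mu := (leb R n).

(** [good_radius] is applied to the energy of the cube about y as a function of its radius. As r
    keeps the distance r0 / m^(j+1) from both ends of the j-th interval, a cube of that radius about
    a point with |x - y| = r lies in the layer between the cubes whose radii are these ends, so its
    energy is at most the increment. *)
Lemma good_cube_radius V y (r0 E : R) (m : nat) (psi : lebT R n -> \bar R) :
  (3 < m)%N -> 0 < r0 -> open V -> [set z | `|z - y| <= 3 * r0] `<=` V ->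
  measurable_fun (V : set (lebT R n)) psi -> (forall z, V z -> 0 <= psi z)%E ->
  (\int[mu]_(z in V) psi z <= E%:E)%E ->
  exists2 r, r0 <= r <= 2 * r0 & forall x, `|x - y| = r -> forall j,
    (\int[mu]_(z in ball x (r0 / m%:R ^+ j.+1)) psi z <= (E / (m - 2)%:R ^+ j)%:E)%E.
Proof.
move=> m3 r00 oV KV mpsi psi0 intE.
have mV : measurable (V : set (lebT R n)) by exact: open_leb_measurable.
pose A r : set (lebT R n) := (V : set (lebT R n)) `&` (ball y r : set (lebT R n)).
have mA r : measurable (A r) by apply: measurableI => //; exact: ball_leb_measurable.
have mS (D : set (lebT R n)) : D `<=` V -> measurable_fun D psi.
  by move=> DV; exact: measurable_funS mV DV mpsi.
have le_int (D D' : set (lebT R n)) : measurable D -> measurable D' -> D `<=` D' -> D' `<=` V ->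
    (\int[mu]_(z in D) psi z <= \int[mu]_(z in D') psi z)%E.
  move=> mD mD' DD' D'V; apply: (ge0_subset_integral mu mD mD' (mS _ D'V) _ DD').
  by move=> z /D'V; exact: psi0.
have AV r : A r `<=` V by move=> z [].
have I0 r : (0 <= \int[mu]_(z in A r) psi z)%E.
  by apply: integral_ge0 => z /AV; exact: psi0.
have fin r : (\int[mu]_(z in A r) psi z)%E \is a fin_num.
  rewrite ge0_fin_numE//; apply: le_lt_trans (ltry E); apply: le_trans intE.
  exact: le_int.
pose Phi r := fine (\int[mu]_(z in A r) psi z)%E.
have PhiE r : (\int[mu]_(z in A r) psi z)%E = (Phi r)%:E by rewrite fineK.
have Phi_homo : {homo Phi : r s / r <= s}.
  move=> r s rs; apply: fine_le => //; apply: le_int => // z [Vz].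
  by rewrite ball_rowE/= => h; split => //; rewrite ball_rowE/=; exact: lt_le_trans rs.
have Phi_inc : Phi (r0 + r0) - Phi r0 <= E.
  rewrite lerBlDr ler_wpDr//; first by rewrite -lee_fin -PhiE.
  by rewrite -lee_fin -PhiE; apply: le_trans intE; exact: le_int.
have [r /andP[r0r rr0] rP] := good_radius m3 r00 Phi_homo Phi_inc.
exists r; first by rewrite r0r/=; lra.
move=> x xr j; have [a [ar rb PhiQ]] := rP j.
set d := r0 / m%:R ^+ j.+1; set b := a + r0 / m%:R ^+ j in PhiQ rb *.
have dr0 : d <= r0.
  rewrite /d ler_pdivrMr ?exprn_gt0 ?ltr0n ?(leq_trans _ m3)// ler_peMr ?(ltW r00)//.
  by rewrite exprn_ege1// ler1n (leq_trans _ m3).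
have mb : measurable (ball x d : set (lebT R n)) by exact: ball_leb_measurable.
have bA : (ball x d : set (lebT R n)) `<=` A b.
  move=> z; rewrite ball_rowE/= distrC => zd.
  have zy : `|z - y| < r + d.
    by rewrite -(subrKA x) (le_lt_trans (ler_normD _ _))// xr addrC ltrD2l.
  split; first by apply: KV => /=; lra.
  by rewrite ball_rowE/= distrC; exact: lt_le_trans rb.
have ab : A a `<=` A b.
  move=> z [Vz]; rewrite ball_rowE/= => za; split => //; rewrite ball_rowE/=.
  by apply: (lt_le_trans za); rewrite /b lerDl divr_ge0 ?(ltW r00)// exprn_ge0.
have AbV := AV b.
have dis : [disjoint A a & (ball x d : set (lebT R n))]%classic.
  apply/eqP; rewrite -subset0 => z [[_]]; rewrite !ball_rowE/= => zy zx.
  have : r < d + a.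
    rewrite -xr -(subrKA z) (le_lt_trans (ler_normD _ _))// ltrD//.
    by rewrite distrC.
  by rewrite ltNge => /negP; apply; rewrite -lerBrDl.
have h : (\int[mu]_(z in A a) psi z + \int[mu]_(z in ball x d) psi z <=
    \int[mu]_(z in A b) psi z)%E.
  have sub : A a `|` (ball x d : set (lebT R n)) `<=` A b by move=> z [/ab|/bA].
  rewrite -(ge0_integral_setU mu (mA a) mb _ _ dis).
  - by apply: le_int => //; exact: measurableU.
  - by apply: mS; exact: subset_trans sub AbV.
  - by move=> z /sub/AbV; exact: psi0.
move: h; rewrite !PhiE => h.
apply: le_trans (_ : (Phi b - Phi a)%:E <= _)%E; last by rewrite lee_fin.
by rewrite EFinB leeBrDl.
Qed.

End good_cube.

Section small_sphere.
Context {R : realType} {n : nat}.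
Variables (P : R -> R) (alpha : R).
Hypotheses (P_young : young_function P) (alpha_ge1 : 1 <= alpha).
Hypothesis P_iv : forall s t, 0 < s -> s <= t ->
  s `^ (- alpha) * P s <= t `^ (- alpha) * P t.
Hypotheses (n_gt0 : (0 < n)%N) (n_alpha : n%:R - 1 < alpha).
Implicit Types (V : set 'rV[R]_n) (x y z : 'rV[R]_n).
Local Notation mu := (leb R n).

(** One radius must serve all k components and their n partial derivatives, so the sum of their
    energies is used, whence E = k n. The constant is fixed before [kappa] and [g], and only the
    radius depends on them; this order of quantifiers lets epsilon in (a) be chosen before u1 and
    u2. *)
Lemma small_on_cube_boundary k V y (r0 : R) : 0 < r0 -> open V ->
  [set z | `|z - y| <= 3 * r0] `<=` V ->
  exists2 C : R, 0 < C & forall (kappa : R) (g : 'I_k -> 'rV[R]_n -> R), 0 < kappa ->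
    (forall a, Ck_on 1 V (g a)) ->
    (forall a i, \int[mu]_(z in V) (P (`|partial i (g a) z| / kappa))%:E <= 1)%E ->
    (forall a, \int[mu]_(z in V) `|g a z|%:E <= kappa%:E)%E ->
    exists2 r, r0 <= r <= 2 * r0 & forall x, `|x - y| = r -> forall a, `|g a x| <= C * kappa.
Proof.
move=> r00 oV KV.
have [m [b [m3 b1 bm bP]]] := geometric_choice alpha_ge1 n_gt0 n_alpha.
have m0 : 0 < m%:R :> R by rewrite ltr0n (leq_trans _ m3).
have V00 := @unit_vol_gt0 R n.
have P1 := young_gt0 P_young (@ltr01 R).
pose E : R := (k * n)%:R.
pose D : R := ((r0 / m%:R) ^+ n)^-1 +
    (r0 / m%:R) * (n%:R * (@unit_vol R n + ((r0 / m%:R ^+ 2) ^+ n)^-1 * E / P 1)) / (1 - b / m%:R).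
have D0 : 0 < D.
  rewrite ltr_wpDr// ?invr_gt0 ?exprn_gt0 ?divr_gt0//.
  rewrite divr_ge0//; last by rewrite subr_ge0 ler_pdivrMr// mul1r ltW.
  rewrite mulr_ge0 ?divr_ge0 ?(ltW r00) ?(ltW m0)// mulr_ge0// addr_ge0 ?(ltW V00)//.
  by rewrite divr_ge0 ?(ltW P1)// mulr_ge0// invr_ge0 exprn_ge0// divr_ge0 ?(ltW r00)// exprn_ge0.
exists (D / @unit_vol R n); first by rewrite divr_gt0.
move=> kappa g k0 Vg intP intg.
have mV : measurable (V : set (lebT R n)) by exact: open_leb_measurable.
pose psi0 (ai : 'I_k * 'I_n) (z : lebT R n) := (P (`|partial ai.2 (g ai.1) z| / kappa))%:E.
pose psi (z : lebT R n) := (\sum_(ai : 'I_k * 'I_n) psi0 ai z)%E.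
have mpsi0 ai : measurable_fun (V : set (lebT R n)) (psi0 ai).
  apply/measurable_EFinP; apply: (young_measurable P_young k0).
  apply: continuous_leb_measurable => // z.
  exact: (Ck_on_continuous oV (Ck_onS ai.2 (Vg ai.1))).
have psi0_ge0 ai z : (0 <= psi0 ai z)%E.
  by rewrite lee_fin; apply: (young_ge0 P_young); rewrite divr_ge0// ltW.
have mpsi : measurable_fun (V : set (lebT R n)) psi by exact: emeasurable_sum.
have psi_ge0 z : (0 <= psi z)%E by apply: sume_ge0 => ai _.
have psiE : (\int[mu]_(z in V) psi z <= E%:E)%E.
  rewrite /psi (ge0_integral_sum mu mV mpsi0 (fun ai z _ => psi0_ge0 ai z)).
  apply: (@le_trans _ _ (\sum_(ai : 'I_k * 'I_n) 1%:E)%E).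
    by apply: lee_sum => ai _; exact: intP.
  by rewrite sumEFin sumr_const card_prod !card_ord.
have [r rr rP] := good_cube_radius m3 r00 oV KV mpsi (fun z _ => psi_ge0 z) psiE.
exists r => // x xr a.
have KxV : [set z | `|z - x| <= r0] `<=` V.
  move=> z /= zx; apply: KV => /=; rewrite -(subrKA x) (le_trans (ler_normD _ _))// xr.
  by case/andP: rr => _ ?; lra.
have intx j l : (\int[mu]_(z in ball x (r0 / m%:R ^+ j.+1)) (P (`|partial l (g a) z| / kappa))%:E
     <= (E / (m - 2)%:R ^+ j)%:E)%E.
  apply: le_trans (rP x xr j).
  have mb : measurable (ball x (r0 / m%:R ^+ j.+1) : set (lebT R n)).
    exact: ball_leb_measurable.
  have sub : (ball x (r0 / m%:R ^+ j.+1) : set (lebT R n)) `<=` V.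
    move=> z; rewrite ball_rowE/= distrC => zd; apply: KxV => /=; apply: (le_trans (ltW zd)).
    rewrite ler_pdivrMr ?exprn_gt0// ler_peMr ?(ltW r00)//.
    by rewrite exprn_ege1// ler1n (leq_trans _ m3).
  apply: (ge0_le_integral mu mb).
  - by move=> z _; exact: (psi0_ge0 (a, l)).
  - exact: measurable_funS mV sub (mpsi0 (a, l)).
  - exact: measurable_funS mV sub mpsi.
  - move=> z _; rewrite /psi (bigD1 (a, l))//=; apply: leeDl; exact: sume_ge0.
have := morrey_point P_young alpha_ge1 P_iv m3 b1 bm bP oV (Vg a) KxV r00 k0 (ler0n _ _) intx (intg a).
by rewrite -/E -/D => h; rewrite mulrAC ler_pdivlMr// mulrC [D * _]mulrC.
Qed.

End small_sphere.

(** * Comparison of two C^1 approximations of a Sobolev function *)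

Section sobolev.
Context {R : realType} {n : nat}.
Implicit Types (V : set 'rV[R]_n) (f g h : 'rV[R]_n -> R).
Local Notation mu := (leb R n).
Local Open Scope ereal_scope.

Lemma loc_integrableB V f g : open V -> loc_integrable V f -> loc_integrable V g ->
  loc_integrable V (fun x => f x - g x)%R.
Proof.
move=> oV [mf If] [mg Ig]; split; first exact: measurable_funB.
move=> K cK KV.
have mK : measurable (K : set (lebT R n)) by exact: compact_leb_measurable.
have mV : measurable (V : set (lebT R n)) by exact: open_leb_measurable.
have mfK : measurable_fun (K : set (lebT R n)) ((fun x => `|f x|%:E) : lebT R n -> \bar R).
  by apply/measurable_EFinP; apply: measurableT_comp => //; exact: measurable_funS mV KV mf.
have mgK : measurable_fun (K : set (lebT R n)) ((fun x => `|g x|%:E) : lebT R n -> \bar R).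
  by apply/measurable_EFinP; apply: measurableT_comp => //; exact: measurable_funS mV KV mg.
have f0 x : K x -> 0 <= `|f x|%:E by move=> _; rewrite lee_fin.
have g0 x : K x -> 0 <= `|g x|%:E by move=> _; rewrite lee_fin.
apply: (@le_lt_trans _ _ (\int[mu]_(x in K) (`|f x|%:E + `|g x|%:E))).
  apply: (ge0_le_integral mu mK).
  - by move=> x _; rewrite lee_fin.
  - apply/measurable_EFinP; apply: (measurableT_comp (@normr_measurable R setT)).
    exact: (measurable_funS mV KV (measurable_funB mf mg)).
  - exact: emeasurable_funD.
  - by move=> x _; rewrite -EFinD lee_fin; exact: ler_normB.
rewrite (ge0_integralD mu mK f0 mfK g0 mgK).
by apply: lte_add_pinfty; [exact: If|exact: Ig].
Qed.

Lemma is_weak_partialB V i f g f' g' : open V -> loc_integrable V f -> loc_integrable V g ->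
  is_weak_partial V i f f' -> is_weak_partial V i g g' ->
  is_weak_partial V i (fun x => f x - g x)%R (fun x => f' x - g' x)%R.
Proof.
move=> oV lf lg [lf' Hf] [lg' Hg]; split; first exact: loc_integrableB.
move=> phi tphi.
have mV : measurable (V : set (lebT R n)) by exact: open_leb_measurable.
have [K [cK KV phi0 dphi0]] := test_partial_supp i tphi.
have cphi := test_continuous tphi.
have cdphi : continuous (partial i phi).
  move=> x; apply: (@Ck_on_continuous R n _ 0 setT _ x openT); last by [].
  exact: (Ck_onS i (tphi.1 1%N)).
have E (a b c : 'rV[R]_n -> R) : loc_integrable V a -> loc_integrable V b -> continuous c ->
    (forall x, ~ K x -> c x = 0%R) ->
    \int[mu]_(x in V) ((a x - b x) * c x)%:E =
    \int[mu]_(x in V) (a x * c x)%:E - \int[mu]_(x in V) (b x * c x)%:E /\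
    (\int[mu]_(x in V) (b x * c x)%:E) \is a fin_num.
  move=> la lb cc c0.
  have ia : mu.-integrable (V : set (lebT R n)) (EFin \o ((fun x => a x * c x)%R : lebT R n -> R)).
    by apply: loc_integrable_test => //; exists K.
  have ib : mu.-integrable (V : set (lebT R n)) (EFin \o ((fun x => b x * c x)%R : lebT R n -> R)).
    by apply: loc_integrable_test => //; exists K.
  split; last exact: integrable_fin_num ib.
  rewrite -(integralB mV ia ib); apply: eq_integral => x _.
  by rewrite /= -EFinB mulrBl.
have [-> _] := E _ _ _ lf lg cdphi dphi0.
have [-> fin] := E _ _ _ lf' lg' cphi phi0.
by rewrite (Hf _ tphi) (Hg _ tphi) fin_num_oppeB// oppeK.
Qed.

Lemma weak_partialP V i f : weakly_differentiable V f ->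
  is_weak_partial V i f (weak_partial V i f).
Proof. by move=> [_ /(_ i) ex]; exact: (xgetPex (fun=> 0%R) ex). Qed.

Variable P : R -> R.
Hypothesis P_young : young_function P.

Lemma luxemburg_ge0 V f : 0 <= luxemburg P V f.
Proof. by apply: le_ereal_inf_tmp => _ [k [k0 _] <-]; rewrite lee_fin ltW. Qed.

Lemma luxemburg_lt V f (e : R) : open V ->
  measurable_fun (V : set (lebT R n)) (f : lebT R n -> R) ->
  luxemburg P V f < e%:E -> \int[mu]_(x in V) (P (`|f x| / e)%R)%:E <= 1.
Proof.
move=> oV mf /ereal_inf_lt[_ [k [k0 intk] <-]]; rewrite lte_fin => ke.
have e0 : (0 < e)%R by exact: lt_trans ke.
apply: le_trans intk; apply: ge0_le_integral.
- exact: open_leb_measurable.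
- by move=> x _; rewrite lee_fin; apply: (young_ge0 P_young); rewrite divr_ge0// ltW.
- by apply/measurable_EFinP; exact: (young_measurable P_young).
- by apply/measurable_EFinP; exact: (young_measurable P_young).
- move=> x _; rewrite lee_fin; apply: (young_le P_young); first by rewrite divr_ge0// ltW.
  by rewrite ler_wpM2l// lef_pV2 ?posrE// ltW.
Qed.

Lemma W1P_norm_lt V f e : W1P_norm P V f < e ->
  \int[mu]_(x in V) `|f x|%:E < e /\ forall i, luxemburg P V (weak_partial V i f) < e.
Proof.
move=> fe; split => [|i]; apply: le_lt_trans fe; rewrite /W1P_norm.
  by apply: leeDl; apply: sume_ge0 => i _; exact: luxemburg_ge0.
rewrite (bigD1 i)// addeCA; apply: leeDl; apply: adde_ge0.
  by apply: integral_ge0 => x _; rewrite lee_fin.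
by apply: sume_ge0 => l _; exact: luxemburg_ge0.
Qed.

(** Here f disappears: the difference of the weak derivatives of f - g1 and f - g2 is a weak
    derivative of g2 - g1, so it agrees almost everywhere with the classical one. Convexity of P at
    the midpoint turns the two bounds at scale [e] into one at scale 2 e. *)
Lemma sobolev_close V f g1 g2 (e : R) : (0 < e)%R -> open V -> weakly_differentiable V f ->
  Ck_on 1 V g1 -> Ck_on 1 V g2 ->
  W1P_norm P V (fun x => f x - g1 x)%R < e%:E -> W1P_norm P V (fun x => f x - g2 x)%R < e%:E ->
  (forall i, \int[mu]_(x in V) (P (`|partial i (fun y => g2 y - g1 y)%R x| / (2 * e)))%:E <= 1)
  /\ \int[mu]_(x in V) `|g2 x - g1 x|%:E <= (2 * e)%:E.
Proof.
move=> e0 oV wf V1 V2 /W1P_norm_lt[n1 l1] /W1P_norm_lt[n2 l2].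
have mV : measurable (V : set (lebT R n)) by exact: open_leb_measurable.
have lf : loc_integrable V f by case: wf.
have lg g : Ck_on 1 V g -> loc_integrable V g.
  by move=> Vg; apply: continuous_loc_integrable => // x; exact: (Ck_on_continuous oV Vg).
have wB g : Ck_on 1 V g -> weakly_differentiable V (fun x => f x - g x)%R.
  move=> Vg; split; first by apply: loc_integrableB => //; exact: lg.
  move=> i; have wpf := weak_partialP i wf; have wpg := C1_weak_partial i oV Vg.
  by eexists; apply: (is_weak_partialB oV lf _ wpf wpg); exact: lg.
have V12 : Ck_on 1 V (fun y => g2 y - g1 y)%R.
  have := Ck_onD oV V2 (Ck_onM oV (Ck_on_cst 1 (-1 : R)%R oV) V1).
  by apply: Ck_on_eq => // x _ /=; rewrite mulN1r.
have [lB1 _] := wB _ V1; have [lB2 _] := wB _ V2.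
split=> [i|].
  set h1 := weak_partial V i (fun x => f x - g1 x)%R in (l1).
  set h2 := weak_partial V i (fun x => f x - g2 x)%R.
  have w1 := weak_partialP i (wB _ V1); have w2 := weak_partialP i (wB _ V2).
  have := is_weak_partialB oV lB1 lB2 w1 w2.
  have -> : (fun x => f x - g1 x - (f x - g2 x))%R = (fun y => g2 y - g1 y)%R.
    by apply/funext => x; ring.
  rewrite -/h1 -/h2 => /(weak_partial_C1_ae oV V12) ae12.
  have mh1 : measurable_fun (V : set (lebT R n)) (h1 : lebT R n -> R) by case: w1 => -[].
  have mh2 : measurable_fun (V : set (lebT R n)) (h2 : lebT R n -> R) by case: w2 => -[].
  have i1 := luxemburg_lt oV mh1 (l1 i); have i2 := luxemburg_lt oV mh2 (l2 i).
  have e20 : (0 < 2 * e)%R by rewrite mulr_gt0.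
  have md : measurable_fun (V : set (lebT R n)) ((fun x => h1 x - h2 x)%R : lebT R n -> R).
    exact: (measurable_funB mh1 mh2).
  have pos (h : 'rV[R]_n -> R) (k : R) x : (0 < k)%R -> 0 <= (P (`|h x| / k))%:E.
    by move=> k0; rewrite lee_fin; apply: (young_ge0 P_young); rewrite divr_ge0// ltW.
  have mY (h : 'rV[R]_n -> R) (k : R) : (0 < k)%R ->
      measurable_fun (V : set (lebT R n)) (h : lebT R n -> R) ->
      measurable_fun (V : set (lebT R n)) ((fun x => (P (`|h x| / k))%:E) : lebT R n -> \bar R).
    by move=> k0 mh; apply/measurable_EFinP; exact: (young_measurable P_young).
  have -> : \int[mu]_(x in V) (P (`|partial i (fun y => g2 y - g1 y)%R x| / (2 * e)))%:E =
      \int[mu]_(x in V) (P (`|h1 x - h2 x| / (2 * e))%R)%:E.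
    apply: ge0_ae_eq_integral.
    - exact: mV.
    - apply: (mY (partial i (fun y => g2 y - g1 y)%R) _ e20); apply: continuous_leb_measurable => // x.
      exact: (Ck_on_continuous oV (Ck_onS i V12)).
    - exact: (mY _ _ e20 md).
    - by move=> x _; exact: (pos (partial i (fun y => g2 y - g1 y)%R)).
    - by move=> x _; exact: (pos (fun x => h1 x - h2 x)%R).
    - by apply: negligibleS ae12 => x; apply: contra_not => H Vx; rewrite H.
  apply: (@le_trans _ _ (\int[mu]_(x in V) ((2^-1)%:E * ((P (`|h1 x| / e))%:E + (P (`|h2 x| / e))%:E)))).
    apply: (ge0_le_integral mu mV).
    - by move=> x _; exact: (pos (fun x => h1 x - h2 x)%R).
    - exact: (mY _ _ e20 md).
    - apply: emeasurable_funM; first exact: measurable_cst.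
      by apply: emeasurable_funD; exact: mY.
    - move=> x _; rewrite -EFinD -EFinM lee_fin [leRHS]mulrC.
      apply: le_trans (young_mid P_young _ _); rewrite ?divr_ge0 ?(ltW e0)//.
      apply: (young_le P_young); first by rewrite divr_ge0// ltW.
      rewrite -mulrDl -mulrA -invfM [(e * 2)%R]mulrC ler_wpM2r ?invr_ge0 ?(ltW e20)//.
      exact: ler_normB.
  have s0 x : V x -> 0 <= (P (`|h1 x| / e))%:E + (P (`|h2 x| / e))%:E.
    by move=> _; apply: adde_ge0; exact: pos.
  have ms := emeasurable_funD (mY h1 e e0 mh1) (mY h2 e e0 mh2).
  rewrite (ge0_integralZl mu mV ms s0); last by rewrite lee_fin.
  rewrite (ge0_integralD mu mV (fun x _ => pos h1 e x e0) (mY h1 e e0 mh1)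
    (fun x _ => pos h2 e x e0) (mY h2 e e0 mh2)).
  apply: (@le_trans _ _ ((2^-1)%:E * (1 + 1))).
    apply: lee_wpmul2l; first by rewrite lee_fin.
    exact: (leeD i1 i2).
  by rewrite -EFinD -EFinM mulVf.
have mB g : loc_integrable V (fun x => f x - g x)%R ->
    measurable_fun (V : set (lebT R n)) ((fun x => `|f x - g x|%:E) : lebT R n -> \bar R).
  by move=> [mfg _]; apply/measurable_EFinP; exact: measurableT_comp.
apply: (@le_trans _ _ (\int[mu]_(x in V) (`|f x - g1 x|%:E + `|f x - g2 x|%:E))).
  apply: (ge0_le_integral mu mV).
  - by move=> x _; rewrite lee_fin.
  - apply/measurable_EFinP; apply: (measurableT_comp (@normr_measurable R setT)).
    by apply: continuous_leb_measurable => // x; exact: (Ck_on_continuous oV V12).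
  - by apply: emeasurable_funD; exact: mB.
  - move=> x _; rewrite -EFinD lee_fin.
    have -> : (g2 x - g1 x = (f x - g1 x) - (f x - g2 x))%R by ring.
    exact: ler_normB.
rewrite (ge0_integralD mu mV (f1 := fun x => `|f x - g1 x|%:E) (f2 := fun x => `|f x - g2 x|%:E)).
- rewrite mulr_natl mulr2n EFinD; apply: leeD; exact: ltW.
- by move=> x _; rewrite lee_fin.
- exact: mB.
- by move=> x _; rewrite lee_fin.
- exact: mB.
Qed.

End sobolev.

(** * Homotopies of maps of cubes *)

Section gluing.
Context {R : realType}.

(** Used with clamps and retractions onto A: it trades continuity on a subspace for continuity
    everywhere, which is easier to glue. *)
Lemma comp_within_continuous (S T U : topologicalType) (A : set T) (r : S -> T) (f : T -> U) :
  {within A, continuous f} -> continuous r -> (forall x, A (r x)) -> continuous (f \o r).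
Proof.
move=> /subspace_continuousP cf cr Ar x W /= Wf.
have H : nbhs (r x) (fun y => A y -> W (f y)) by exact: (cf (r x) (Ar x)).
have := cr x _ H; rewrite /nbhs /=; apply: (@filterS _ (nbhs x)) => y /=.
by apply; exact: Ar.
Qed.

Lemma continuous_add (T : topologicalType) (W : normedModType R) (f g : T -> W) :
  continuous f -> continuous g -> continuous (fun x => f x + g x).
Proof. by move=> cf cg x; apply: cvgD; [exact: cf|exact: cg]. Qed.

Lemma continuous_sub (T : topologicalType) (W : normedModType R) (f g : T -> W) :
  continuous f -> continuous g -> continuous (fun x => f x - g x).
Proof. by move=> cf cg x; apply: cvgB; [exact: cf|exact: cg]. Qed.

Lemma continuous_scale (T : topologicalType) (W : normedModType R) (f : T -> R) (g : T -> W) :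
  continuous f -> continuous g -> continuous (fun x => f x *: g x).
Proof. by move=> cf cg x; apply: cvgZ; [exact: cf|exact: cg]. Qed.

Lemma continuous_mul (T : topologicalType) (f g : T -> R) :
  continuous f -> continuous g -> continuous (fun x => f x * g x).
Proof. by move=> cf cg x; apply: cvgM; [exact: cf|exact: cg]. Qed.

Lemma continuous_inv (T : topologicalType) (f : T -> R) :
  (forall x, f x != 0) -> continuous f -> continuous (fun x => (f x)^-1).
Proof. by move=> f0 cf x; apply: cvgV; [exact: f0|exact: cf]. Qed.

Lemma continuous_norm (T : topologicalType) (W : normedModType R) (f : T -> W) :
  continuous f -> continuous (fun x => `|f x|).
Proof. by move=> cf x; apply: cvg_norm; exact: cf. Qed.

Lemma continuous_maxr (T : topologicalType) (f g : T -> R) :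
  continuous f -> continuous g -> continuous (fun x => Num.max (f x) (g x)).
Proof. by move=> cf cg x; apply: continuous_max; [exact: cf|exact: cg]. Qed.

Lemma glue_closed (S T : topologicalType) (A B : set S) (f g : S -> T) :
  closed A -> closed B -> A `|` B = setT ->
  {within A, continuous f} -> {within B, continuous g} ->
  (forall x, A x -> B x -> f x = g x) ->
  continuous (fun x => if `[< A x >] then f x else g x).
Proof.
move=> cA cB AB cf cg fg; set h := fun x => _.
have := @withinU_continuous _ _ A B h cA cB; rewrite AB.
move=> H; have := H _ _.
rewrite continuous_subspace_setT; apply.
- apply: subspace_eq_continuous cf => x /set_mem Ax.
  by change (f x = h x); rewrite /h asboolT.
- apply: subspace_eq_continuous cg => x /set_mem Bx.
  by change (g x = h x); rewrite /h; case: asboolP => // Ax; rewrite -fg.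
Qed.

Lemma glue_le (S T : topologicalType) (h : S -> R) (f g : S -> T) :
  continuous h -> continuous f -> continuous g ->
  (forall x, h x = 0 -> f x = g x) ->
  continuous (fun x => if h x <= 0 then f x else g x).
Proof.
move=> ch cf cg fg.
rewrite (_ : (fun x => _) = (fun x => if `[< h x <= 0 >] then f x else g x)); last first.
  by apply/funext => x; rewrite asboolb.
apply: (@glue_closed _ _ [set x | h x <= 0] [set x | 0 <= h x]).
- exact: (closed_comp (fun x _ => ch x) (@closed_le R 0)).
- exact: (closed_comp (fun x _ => ch x) (@closed_ge R 0)).
- by apply/seteqP; split => // x _ /=; case: (leP (h x) 0) => [|/ltW]; [left|right].
- exact: continuous_subspaceT.
- exact: continuous_subspaceT.
- by move=> x /= h1 h2; apply: fg; apply/eqP; rewrite eq_le h1.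
Qed.

Definition clamp01 (t : R) : R := Num.max 0 (Num.min 1 t).

Lemma clamp01_itv t : 0 <= clamp01 t <= 1.
Proof. by rewrite /clamp01 le_max lexx/= ge_max ler01 ge_min lexx. Qed.

Lemma clamp01_id t : 0 <= t <= 1 -> clamp01 t = t.
Proof. by move=> /andP[t0 t1]; rewrite /clamp01 (min_r t1) max_r. Qed.

Lemma clamp01_0 : clamp01 0 = 0. Proof. by rewrite clamp01_id ?lexx ?ler01. Qed.

Lemma clamp01_1 : clamp01 1 = 1. Proof. by rewrite clamp01_id ?lexx ?ler01. Qed.

Lemma continuous_clamp01 : continuous clamp01.
Proof.
move=> t; apply: continuous_max; first exact: cst_continuous.
by apply: continuous_min; [exact: cst_continuous|exact: cvg_id].
Qed.

Lemma continuous_pair_for (S T U : topologicalType) (f : S -> T) (g : S -> U) x :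
  {for x, continuous f} -> {for x, continuous g} -> {for x, continuous (fun x => (f x, g x))}.
Proof. by move=> cf cg; apply: cvg_pair; [exact: cf|exact: cg]. Qed.

Lemma continuous_pair (S T U : topologicalType) (f : S -> T) (g : S -> U) :
  continuous f -> continuous g -> continuous (fun x => (f x, g x)).
Proof. by move=> cf cg x; apply: cvg_pair; [exact: cf|exact: cg]. Qed.

Lemma fst_continuous (S T : topologicalType) : continuous (@fst S T).
Proof. by move=> x; exact: cvg_fst. Qed.

Lemma snd_continuous (S T : topologicalType) : continuous (@snd S T).
Proof. by move=> x; exact: cvg_snd. Qed.

Lemma comp_continuous (S T U : topologicalType) (f : S -> T) (g : T -> U) :
  continuous f -> continuous g -> continuous (fun x => g (f x)).
Proof. by move=> cf cg x; apply: (@continuous_comp _ _ _ f g); [exact: cf|exact: cg]. Qed.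

End gluing.

Section homotopy_tools.
Context {R : realType}.
Implicit Types (X Y : topologicalType).

(** Clamping the time to [0, 1] extends a homotopy to all real times, so that no subspace of the
    time axis occurs in later constructions. *)
Lemma homotopic_relP X Y (B : set X) (f g : X -> Y) :
  homotopic_rel R setT B f g <->
  exists H : R * X -> Y, [/\ continuous H, forall t x, t <= 0 -> H (t, x) = f x,
    forall t x, 1 <= t -> H (t, x) = g x & forall t x, B x -> H (t, x) = f x].
Proof.
split=> [[H [cH H0 H1 HB]]|[H [cH H0 H1 HB]]].
  pose c (tx : R * X) := (clamp01 tx.1, tx.2).
  exists (H \o c); split.
  - apply: comp_within_continuous cH _ _.
      apply: continuous_pair; last exact: snd_continuous.
      by apply: comp_continuous (@fst_continuous _ _) _; exact: continuous_clamp01.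
    by move=> [t x]; split => //=; rewrite in_itv/= clamp01_itv.
  - move=> t x t0; rewrite /= /c /clamp01/= max_l; first exact: H0.
    by rewrite ge_min t0 orbT.
  - move=> t x t1; rewrite /= /c /clamp01/= min_l// max_r//; exact: H1.
  - by move=> t x Bx; apply: HB => //; exact: clamp01_itv.
exists H; split.
- exact: continuous_subspaceT.
- by move=> x _; exact: H0.
- by move=> x _; exact: H1.
- by move=> t x _; exact: HB.
Qed.

Lemma homotopic_rel_refl X Y (B : set X) (f : X -> Y) : continuous f ->
  homotopic_rel R setT B f f.
Proof.
move=> cf; apply/homotopic_relP; exists (fun tx => f tx.2); split => //.
by apply: comp_continuous cf; exact: snd_continuous.
Qed.

Lemma homotopic_rel_sym X Y (B : set X) (f g : X -> Y) : 
  homotopic_rel R setT B f g -> homotopic_rel R setT B g f.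
Proof.
move=> /homotopic_relP[H [cH H0 H1 HB]]; apply/homotopic_relP.
exists (fun tx => H (1 - tx.1, tx.2)); split.
- apply: comp_continuous cH; apply: continuous_pair; last exact: snd_continuous.
  by apply: continuous_sub; [exact: cst_continuous|exact: fst_continuous].
- by move=> t x t0 /=; apply: H1; rewrite lerBrDl -lerBrDr subrr.
- by move=> t x t0 /=; apply: H0; rewrite subr_le0.
- move=> t x Bx /=; rewrite HB// -(HB 1 x Bx); exact: H1.
Qed.

Lemma homotopic_rel_trans X Y (B : set X) (g f h : X -> Y) :
  homotopic_rel R setT B f g -> homotopic_rel R setT B g h -> homotopic_rel R setT B f h.
Proof.
move=> /homotopic_relP[H [cH H0 H1 HB]] /homotopic_relP[K [cK K0 K1 KB]].
apply/homotopic_relP.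
exists (fun tx => if tx.1 - 2^-1 <= 0 then H (2 * tx.1, tx.2) else K (2 * tx.1 - 1, tx.2)).
have c1 : continuous (fun tx : R * X => tx.1) by exact: fst_continuous.
split.
- apply: glue_le.
  + by apply: continuous_sub c1 _; exact: cst_continuous.
  + apply: comp_continuous cH; apply: continuous_pair; last exact: snd_continuous.
    by apply: continuous_mul c1; exact: cst_continuous.
  + apply: comp_continuous cK; apply: continuous_pair; last exact: snd_continuous.
    apply: continuous_sub; last exact: cst_continuous.
    by apply: continuous_mul c1; exact: cst_continuous.
  + move=> [t x] /= t2; have -> : t = 2^-1 by lra.
    by rewrite H1 ?mulfV// K0// subrr.
- by move=> t x t0 /=; case: ifP => [_|/negP]; [apply: H0|case]; lra.
- move=> t x t1 /=; case: ifP => [h1|_]; last by apply: K1; lra.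
  by exfalso; lra.
- move=> t x Bx /=; case: ifP => _; first exact: HB.
  by rewrite KB// -(HB 1 x Bx) H1.
Qed.

End homotopy_tools.

(** * Maps of the unit disk of the sup norm that agree on its boundary *)

Section disks.
Context {R : realType} {n : nat}.
Implicit Types (Y : topologicalType) (z : 'rV[R]_n).

Lemma id_continuous (T : topologicalType) : continuous (fun x : T => x).
Proof. by move=> x; exact: cvg_id. Qed.

Lemma norm_rV_continuous : continuous (fun z : 'rV[R]_n => `|z|).
Proof. by apply: continuous_norm; exact: id_continuous. Qed.

Definition retract z : 'rV[R]_n := (Num.max 1 `|z|)^-1 *: z.

Lemma max1_gt0 (t : R) : 0 < Num.max 1 t.
Proof. by rewrite lt_max ltr01. Qed.

Lemma retract_continuous : continuous retract.
Proof.
apply: continuous_scale; last exact: id_continuous.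
apply: continuous_inv => [z|]; first by rewrite gt_eqF// max1_gt0.
by apply: continuous_maxr; [exact: cst_continuous|exact: norm_rV_continuous].
Qed.

Lemma norm_retract z : `|retract z| = Num.min 1 `|z|.
Proof.
rewrite normrZ normfV gtr0_norm ?max1_gt0//.
case: (leP 1 `|z|) => z1; last by rewrite invr1 mul1r.
by rewrite mulVf// gt_eqF// (lt_le_trans ltr01).
Qed.

Lemma norm_retract_le1 z : `|retract z| <= 1.
Proof. by rewrite norm_retract ge_min lexx. Qed.

Lemma retract_id z : `|z| <= 1 -> retract z = z.
Proof. by move=> z1; rewrite /retract max_l// invr1 scale1r. Qed.

Lemma norm_retract_out z : 1 <= `|z| -> `|retract z| = 1.
Proof. by move=> z1; rewrite norm_retract min_l. Qed.

Lemma norm_eq1_coord z : (0 < n)%N -> `|z| = 1 -> exists i, `|z ord0 i| = 1.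
Proof.
move=> n0 z1; apply/not_existsP => H.
have : `|z| < 1.
  apply/row_norm_ltP => // i; rewrite lt_neqAle; apply/andP; split.
    by apply/eqP; exact: H.
  by rewrite -z1; exact: row_coord_le.
by rewrite z1 ltxx.
Qed.

(** Up to this affine change, the cube in the definition of pi_n is the unit disk of the sup norm
    and its boundary is the unit sphere of that norm. *)
Definition to_disk (x : 'rV[R]_n) : 'rV[R]_n := - const_mx 1 + 2 *: x.
Definition to_cube (x : 'rV[R]_n) : 'rV[R]_n := 2^-1 *: const_mx 1 + 2^-1 *: x.

Lemma to_disk_continuous : continuous to_disk.
Proof. exact: affine_continuous. Qed.

Lemma to_cube_continuous : continuous to_cube.
Proof. exact: affine_continuous. Qed.

Lemma to_cubeK x : to_disk (to_cube x) = x.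
Proof. by apply/rowP => i; rewrite !mxE; field. Qed.

Lemma to_diskK x : to_cube (to_disk x) = x.
Proof. by apply/rowP => i; rewrite !mxE; field. Qed.

Let to_diskE x i : to_disk x ord0 i = 2 * x ord0 i - 1.
Proof. by rewrite !mxE addrC. Qed.

Let to_cubeE x i : to_cube x ord0 i = (x ord0 i + 1) / 2.
Proof. by rewrite !mxE; ring. Qed.

Lemma cube_to_cube z : `|z| <= 1 -> @cube R n (to_cube z).
Proof.
move=> z1 i; have := le_trans (row_coord_le z i) z1; rewrite ler_norml to_cubeE.
by move=> /andP[? ?]; apply/andP; split; lra.
Qed.

Lemma boundary_to_cube z : (0 < n)%N -> `|z| = 1 -> @cube_boundary R n (to_cube z).
Proof.
move=> n0 z1; split; first by apply: cube_to_cube; rewrite z1.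
have [i /eqP] := norm_eq1_coord n0 z1; rewrite eqr_norml ler01 andbT => zi.
exists i; rewrite to_cubeE; case/orP: zi => /eqP ->; first by right; field.
by left; field.
Qed.

Lemma norm_to_disk x : @cube R n x -> `|to_disk x| <= 1.
Proof.
move=> cx; apply/row_norm_leP => // i; rewrite to_diskE ler_norml.
by have /andP[? ?] := cx i; apply/andP; split; lra.
Qed.

Lemma boundary_to_disk x : @cube_boundary R n x -> 1 <= `|to_disk x|.
Proof.
move=> [_ [i xi]]; apply: le_trans (row_coord_le (to_disk x) i); rewrite to_diskE.
case: xi => ->; first by rewrite mulr0 sub0r normrN1.
by rewrite mulr1 -[2]/(1 + 1) addrK normr1.
Qed.

Lemma pi_trivial_disk Y (y : Y) (f : 'rV[R]_n -> Y) : (0 < n)%N ->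
  pi_trivial_at R n y -> continuous f -> (forall z, 1 <= `|z| -> f z = y) ->
  homotopic_rel R setT [set z | 1 <= `|z|] f (cst y).
Proof.
move=> n0 triv cf fy.
have lf : nloop y (f \o to_disk).
  split; last by move=> x bx; apply: fy; exact: boundary_to_disk.
  apply: continuous_subspaceT; exact: comp_continuous to_disk_continuous cf.
have [H [cH H0 H1 HB]] := triv _ lf.
exists (fun tz => H (clamp01 tz.1, to_cube (retract tz.2))); split.
- apply: continuous_subspaceT; apply: (comp_within_continuous cH).
    apply: continuous_pair.
      by apply: comp_continuous (@fst_continuous _ _) _; exact: continuous_clamp01.
    apply: comp_continuous to_cube_continuous.
    by apply: comp_continuous (@snd_continuous _ _) _; exact: retract_continuous.
  move=> [t z]; split => /=; first by rewrite in_itv/= clamp01_itv.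
  exact/cube_to_cube/norm_retract_le1.
- move=> z _ /=; rewrite clamp01_0 H0; last exact/cube_to_cube/norm_retract_le1.
  rewrite /= to_cubeK; have [z1|z1] := leP `|z| 1; first by rewrite retract_id.
  by rewrite !fy// ?norm_retract_out// ltW.
- by move=> z _ /=; rewrite clamp01_1 H1//; exact/cube_to_cube/norm_retract_le1.
- move=> t z _ /= z1; rewrite HB ?clamp01_itv//; last exact/boundary_to_cube/norm_retract_out.
  by rewrite /= to_cubeK !fy// norm_retract_out.
Qed.

Lemma nontrivial_disk Y (y : Y) : (0 < n)%N -> ~ pi_trivial_at R n y ->
  exists f : 'rV[R]_n -> Y, [/\ continuous f, forall z, 1 <= `|z| -> f z = y &
    ~ homotopic_rel R setT [set z | 1 <= `|z|] f (cst y)].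
Proof.
move=> n0 /existsNP[f /not_implyP[[cf fy] nf]].
have bd z : 1 <= `|z| -> f (to_cube (retract z)) = y.
  by move=> z1; apply: fy; apply: boundary_to_cube => //; exact: norm_retract_out.
exists (f \o (to_cube \o retract)); split.
- apply: (comp_within_continuous cf).
    exact: (comp_continuous retract_continuous to_cube_continuous).
  by move=> z; exact/cube_to_cube/norm_retract_le1.
- exact: bd.
move=> /homotopic_relP[H [cH H0 H1 HB]]; apply: nf.
exists (fun tx => H (tx.1, to_disk tx.2)); split.
- apply: continuous_subspaceT; apply: comp_continuous cH.
  apply: continuous_pair; first exact: fst_continuous.
  exact: (comp_continuous (@snd_continuous _ _) to_disk_continuous).
- by move=> x cx /=; rewrite H0//= retract_id ?to_diskK//; exact: norm_to_disk.
- by move=> x cx /=; rewrite H1.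
- move=> t x _ bx /=; rewrite HB/=; last exact: boundary_to_disk.
  by rewrite bd ?fy//; exact: boundary_to_disk.
Qed.

Lemma retract_homotopy Y (H : R * 'rV[R]_n -> Y) (f g : 'rV[R]_n -> Y) : continuous H ->
  (forall z, `|z| <= 1 -> H (0, z) = f z) -> (forall z, `|z| <= 1 -> H (1, z) = g z) ->
  (forall t z, 0 <= t <= 1 -> `|z| = 1 -> H (t, z) = f z) ->
  homotopic_rel R setT [set z | 1 <= `|z|] (f \o retract) (g \o retract).
Proof.
move=> cH H0 H1 HB; exists (fun tz => H (tz.1, retract tz.2)); split.
- apply: continuous_subspaceT; apply: comp_continuous cH.
  apply: continuous_pair; first exact: fst_continuous.
  by apply: comp_continuous (@snd_continuous _ _) _; exact: retract_continuous.
- by move=> z _; exact/H0/norm_retract_le1.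
- by move=> z _; exact/H1/norm_retract_le1.
- by move=> t z t01 /= z1; apply: HB => //; exact: norm_retract_out.
Qed.

Let phi z : R := Num.max 0 (2 * `|z| - 1).

Let phi_continuous : continuous phi.
Proof.
apply: continuous_maxr; first exact: cst_continuous.
apply: continuous_sub; last exact: cst_continuous.
by apply: continuous_mul; [exact: cst_continuous|exact: norm_rV_continuous].
Qed.

Let phi1 z : `|z| = 1 -> phi z = 1.
Proof. by move=> z1; rewrite /phi z1 max_r; lra. Qed.

Let phi0 z : `|z| <= 2^-1 -> phi z = 0.
Proof. by move=> z1; rewrite /phi max_l//; lra. Qed.

(** The deformed map is constant, equal to v 0, on the inner half of the disk. This provides the
    room in which [disk_homotopy] goes around its rectangle. *)
Let shrink_homotopy Y (v : 'rV[R]_n -> Y) : continuous v ->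
  homotopic_rel R setT [set z | 1 <= `|z|] (v \o retract) ((fun z => v (phi z *: z)) \o retract).
Proof.
move=> cv.
apply: (@retract_homotopy _ (fun tz => v ((1 - tz.1 + tz.1 * phi tz.2) *: tz.2))).
- have cp : continuous (fun tz : R * 'rV[R]_n => phi tz.2).
    exact: (comp_continuous (@snd_continuous _ _) phi_continuous).
  apply: comp_continuous cv; apply: continuous_scale; last exact: snd_continuous.
  apply: continuous_add; last by apply: continuous_mul cp; exact: fst_continuous.
  by apply: continuous_sub; [exact: cst_continuous|exact: fst_continuous].
- by move=> z _ /=; rewrite mul0r addr0 subr0 scale1r.
- by move=> z _ /=; rewrite mul1r subrr add0r.
- by move=> t z _ z1 /=; rewrite phi1// mulr1 subrK scale1r.
Qed.

(* The map equal to w on the inner half of the disk and to v, run backwards, on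
   the outer half is constant on the boundary; a null-homotopy F of it is
   traversed from the outer to the inner half around the rectangle
   [0, 1] x [0, 1] of times and radii. *)
Lemma disk_homotopy Y (v w : 'rV[R]_n -> Y) : (0 < n)%N -> pi_trivial R n Y ->
  continuous v -> continuous w -> (forall z, `|z| = 1 -> v z = w z) ->
  homotopic_rel R setT [set z | 1 <= `|z|] (v \o retract) (w \o retract).
Proof.
move=> n0 triv cv cw vw; pose y0 := v 0.
pose m z : R := Num.max 2^-1 `|z|.
have m0 z : 0 < m z by rewrite /m lt_max invr_gt0 ltr0n.
have cm : continuous m.
  by apply: continuous_maxr; [exact: cst_continuous|exact: norm_rV_continuous].
have cmV : continuous (fun z => (m z)^-1).
  by apply: continuous_inv cm => z; rewrite gt_eqF.
(* On the outer half the radius |z| is replaced by 2 - 2 |z| on the same ray: the boundary values of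
   v appear at radius 1/2 and v 0 at radius 1. The lower bound 1/2 in [m] avoids division by 0. *)
pose psi z := Num.max 0 (2 - 2 * `|z|) / m z.
pose f z := if `|z| - 2^-1 <= 0 then w (2 *: z) else v (psi z *: z).
have c2 (T : topologicalType) (r : R) : continuous (fun _ : T => r) by exact: cst_continuous.
have cf : continuous f.
  apply: glue_le.
  - by apply: continuous_sub => //; exact: norm_rV_continuous.
  - by apply: comp_continuous cw; apply: continuous_scale => //; exact: id_continuous.
  - apply: comp_continuous cv; apply: continuous_scale; last exact: id_continuous.
    apply: continuous_mul cmV; apply: continuous_maxr => //.
    apply: continuous_sub => //; apply: continuous_mul => //; exact: norm_rV_continuous.
  - move=> z /eqP; rewrite subr_eq0 => /eqP z2; rewrite /psi /m z2 maxxx.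
    rewrite mulfV// max_r; last by lra.
    have -> : (2 - 1) / 2^-1 = 2 :> R by field.
    by rewrite vw// normrZ z2 ger0_norm// mulfV.
have fy z : 1 <= `|z| -> f z = y0.
  move=> z1; rewrite /f ifF; last by apply/negbTE; rewrite -ltNge subr_gt0; lra.
  by rewrite /psi max_l ?mul0r ?scale0r// subr_le0; lra.
have /homotopic_relP[F [cF F0 F1 FB]] := pi_trivial_disk n0 (triv y0) cf fy.
have Fy t z : 1 <= `|z| -> F (t, z) = y0 by move=> z1; rewrite FB// fy.
have mE z : 2^-1 <= `|z| -> m z = `|z| by move=> z2; rewrite /m max_r.
have fin z : `|z| <= 1 -> f (2^-1 *: z) = w z.
  move=> z1; rewrite /f ifT; first by rewrite scalerA mulfV// scale1r.
  by rewrite normrZ ger0_norm ?invr_ge0// subr_le0; lra.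
have ph01 z : `|z| <= 1 -> 0 <= phi z <= 1.
  by move=> z1; rewrite /phi le_max lexx ge_max ler01/=; lra.
have cphi2 : continuous (fun tz : R * 'rV[R]_n => phi tz.2).
  exact: (comp_continuous (@snd_continuous _ _) phi_continuous).
have cn2 : continuous (fun tz : R * 'rV[R]_n => `|tz.2|).
  exact: (comp_continuous (@snd_continuous _ _) norm_rV_continuous).
have cmV2 : continuous (fun tz : R * 'rV[R]_n => (m tz.2)^-1).
  exact: (comp_continuous (@snd_continuous _ _) cmV).
have c1 : continuous (fun tz : R * 'rV[R]_n => tz.1) by exact: fst_continuous.
have c3 : continuous (fun tz : R * 'rV[R]_n => tz.2) by exact: snd_continuous.
have cp : continuous (fun tz : R * 'rV[R]_n => phi tz.2 * `|tz.2| / 2).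
  by apply: continuous_mul => //; exact: continuous_mul.
(* All three maps evaluate F on the ray of z. [H1] moves the time from 0 to 1 - phi at radius 1 -
   phi |z| / 2, [H2] moves the radius to phi |z| / 2, and [H3] moves the time back to 0. For |z| = 1
   one has phi = 1, so the time stays 0 and the radius 1/2, and the boundary values never change. *)
pose H1 (tz : R * 'rV[R]_n) := if `|tz.2| - 2^-1 <= 0 then y0 else
  F (tz.1 * (1 - phi tz.2), ((1 - phi tz.2 * `|tz.2| / 2) / m tz.2) *: tz.2).
pose H2 (tz : R * 'rV[R]_n) := F (1 - phi tz.2,
  (((1 - tz.1) * (1 - phi tz.2 * `|tz.2| / 2) + tz.1 * (phi tz.2 * `|tz.2| / 2)) / m tz.2) *: tz.2).
pose H3 (tz : R * 'rV[R]_n) := F ((1 - tz.1) * (1 - phi tz.2), (phi tz.2 / 2) *: tz.2).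
have cH1 : continuous H1.
  apply: glue_le.
  - exact: continuous_sub.
  - exact: cst_continuous.
  - apply: comp_continuous cF; apply: continuous_pair.
      by apply: continuous_mul => //; exact: continuous_sub.
    apply: continuous_scale => //; apply: continuous_mul => //; exact: continuous_sub.
  - move=> [t z] /= /eqP; rewrite subr_eq0 => /eqP z2.
    rewrite Fy// mE ?z2// phi0 ?z2// !mul0r subr0 mul1r normrZ z2.
    by rewrite invrK ger0_norm// mulfV.
have cH2 : continuous H2.
  apply: comp_continuous cF; apply: continuous_pair; first exact: continuous_sub.
  apply: continuous_scale => //; apply: continuous_mul => //.
  apply: continuous_add; apply: continuous_mul => //; exact: continuous_sub.
have cH3 : continuous H3.
  apply: comp_continuous cF; apply: continuous_pair.
    by apply: continuous_mul; exact: continuous_sub.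
  by apply: continuous_scale => //; exact: continuous_mul.
have H1bd t z : `|z| = 1 -> H1 (t, z) = w z.
  move=> z1; rewrite /H1/= z1 ifF; last by apply/negbTE; rewrite -ltNge; lra.
  rewrite phi1// mE ?z1; last by lra.
  rewrite subrr mulr0 F0// mulr1 divr1 mul1r.
  have -> : 1 - 2^-1 = 2^-1 :> R by lra.
  by rewrite fin// z1.
have H2bd t z : `|z| = 1 -> H2 (t, z) = w z.
  move=> z1; rewrite /H2/= z1 phi1// mE ?z1; last by lra.
  rewrite subrr F0// mulr1 divr1 mul1r.
  have -> : (1 - t) * (1 - 2^-1) + t / 2 = 2^-1 :> R by field.
  by rewrite fin// z1.
apply: (homotopic_rel_trans (shrink_homotopy cv)).
apply: homotopic_rel_trans (homotopic_rel_sym (shrink_homotopy cw)).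
apply: (@homotopic_rel_trans _ _ _ _ ((fun z => H1 (1, z)) \o retract)).
  apply: (retract_homotopy cH1) => // [z z1|t z _ z1]; last first.
    by rewrite H1bd// phi1// scale1r vw.
  rewrite /H1/=; case: ifPn => [z2|].
    by rewrite phi0 ?scale0r// -subr_le0.
  rewrite -ltNge subr_gt0 => z2; rewrite mul0r F0// mE ?(ltW z2)//.
  have zp : 0 < `|z| by apply: lt_trans z2; rewrite invr_gt0.
  have /andP[p0 p1] := ph01 z z1.
  set x := ((1 - phi z * `|z| / 2) / `|z|) *: z.
  have xE : `|x| = 1 - phi z * `|z| / 2.
    have q0 : 0 <= 1 - phi z * `|z| / 2 by rewrite subr_ge0; nra.
    by rewrite /x normrZ ger0_norm ?divr_ge0 ?(ltW zp)// mulfVK// gt_eqF.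
  have x2 : 2^-1 <= `|x| by rewrite xE; nra.
  have xv : psi x *: x = phi z *: z.
    rewrite /psi mE// max_r; last by rewrite xE; nra.
    rewrite /x scalerA -/x xE; congr (_ *: _).
    field; rewrite gt_eqF//=; apply/eqP => h.
    by have := x2; rewrite xE; lra.
  (* The inner branch of [f] occurs at radius exactly 1/2 only, which means |z| = 1, where v and w
     agree. *)
  rewrite /f xv; case: ifPn => // ; rewrite xE => h.
  have pz : phi z * `|z| = 1 by nra.
  have z11 : `|z| = 1 by nra.
  rewrite phi1// scale1r vw// /x phi1// z11 mul1r divr1 scalerA.
  have -> : 2 * (1 - 1 / 2) = 1 :> R by field.
  by rewrite scale1r.
apply: (@homotopic_rel_trans _ _ _ _ ((fun z => H2 (1, z)) \o retract)).
  apply: (retract_homotopy cH2) => // [z z1|t z _ z1]; last by rewrite H2bd// H1bd.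
  rewrite /H1/= /H2/= mul1r subr0 mul1r mul0r addr0; case: ifPn => // z2.
  by rewrite phi0 ?subr0 ?F1// -subr_le0.
apply: (retract_homotopy cH3) => [z z1|z z1|t z _ z1].
- rewrite /H3 /H2/= subr0 mul1r subrr mul0r add0r mul1r.
  have [z2|z2] := leP `|z| 2^-1.
    by rewrite phi0// !mul0r !scale0r.
  rewrite mE ?(ltW z2)//; congr (F (_, _ *: _)); field.
  by rewrite gt_eqF//; apply: lt_trans z2; rewrite invr_gt0.
- rewrite /H3/= subrr mul0r F0// mulrC -scalerA fin// normrZ.
  by have /andP[p0 p1] := ph01 z z1; rewrite ger0_norm// mulr_ile1.
- rewrite H2bd// /H3/= phi1// subrr mulr0 F0// mul1r fin// z1//.
Qed.

End disks.

(** * Coordinate cubes in a manifold and replacement of a map inside one of them *)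

Section charts.
Context {R : realType} {X : topologicalType} {n : nat}.
Variable c : @chart R X n.
Hypothesis c_chart : is_chart c.
Implicit Types (z : 'rV[R]_n) (W K : set 'rV[R]_n).

Lemma chart_coordK x : chart_dom c x -> chart_param c (chart_coord c x) = x.
Proof. by case: c_chart => _ _ cK _ _ dx; apply: cK; exact/mem_set. Qed.

Lemma chart_imgP z : chart_img c z ->
  chart_dom c (chart_param c z) /\ chart_coord c (chart_param c z) = z.
Proof. by move=> [x dx <-]; rewrite chart_coordK. Qed.

Lemma chart_img_coord x : chart_dom c x -> chart_img c (chart_coord c x).
Proof. by move=> dx; exists x. Qed.

Lemma chart_param_cont z : chart_img c z -> {for z, continuous (chart_param c)}.
Proof.
case: c_chart => _ oi _ _; rewrite continuous_open_subspace// => H iz.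
exact/H/mem_set.
Qed.

Lemma chart_coord_cont x : chart_dom c x -> {for x, continuous (chart_coord c)}.
Proof.
case: c_chart => od _ _ + _; rewrite continuous_open_subspace// => H dx.
exact/H/mem_set.
Qed.

Lemma chart_param_image W : W `<=` chart_img c ->
  chart_param c @` W = chart_dom c `&` chart_coord c @^-1` W.
Proof.
move=> Wi; apply/seteqP; split => [_ [z Wz <-]|x [dx Wx]].
  by have [? e] := chart_imgP (Wi _ Wz); split => //=; rewrite e.
by exists (chart_coord c x) => //; exact: chart_coordK.
Qed.

Lemma chart_open_image W : open W -> W `<=` chart_img c -> open (chart_param c @` W).
Proof.
move=> oW Wi; rewrite chart_param_image// openE => x [dx Wx]; apply: filterI.
  by apply: open_nbhs_nbhs; split => //; case: c_chart.
by apply: (chart_coord_cont dx); apply: open_nbhs_nbhs.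
Qed.

Lemma chart_compact_image K : compact K -> K `<=` chart_img c -> compact (chart_param c @` K).
Proof.
move=> cK Ki; apply: continuous_compact cK; apply: continuous_in_subspaceT => z.
by move=> /set_mem/Ki; exact: chart_param_cont.
Qed.

Lemma chart_compact_closed K : hausdorff_space X -> compact K -> K `<=` chart_img c ->
  closed (chart_param c @` K).
Proof. by move=> hX cK Ki; apply: compact_closed => //; exact: chart_compact_image. Qed.

(** [disk_homotopy] is transported through the chart and glued with the constant homotopy. The
    pieces are the closed cube, closed in X since it is compact and X is Hausdorff, and the
    complement of the open cube; they meet in the image of the boundary, where u = w. *)
Lemma chart_replace_homotopy (Y : topologicalType) (y : 'rV[R]_n) (r : R) (u w : X -> Y) :
  (0 < n)%N -> hausdorff_space X -> pi_trivial R n Y -> 0 < r ->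
  [set z | `|z - y| <= r] `<=` chart_img c -> continuous u -> continuous w ->
  (forall z, `|z - y| = r -> u (chart_param c z) = w (chart_param c z)) ->
  let v x := if `[< (chart_param c @` [set z | `|z - y| <= r]) x >] then w x else u x in
  continuous v /\ homotopic R u v.
Proof.
move=> n0 hX triv r0 Ki cu cw uw v.
set Q := chart_param c @` [set z | `|z - y| <= r] in v *.
set Q0 := chart_param c @` ball y r.
have ballK : ball y r `<=` [set z | `|z - y| <= r].
  by move=> z; rewrite ball_rowE/= distrC => /ltW.
have cQ : closed Q by apply: chart_compact_closed => //; exact: closed_cube_compact.
have oQ0 : open Q0.
  by apply: chart_open_image; [exact: ball_open|exact: subset_trans ballK Ki].
have QC : Q `|` ~` Q0 = setT.
  apply/seteqP; split => // x _; have [q0|q0] := pselect (Q0 x); last by right.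
  by left; case: q0 => z /ballK ? <-; exists z.
have Qbd x : Q x -> ~ Q0 x -> exists2 z, `|z - y| = r & chart_param c z = x.
  move=> [z /= zr <-] nq; exists z => //; apply/eqP; rewrite eq_le zr/= leNgt.
  by apply/negP => h; apply: nq; exists z => //; rewrite ball_rowE/= distrC.
have cv : continuous v.
  apply: (@glue_closed _ _ Q (~` Q0)) => //; first exact: open_closedC.
  - exact: continuous_subspaceT.
  - exact: continuous_subspaceT.
  - by move=> x Qx /(Qbd x Qx)[z zr <-]; rewrite uw.
split => //.
pose e z := y + r *: retract z.
have eK z : `|e z - y| <= r.
  by rewrite /e addrAC subrr add0r normrZ gtr0_norm// ler_piMr ?(ltW r0)// norm_retract_le1.
have ce (h : X -> Y) : continuous h -> continuous (fun z => h (chart_param c (e z))).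
  move=> ch; apply: comp_continuous ch => z; apply: (@continuous_comp _ _ _ e).
    apply: (@comp_continuous _ _ _ (@retract R n) (fun v => y + r *: v)).
      exact: retract_continuous.
    exact: affine_continuous.
  by apply: chart_param_cont; apply: Ki; exact: eK.
have eE z : `|z| <= 1 -> e z = y + r *: z by move=> z1; rewrite /e retract_id.
have euw z : `|z| = 1 -> u (chart_param c (e z)) = w (chart_param c (e z)).
  move=> z1; apply: uw; rewrite eE ?z1// addrAC subrr add0r normrZ z1 mulr1.
  exact: gtr0_norm.
have /homotopic_relP[H [cH H0 H1 HB]] := disk_homotopy n0 triv (ce u cu) (ce w cw) euw.
have eret z : e (retract z) = e z by rewrite /e retract_id// norm_retract_le1.
pose q x := r^-1 *: (chart_coord c x - y).
have qe x : Q x -> chart_param c (e (q x)) = x /\ `|q x| <= 1.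
  move=> [z /= zr <-]; have [_ ek] := chart_imgP (Ki z zr).
  have q1 : `|q (chart_param c z)| <= 1.
    by rewrite /q ek normrZ gtr0_norm ?invr_gt0// mulrC ler_pdivrMr// mul1r.
  by split => //; rewrite eE// /q ek scalerA mulfV ?gt_eqF// scale1r addrC subrK.
apply/homotopic_relP.
exists (fun tx => if `[< Q tx.2 >] then H (tx.1, q tx.2) else u tx.2); split.
- apply: (@glue_closed _ _ [set tx | Q tx.2] [set tx | ~ Q0 tx.2]).
  + exact: (closed_comp (fun x _ => @snd_continuous _ _ x) cQ).
  + exact: (closed_comp (fun x _ => @snd_continuous _ _ x) (open_closedC oQ0)).
  + by apply/seteqP; split => // tx _; have : setT tx.2 by []; rewrite -QC => -[]; [left|right].
  + apply: continuous_in_subspaceT => -[t x] /set_mem/= Qx.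
    apply: (@continuous_comp _ _ _ (fun tx : R * X => (tx.1, q tx.2)) H); last exact: cH.
    apply: continuous_pair_for; first exact: fst_continuous.
    apply: (@continuous_comp _ _ _ (@snd R X) q); first exact: snd_continuous.
    apply: (@continuous_comp _ _ _ (chart_coord c) (fun z => r^-1 *: (z - y))).
      by apply: chart_coord_cont; case: Qx => z /Ki/chart_imgP[? _] <-.
    apply: (@continuous_scale _ _ _ (fun=> r^-1) (fun z => z - y)).
      exact: cst_continuous.
    exact: shift_continuous.
  + apply: continuous_subspaceT; apply: comp_continuous cu; exact: snd_continuous.
  + move=> [t x] /= Qx nq; have [qK _] := qe x Qx.
    rewrite HB/=; first by rewrite eret qK.
    have [z zr zx] := Qbd x Qx nq.
    have zK : chart_img c z by apply: Ki => /=; rewrite zr.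
    have [_ ek] := chart_imgP zK.
    by rewrite -zx /q ek normrZ zr gtr0_norm ?invr_gt0// mulVf ?gt_eqF.
- move=> t x t0 /=; case: asboolP => // Qx; rewrite H0//= eret.
  by have [-> _] := qe x Qx.
- move=> t x t0 /=; rewrite /v; case: asboolP => // Qx; rewrite H1//= eret.
  by have [-> _] := qe x Qx.
- by [].
Qed.

End charts.

(** A replacement never destroys an equality u x = w x. Hence agreement on the boundaries still to
    come, and on the cubes already treated, survives every step; the last clause carries this
    through the induction. *)
Lemma replace_all_homotopy (R : realType) (X Y : topologicalType) (I : eqType)
    (Q D : I -> set X) (w : X -> Y) (s : seq I) :
  (forall (i : I) (u : X -> Y), i \in s -> continuous u -> (forall x, D i x -> u x = w x) ->
     let v x := if `[< Q i x >] then w x else u x in continuous v /\ homotopic R u v) ->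
  forall u : X -> Y, continuous u -> (forall i x, i \in s -> D i x -> u x = w x) ->
  exists v, [/\ homotopic R u v, forall i x, i \in s -> Q i x -> v x = w x &
    forall x, u x = w x -> v x = w x].
Proof.
elim: s => [|i s IH] step u cu uw.
  by exists u; split => //; exact: homotopic_rel_refl.
have [||cv uv] := step i u _ cu.
- by rewrite mem_head.
- by move=> x Dx; apply: (uw i) => //; rewrite mem_head.
set v := fun x => _ in cv uv.
have vw x : u x = w x -> v x = w x by rewrite /v; case: asboolP.
have [||v' [vv' v'Q v'w]] := IH _ v cv.
- by move=> j h js; apply: step; rewrite inE js orbT.
- by move=> j x js Dx; apply: vw; apply: (uw j) => //; rewrite inE js orbT.
exists v'; split.
- exact: homotopic_rel_trans uv vv'.
- move=> j x; rewrite inE => /orP[/eqP -> Qx|]; last exact: v'Q.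
  by apply: v'w; rewrite /v asboolT.
- by move=> x /vw; exact: v'w.
Qed.

(** * Short homotopies in N *)

(** Compactness is used in its near-covering form with the filter of all sufficiently large finite
    lists: what holds near each point for large lists holds on all of K for one list. *)
Lemma compact_sub_cover (T : topologicalType) (K : set T) (U : T -> set T) :
  compact K -> (forall p, K p -> open (U p)) -> (forall p, K p -> U p p) ->
  exists2 s : seq T, forall i, i \in s -> K i &
    forall p, K p -> exists2 i, i \in s & U i p.
Proof.
move=> /compact_near_coveringP cT oU Up.
pose B (s0 : seq T) := [set s : seq T | {subset s0 <= s}].
have FB : Filter (filter_from setT B).
  apply: filter_fromT_filter; first by exists [::].
  move=> s t; exists (s ++ t) => r sr.
  by split => x xs; apply: sr; rewrite mem_cat xs ?orbT.
have [p Kp|s _ sP] := cT _ _ (fun (s : seq T) p => exists2 i, i \in s & K i /\ U i p) FB.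
  exists (U p, B [:: p]) => /=.
    by split; [exact: open_nbhs_nbhs (conj (oU p Kp) (Up p Kp))|exists [:: p]].
  by move=> [x s] /= [Ux ps]; exists p; [apply: ps; rewrite mem_head|].
exists [seq i <- s | `[< K i >]] => [i|p Kp].
  by rewrite mem_filter => /andP[/asboolP].
have [|i si [Ki Ui]] := sP s _ p Kp; first by [].
by exists i => //; rewrite mem_filter si asboolT.
Qed.

Lemma compact_point_cover (T : topologicalType) (U : T -> set T) :
  compact [set: T] -> (forall p, open (U p)) -> (forall p, U p p) ->
  exists s : seq T, forall p, exists2 i, i \in s & U i p.
Proof.
move=> cT oU Up; have [//|//|s _ sP] := @compact_sub_cover T setT U cT.
by exists s => p; exact: sP.
Qed.

(** * Moving one point of N towards another inside one coordinate cube *)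

Section phase.
Context {R : realType} {N : topologicalType} {m : nat}.
Variables (c : @chart R N m) (y : 'rV[R]_m) (r : R).
Hypotheses (c_chart : is_chart c) (r_gt0 : 0 < r).
Hypothesis (sub_img : [set z | `|z - y| <= 3 * r] `<=` chart_img c).

Lemma cutoff_continuous (d : R) : continuous (cutoff y d).
Proof.
by move=> z; apply: (Ck_on_continuous openT (cutoff_smooth y d openT 0%N)).
Qed.

Let O : set N := chart_param c @` ball y (3 * r).

(** With both cutoffs, p starts to move only if both points lie in the cube of radius 2 r, and it
    reaches q at time 1 if both lie in the cube of radius r. This is what makes the extension by p
    continuous. *)
Definition phase_weight (t : R) (p q : N) : R :=
  clamp01 t * (cutoff y r (chart_coord c p) * cutoff y r (chart_coord c q)).

Definition phase (tpq : R * (N * N)) : N :=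
  let: (t, (p, q)) := tpq in
  if `[< O p /\ O q >] then chart_param c (chart_coord c p +
    phase_weight t p q *: (chart_coord c q - chart_coord c p)) else p.

Let ball_img : ball y (3 * r) `<=` chart_img c.
Proof. by move=> z; rewrite ball_rowE/= distrC => /ltW zr; exact: sub_img. Qed.

Let OE p : O p -> chart_dom c p /\ `|chart_coord c p - y| < 3 * r.
Proof.
rewrite /O chart_param_image//= => -[? /=]; rewrite ball_rowE/= => h; split => //.
by rewrite distrC.
Qed.

Let weight_itv t p q : 0 <= phase_weight t p q <= 1.
Proof.
have /andP[? ?] := clamp01_itv t.
have /andP[? ?] := cutoff_itv y r (chart_coord c p).
have /andP[? ?] := cutoff_itv y r (chart_coord c q).
by rewrite /phase_weight !mulr_ge0//= !mulr_ile1// mulr_ge0.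
Qed.

Let inner_lt (a b : 'rV[R]_m) (s d : R) : 0 <= s <= 1 -> `|a - y| < d -> `|b - y| < d ->
  `|a + s *: (b - a) - y| < d.
Proof.
move=> /andP[s0 s1] ay bY.
have -> : a + s *: (b - a) - y = (1 - s) *: (a - y) + s *: (b - y).
  by apply/rowP => i; rewrite !mxE; ring.
apply: (le_lt_trans (ler_normD _ _)); rewrite !normrZ (ger0_norm s0) ger0_norm ?subr_ge0//.
have [->|s0'] := eqVneq s 0; first by rewrite mul0r addr0 subr0 mul1r.
have sp : 0 < s by rewrite lt_def s0'.
nra.
Qed.

Lemma phase0 p q : phase (0, (p, q)) = p.
Proof.
rewrite /phase; case: asboolP => // -[Op Oq].
by rewrite /phase_weight clamp01_0 mul0r scale0r addr0 chart_coordK//; case: (OE Op).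
Qed.

Lemma phase_diag t q : phase (t, (q, q)) = q.
Proof.
rewrite /phase; case: asboolP => // -[Oq _].
by rewrite subrr scaler0 addr0 chart_coordK//; case: (OE Oq).
Qed.

Let in_cube p : (chart_param c @` ball y r) p ->
  O p /\ `|chart_coord c p - y| <= r.
Proof.
move=> [z]; rewrite ball_rowE/= => zr <-.
have z3 : ball y (3 * r) z.
  by rewrite ball_rowE/=; apply: (lt_trans zr); rewrite ltr_pMl// ltr1n.
split; first by exists z.
by have [_ ->] := chart_imgP c_chart (ball_img z3); rewrite distrC ltW.
Qed.

Lemma phase1 p q : (chart_param c @` ball y r) p -> (chart_param c @` ball y r) q ->
  phase (1, (p, q)) = q.
Proof.
move=> /in_cube[Op pr] /in_cube[Oq qr]; rewrite /phase asboolT//.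
rewrite /phase_weight clamp01_1 !cutoff_1// !mulr1 scale1r addrC subrK.
by rewrite chart_coordK//; case: (OE Oq).
Qed.

(** On the open set O x O the chart formula applies. A pair outside it has a point outside the
    closed set K, near which one cutoff vanishes and [phase] is the first projection. *)
Lemma phase_continuous : hausdorff_space N -> continuous phase.
Proof.
move=> hN [t [p q]].
have oO : open O by apply: chart_open_image => //; exact: ball_open.
pose K := chart_param c @` [set z | `|z - y| <= 2 * r].
have Ki : [set z | `|z - y| <= 2 * r] `<=` chart_img c.
  move=> z /= zr; apply: sub_img => /=; apply: (le_trans zr).
  by rewrite ler_pM2r// ler_nat.
have cK : closed K by apply: chart_compact_closed => //; exact: closed_cube_compact.
have cp : continuous (fun tpq : R * (N * N) => tpq.2.1).
  exact: (comp_continuous (@snd_continuous _ _) (@fst_continuous _ _)).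
have cq : continuous (fun tpq : R * (N * N) => tpq.2.2).
  exact: (comp_continuous (@snd_continuous _ _) (@snd_continuous _ _)).
have [[Op Oq]|nO] := pselect (O p /\ O q).
  pose F (x : R * (N * N)) := chart_param c (chart_coord c x.2.1 +
      phase_weight x.1 x.2.1 x.2.2 *: (chart_coord c x.2.2 - chart_coord c x.2.1)).
  apply: (@near_eq_continuous _ _ F).
    have n1 : \forall x \near (t, (p, q)), O x.2.1.
      exact: (cp (t, (p, q)) O (open_nbhs_nbhs (conj oO Op))).
    have n2 : \forall x \near (t, (p, q)), O x.2.2.
      exact: (cq (t, (p, q)) O (open_nbhs_nbhs (conj oO Oq))).
    apply: filterS2 n1 n2 => -[s [a b]] /= Oa Ob.
    by rewrite /F/= asboolT.
  have [dp py] := OE Op; have [dq qy] := OE Oq.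
  have ccp : {for (t, (p, q)), continuous (fun x : R * (N * N) => chart_coord c x.2.1)}.
    apply: (@continuous_comp _ _ _ (fun x : R * (N * N) => x.2.1) (chart_coord c)).
      exact: cp.
    exact: chart_coord_cont.
  have ccq : {for (t, (p, q)), continuous (fun x : R * (N * N) => chart_coord c x.2.2)}.
    apply: (@continuous_comp _ _ _ (fun x : R * (N * N) => x.2.2) (chart_coord c)).
      exact: cq.
    exact: chart_coord_cont.
  pose tri (x : R * (N * N)) := (x.1, (chart_coord c x.2.1, chart_coord c x.2.2)).
  pose F' (x : R * ('rV[R]_m * 'rV[R]_m)) : 'rV[R]_m := x.2.1 +
    (clamp01 x.1 * (cutoff y r x.2.1 * cutoff y r x.2.2)) *: (x.2.2 - x.2.1).
  apply: (@continuous_comp _ _ _ (F' \o tri) (chart_param c)); last first.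
    apply: chart_param_cont => //; apply: ball_img; rewrite ball_rowE/= distrC.
    by apply: inner_lt => //; exact: weight_itv.
  apply: continuous_comp.
    apply: continuous_pair_for; first exact: fst_continuous.
    exact: continuous_pair_for.
  have c1 : continuous (fun x : R * ('rV[R]_m * 'rV[R]_m) => x.2.1).
    exact: (comp_continuous (@snd_continuous _ _) (@fst_continuous _ _)).
  have c2 : continuous (fun x : R * ('rV[R]_m * 'rV[R]_m) => x.2.2).
    exact: (comp_continuous (@snd_continuous _ _) (@snd_continuous _ _)).
  suff : continuous F' by apply.
  apply: (continuous_add c1); apply: continuous_scale; last exact: (continuous_sub c2 c1).
  apply: continuous_mul.
    by apply: comp_continuous (@fst_continuous _ _) _; exact: continuous_clamp01.
  apply: continuous_mul.
    exact: (comp_continuous c1 (@cutoff_continuous r)).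
  exact: (comp_continuous c2 (@cutoff_continuous r)).
have FE s a b : ~ K a \/ ~ K b -> phase (s, (a, b)) = a.
  move=> nK; rewrite /phase; case: asboolP => // -[Oa Ob].
  have [da _] := OE Oa; have [db _] := OE Ob.
  have w0 x : chart_dom c x -> ~ K x -> cutoff y r (chart_coord c x) = 0.
    move=> dx nx; apply: cutoff_0 => //; rewrite leNgt; apply/negP => h; apply: nx.
    by exists (chart_coord c x); [exact: ltW|exact: chart_coordK].
  suff -> : phase_weight s a b = 0 by rewrite scale0r addr0 chart_coordK.
  by rewrite /phase_weight; case: nK => /w0 ->//; rewrite ?mul0r ?mulr0.
apply: (@near_eq_continuous _ _ (fun x => x.2.1)); last exact: cp.
have KO x : K x -> O x.
  move=> [z /= zr <-]; exists z => //; rewrite ball_rowE/= distrC.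
  by apply: (le_lt_trans zr); rewrite ltr_pM2r// ltr_nat.
have [Kp|nKp] := pselect (K p).
  have nKq : ~ K q by move=> Kq; apply: nO; split; exact: KO.
  have nq : \forall x \near (t, (p, q)), ~ K x.2.2.
    exact: (cq (t, (p, q)) _ (open_nbhs_nbhs (conj (closed_openC cK) nKq))).
  by apply: filterS nq => -[s [a b]] nb; rewrite FE//; right.
have np : \forall x \near (t, (p, q)), ~ K x.2.1.
  exact: (cp (t, (p, q)) _ (open_nbhs_nbhs (conj (closed_openC cK) nKp))).
by apply: filterS np => -[s [a b]] nb; rewrite FE//; left.
Qed.

End phase.

Section short_homotopy.
Context {R : realType} {m : nat}.
Variable N : riemData R m.
Hypothesis N_mfd : compact_riemannian N.

Record coord_cube := CoordCube { cc_chart : @chart R N m; cc_center : 'rV[R]_m; cc_radius : R }.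

Definition good_cube (a : coord_cube) : Prop :=
  [/\ atlas N (cc_chart a), 0 < cc_radius a &
      [set z | `|z - cc_center a| <= 3 * cc_radius a] `<=` chart_img (cc_chart a)].

Definition cube_image (a : coord_cube) : set N :=
  chart_param (cc_chart a) @` ball (cc_center a) (cc_radius a).

Lemma open_closed_cube n (U : set 'rV[R]_n) z : open U -> U z ->
  exists2 r : R, 0 < r & [set x | `|x - z| <= r] `<=` U.
Proof.
move=> oU Uz; have /nbhs_ballP[e /= e0 eU] := open_nbhs_nbhs (conj oU Uz).
exists (e / 2); first by rewrite divr_gt0.
move=> x /= xz; apply: eU; rewrite ball_rowE/= distrC; apply: (le_lt_trans xz).
by rewrite ltr_pdivrMr// ltr_pMr// ltr1n.
Qed.

Lemma good_cube_at p : exists a, good_cube a /\ cube_image a p.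
Proof.
have : setT p by []; rewrite -(mfd_cover N_mfd) => -[c ac dp].
have hc := mfd_chart N_mfd ac.
have oi : open (chart_img c) by case: hc.
have [e e0 eU] := open_closed_cube oi (chart_img_coord dp).
exists (CoordCube c (chart_coord c p) (e / 3)); split.
  split => //=; first by rewrite divr_gt0.
  by have -> : 3 * (e / 3) = e by field.
exists (chart_coord c p) => /=; first by apply: ballxx; rewrite divr_gt0.
exact: chart_coordK.
Qed.

Lemma open_cube_image a : good_cube a -> open (cube_image a).
Proof.
move=> [ac r0 Ki]; apply: (chart_open_image (mfd_chart N_mfd ac)).
  exact: ball_open.
move=> z; rewrite ball_rowE/= distrC => zr; apply: Ki; apply: (le_trans (ltW zr)).
by rewrite ler_pMl// ler1n.
Qed.

(** The phase F of a new cube is performed before the phases G already built. If both points are in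
    the new cube, F reaches q and G stays there, since it fixes the diagonal. Near a point of an
    earlier cube, F moves the pair to a pair still near the diagonal point, by continuity, and the
    induction hypothesis applies to it. *)
Lemma short_phases (I : eqType) (a : I -> coord_cube) (s : seq I) :
  (forall i, good_cube (a i)) ->
  exists G : R * (N * N) -> N, [/\ continuous G, forall p q, G (0, (p, q)) = p,
    forall t q, G (t, (q, q)) = q &
    forall i q0, i \in s -> cube_image (a i) q0 ->
      \forall pq \near (q0, q0), G (1, pq) = pq.2].
Proof.
move=> ga; elim: s => [|i s [G [cG G0 Gd G1]]].
  exists (fun x => x.2.1); split => //.
  exact: (comp_continuous (@snd_continuous _ _) (@fst_continuous _ _)).
have [ac r0 Ki] := ga i; have hc := mfd_chart N_mfd ac.
pose F := phase (cc_chart (a i)) (cc_center (a i)) (cc_radius (a i)).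
have cF : continuous F by apply: phase_continuous => //; exact: mfd_hausdorff N_mfd.
have Fd t q : F (t, (q, q)) = q by exact: phase_diag.
exists (fun x => G (x.1, (F x, x.2.2))); split.
- apply: comp_continuous cG; apply: continuous_pair; first exact: fst_continuous.
  apply: continuous_pair cF _.
  exact: (comp_continuous (@snd_continuous _ _) (@snd_continuous _ _)).
- by move=> p q; rewrite G0; exact: phase0.
- by move=> t q; rewrite Fd Gd.
- move=> j q0; rewrite inE => /orP[/eqP -> qk|js qk].
    have oa : open (cube_image (a i)) by exact: open_cube_image.
    have n1 : \forall pq \near (q0, q0), cube_image (a i) pq.1.
      exact: (@fst_continuous N N (q0, q0) _ (open_nbhs_nbhs (conj oa qk))).
    have n2 : \forall pq \near (q0, q0), cube_image (a i) pq.2.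
      exact: (@snd_continuous N N (q0, q0) _ (open_nbhs_nbhs (conj oa qk))).
    apply: filterS2 n1 n2 => -[p q] Op Oq.
    have -> : F (1, (p, q)) = q by exact: phase1.
    exact: Gd.
  have cf : continuous (fun pq : N * N => (F (1, pq), pq.2)).
    apply: continuous_pair; last exact: snd_continuous.
    apply: comp_continuous cF; apply: continuous_pair; first exact: cst_continuous.
    exact: id_continuous.
  have fq : (F (1, (q0, q0)), q0) = (q0, q0) by rewrite Fd.
  have nG : nbhs (F (1, (q0, q0)), q0) [set pq | G (1, pq) = pq.2].
    by rewrite fq; exact: (G1 j q0 js qk).
  exact: (cf (q0, q0) _ nG).
Qed.

(* Move inside one coordinate cube after the other. *)
Lemma short_homotopy k (iota : N -> 'rV[R]_k) : isometric_embedding iota ->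
  exists (G : R * (N * N) -> N) (d : R), [/\ continuous G, 0 < d,
    forall p q, G (0, (p, q)) = p, forall t q, G (t, (q, q)) = q &
    forall p q, `|iota p - iota q| <= d -> G (1, (p, q)) = q].
Proof.
move=> emb; have ci := emb_continuous emb.
have [a aP] := choice good_cube_at.
have [p|p|s sP] := @compact_point_cover N (fun p => cube_image (a p)) (mfd_compact N_mfd).
- by apply: open_cube_image; case: (aP p).
- by case: (aP p).
have [|G [cG G0 Gd G1]] := short_phases s (a := a); first by move=> p; case: (aP p).
(* [A] is an open neighbourhood of the diagonal. On its compact complement the distance of the
   embedded points is positive, hence bounded below. *)
pose A := [set pq : N * N | G (1, pq) = pq.2]°.
have Aq q : A (q, q) by have [i si iq] := sP q; exact: (G1 i).
have cA : compact (~` A).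
  rewrite -[~` A]setTI; apply: compact_closedI.
    by rewrite -setXTT; apply: compact_setX; exact: (mfd_compact N_mfd).
  by apply: open_closedC; exact: open_interior.
pose h (pq : N * N) := `|iota pq.1 - iota pq.2|.
have ch : continuous h.
  apply: continuous_norm; apply: continuous_sub.
    exact: comp_continuous (@fst_continuous _ _) ci.
  exact: comp_continuous (@snd_continuous _ _) ci.
have h0 pq : (~` A) pq -> 0 < h pq.
  case: pq => p q nA; rewrite /h normr_gt0 subr_eq0; apply/eqP => /(emb_inj emb)/= pq.
  by apply: nA; rewrite pq; exact: Aq.
have [|C C0 CP] := @compact_fun_bounded R _ (~` A) (fun pq => (h pq)^-1) cA.
  apply: continuous_in_subspaceT => pq /set_mem nA.
  by apply: cvgV; [rewrite gt_eqF// h0|exact: ch].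
(* The lower bound C^-1 may be attained, and the distance hypothesis is a weak inequality, so half
   of it is taken. *)
exists G, (C^-1 / 2); split => //; first by rewrite divr_gt0// invr_gt0.
move=> p q pq; have [Apq|nA] := pselect (A (p, q)).
  exact: (interior_subset Apq).
have := CP _ nA; rewrite ger0_norm ?invr_ge0 ?(ltW (h0 _ nA))// => hC.
have : C^-1 <= h (p, q) by rewrite -[h _]invrK lef_pV2 ?posrE ?invr_gt0 ?h0.
rewrite leNgt => /negP; case; apply: (le_lt_trans pq).
by rewrite ltr_pdivrMr// ltr_pMr ?invr_gt0// ltr1n.
Qed.

End short_homotopy.

(** * Well-defined homotopy classes *)

Lemma open_chart_preimage (R : realType) (X : topologicalType) n (c : @chart R X n)
    (W : set X) : is_chart c -> open W -> open (chart_coord c @` (chart_dom c `&` W)).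
Proof.
move=> hc oW.
have -> : chart_coord c @` (chart_dom c `&` W) = chart_img c `&` chart_param c @^-1` W.
  apply/seteqP; split => [_ [x [dx Wx] <-]|z [iz Wz]].
    by split; [exact: chart_img_coord|rewrite /= chart_coordK].
  by have [dz ez] := chart_imgP hc iz; exists (chart_param c z).
rewrite openE => z [iz Wz]; apply: filterI.
  by apply: open_nbhs_nbhs; split => //; case: hc.
by apply: (chart_param_cont hc iz); apply: open_nbhs_nbhs.
Qed.

Lemma smooth_map_emb (R : realType) n m k (M : riemData R n) (N : riemData R m)
    (iota : N -> 'rV[R]_k) (u : M -> N) (c : chart M n) :
  compact_riemannian M -> compact_riemannian N -> isometric_embedding iota ->
  smooth_map u -> atlas M c -> smooth_on (chart_img c) (fun z => iota (u (chart_param c z))).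
Proof.
move=> M_mfd N_mfd emb [cu su] ac r; have hc := mfd_chart M_mfd ac.
have oi : open (chart_img c) by case: hc.
apply: Ck_on_local => // z iz; have [dz ez] := chart_imgP hc iz.
have : setT (u (chart_param c z)) by [].
rewrite -(mfd_cover N_mfd) => -[d ad dd]; have hd := mfd_chart N_mfd ad.
have od : open (chart_dom d) by case: hd.
have oid : open (chart_img d) by case: hd.
set W := chart_coord c @` (chart_dom c `&` u @^-1` chart_dom d).
have oW : open W.
  apply: open_chart_preimage => //.
  by move/continuousP: cu; apply.
exists W; split => //; first by exists (chart_param c z).
have WE y : W y -> chart_dom d (u (chart_param c y)).
  by move=> [x [dx ux] <-]; rewrite chart_coordK.
have := Ck_on_comp oW oid _ (emb_smooth emb ad r) (su c d ac ad r).
move=> H; apply: Ck_on_eq oW _ (H _) => y Wy /=.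
  by rewrite chart_coordK//; exact: WE.
by apply: chart_img_coord; exact: WE.
Qed.

Lemma W1P_norm_ge0 (R : realType) n (P : R -> R) (V : set 'rV[R]_n) f : (0 <= W1P_norm P V f)%E.
Proof.
apply: adde_ge0; first by apply: integral_ge0 => x _; rewrite lee_fin.
by apply: sume_ge0 => i _; exact: luxemburg_ge0.
Qed.

Lemma W1P_normM_lt (R : realType) n (M : riemData R n) (C : coord_cover M) (P : R -> R) k
    (u : M -> 'rV[R]_k) e j a : (W1P_normM C P u < e)%E ->
  (W1P_norm P (@cover_patch _ _ _ C j)
     (fun y => u (chart_param (@cover_chart _ _ _ C j) y) ord0 a) < e)%E.
Proof.
apply: le_lt_trans; rewrite /W1P_normM (bigD1 j)// (bigD1 a)//= -addeA.
apply: leeDl; apply: adde_ge0; apply: sume_ge0 => i _; first exact: W1P_norm_ge0.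
by apply: sume_ge0 => l _; exact: W1P_norm_ge0.
Qed.

Section part_a.
Context {R : realType} {n m k : nat}.
Variables (M : riemData R n) (N : riemData R m) (iota : N -> 'rV[R]_k) (P : R -> R).
Hypotheses (n_ge2 : (2 <= n)%N) (M_mfd : compact_riemannian M) (N_mfd : compact_riemannian N).
Hypotheses (iota_emb : isometric_embedding iota) (P_young : young_function P).
Hypothesis P_iv : exists2 alpha : R, n%:R - 1 < alpha &
       forall s t, 0 < s -> s <= t -> s `^ (- alpha) * P s <= t `^ (- alpha) * P t.

Lemma homotopy_classes_well_defined : pi_trivial R n N ->
  forall (C : coord_cover M) (u : M -> 'rV[R]_k), in_W1PMN C P iota u ->
    exists2 e : R, 0 < e &
      forall u1 u2 : M -> N, smooth_map u1 -> smooth_map u2 ->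
        (W1P_normM C P (fun x => u x - iota (u1 x))%R < e%:E)%E ->
        (W1P_normM C P (fun x => u x - iota (u2 x))%R < e%:E)%E ->
        homotopic R u1 u2.
Proof.
move=> triv C u [uW _].
have [alpha n_alpha P_alpha] := P_iv.
have n0 : (0 < n)%N by exact: leq_trans n_ge2.
have alpha1 : 1 <= alpha.
  apply: ltW; apply: le_lt_trans n_alpha; rewrite lerBrDr.
  by have : 2%:R <= n%:R :> R by rewrite ler_nat.
pose ch j := @cover_chart _ _ _ C j; pose V j := @cover_patch _ _ _ C j.
have hch j : is_chart (ch j) by apply: (mfd_chart M_mfd); exact: cover_atlas.
have oV j : open (V j) by exact: cover_open.
have Vi j : V j `<=` chart_img (ch j).
  by apply: subset_trans (@cover_sub _ _ _ C j); exact: subset_closure.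
(* The factor 3 leaves room for a boundary at radius between r and 2 r and for cubes of radius up to
   r about its points. *)
have atp (p : M) : exists jzr : 'I_(cover_size C) * 'rV[R]_n * R,
    [/\ 0 < jzr.2, chart_param (ch jzr.1.1) jzr.1.2 = p &
        [set z | `|z - jzr.1.2| <= 3 * jzr.2] `<=` V jzr.1.1].
  have : setT p by []; rewrite -(cover_all C) => -[j _ [z Vz zp]].
  have [e e0 eV] := open_closed_cube (oV j) Vz.
  exists (j, z, e / 3) => /=; split => //; first by rewrite divr_gt0.
  by have -> : 3 * (e / 3) = e by field.
have [c cP] := choice atp.
pose J p := (c p).1.1; pose Z p := (c p).1.2; pose r p := (c p).2.
have r0 p : 0 < r p by case: (cP p).
have pZ p : chart_param (ch (J p)) (Z p) = p by case: (cP p).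
have KV p : [set z | `|z - Z p| <= 3 * r p] `<=` V (J p) by case: (cP p).
pose U p : set M := chart_param (ch (J p)) @` ball (Z p) (r p).
have [p|p|s sP] := @compact_point_cover M U (mfd_compact M_mfd).
- apply: (chart_open_image (hch (J p))); first exact: ball_open.
  move=> z; rewrite ball_rowE/= distrC => zr; apply/Vi/KV => /=.
  by apply: (le_trans (ltW zr)); rewrite ler_pMl// ler1n.
- by exists (Z p) => //; exact: ballxx.
have cst (p : M) := small_on_cube_boundary P_young alpha1 P_alpha n0 n_alpha k (r0 p) (oV (J p)) (KV p).
pose B p := s2val (cid2 (cst p)).
have B0 p : 0 < B p := s2valP (cid2 (cst p)).
have BP p := s2valP' (cid2 (cst p)); rewrite -/(B _) in BP.
have [G [d [cG d0 G0 _ G1]]] := short_homotopy N_mfd iota_emb.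
pose S := \sum_(p <- s) B p.
have BS p : p \in s -> B p <= S.
  move=> ps; rewrite /S (big_rem p)//= lerDl; apply: sumr_ge0 => q _; exact: ltW.
have S0 : 0 <= S by apply: sumr_ge0 => q _; exact: ltW.
(* [sobolev_close] yields kappa = 2 e, so the boundary estimate becomes B p * (2 e) = d * B p / (S +
   1) <= d, uniformly over the finite cover. *)
pose e := d / (2 * (S + 1)).
have e0 : 0 < e by rewrite divr_gt0// mulr_gt0// ltr_wpDl.
exists e => // u1 u2 s1 s2 W1 W2.
have c1 : continuous u1 by case: s1.
have c2 : continuous u2 by case: s2.
pose g i (j : 'I_(cover_size C)) (a : 'I_k) (z : 'rV[R]_n) :=
  iota ((if i is true then u2 else u1) (chart_param (ch j) z)) ord0 a.
have Vg i j a : Ck_on 1 (V j) (g i j a).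
  apply: Ck_on_row_coord => //.
  apply: (Ck_on_sub (oV j) (Vi j)); first by case: (hch j).
  have sm : smooth_map (if i is true then u2 else u1) by case: (i).
  exact: (smooth_map_emb M_mfd N_mfd iota_emb sm (@cover_atlas _ _ _ C j) 1%N).
have Wg i j a : (W1P_norm P (V j) (fun z => u (chart_param (ch j) z) ord0 a - g i j a z)%R < e%:E)%E.
  rewrite (_ : (fun z => _) = fun y => (fun x => u x - iota ((if i is true then u2 else u1) x))
    (chart_param (@cover_chart _ _ _ C j) y) ord0 a); last first.
    by apply/funext => z; rewrite !mxE.
  apply: (@W1P_normM_lt _ _ _ C P k
    (fun x => u x - iota ((if i is true then u2 else u1) x)) e%:E j a).
  case: i; [exact: W2|exact: W1].
have wu j a : weakly_differentiable (V j) (fun z => u (chart_param (ch j) z) ord0 a).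
  by case: (uW j a).
have e20 : 0 < 2 * e by rewrite mulr_gt0.
have rad p : exists rho : R, [/\ r p <= rho, rho <= 2 * r p &
    p \in s -> forall z, `|z - Z p| = rho ->
    `|iota (u1 (chart_param (ch (J p)) z)) - iota (u2 (chart_param (ch (J p)) z))| <= d].
  have close a := sobolev_close P_young e0 (oV (J p)) (wu (J p) a) (Vg false (J p) a)
    (Vg true (J p) a) (Wg false (J p) a) (Wg true (J p) a).
  have Vd a : Ck_on 1 (V (J p)) (fun z => g true (J p) a z - g false (J p) a z).
    have := Ck_onD (oV (J p)) (Vg true (J p) a)
      (Ck_onM (oV (J p)) (Ck_on_cst 1 (-1 : R)%R (oV (J p))) (Vg false (J p) a)).
    by apply: Ck_on_eq => // x _ /=; rewrite mulN1r.
  have [rho /andP[rr1 rr2] rhoP] := BP p (2 * e)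
    (fun a z => g true (J p) a z - g false (J p) a z) e20 Vd
    (fun a => (close a).1) (fun a => (close a).2).
  exists rho; split => // ps z zr; rewrite distrC.
  apply/row_norm_leP; first exact: ltW.
  move=> a; have := rhoP z zr a; rewrite /g !mxE => h; apply: (le_trans h).
  have -> : B p * (2 * e) = d * (B p / (S + 1)).
    by rewrite /e; field; rewrite gt_eqF// ltr_wpDl.
  rewrite ler_piMr ?(ltW d0)// ler_pdivrMr ?ltr_wpDl// mul1r.
  by apply: (le_trans (BS p ps)); rewrite lerDl.
have [rho rhoP] := choice rad.
(* Closeness on the boundaries becomes equality: at time 1 the short homotopy has reached u2 exactly
   wherever the two maps are within d. *)
pose v1 x := G (1, (u1 x, u2 x)).
have cv1 : continuous v1.
  apply: comp_continuous cG; apply: continuous_pair; first exact: cst_continuous.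
  exact: continuous_pair.
have hom1 : homotopic R u1 v1.
  exists (fun tx => G (tx.1, (u1 tx.2, u2 tx.2))); split => //.
  apply: continuous_subspaceT; apply: comp_continuous cG.
  apply: continuous_pair; first exact: fst_continuous.
  by apply: continuous_pair; apply: comp_continuous (@snd_continuous _ _) _.
pose Q p : set M := chart_param (ch (J p)) @` [set z | `|z - Z p| <= rho p].
pose D p : set M := chart_param (ch (J p)) @` [set z | `|z - Z p| = rho p].
have [p v ps cv vw|p x ps [z zr <-]|v [v1v vQ _]] :=
    @replace_all_homotopy R M N M Q D u2 s _ v1 cv1.
- have [rr1 rr2 _] := rhoP p.
  apply: (chart_replace_homotopy (hch (J p)) n0 (mfd_hausdorff M_mfd) triv) => //.
  + exact: lt_le_trans rr1.
  + move=> z /= zr; apply/Vi/KV => /=; apply: (le_trans zr); apply: (le_trans rr2).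
    by rewrite ler_pM2r// ler_nat.
  + by move=> z zr; apply: vw; exists z.
- by have [_ _ /(_ ps z zr) h] := rhoP p; rewrite /v1 G1.
(* As rho p >= r p, the cubes [Q p] contain the sets [U p] that cover M, so after all replacements
   nothing of u1 is left. *)
have -> : u2 = v.
  apply/funext => x; have [p ps [z zr zx]] := sP x; apply/esym/(vQ p x ps).
  exists z => //=; move: zr; rewrite ball_rowE/= distrC => /ltW zr.
  by apply: (le_trans zr); case: (rhoP p).
exact: homotopic_rel_trans hom1 v1v.
Qed.

End part_a.

(** * Smoothing *)

(** Finitely many values of g are averaged with a partition of unity made of bumps; at each point
    only centres where g differs by less than d have positive weight. Normalization is possible on
    the open set A where the sum of the bumps is positive. *)
Lemma smooth_approx (R : realType) n m (K : set 'rV[R]_n) (g : 'rV[R]_n -> 'rV[R]_m) (d : R) :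
  compact K -> (forall z, K z -> {for z, continuous g}) -> 0 < d ->
  exists A a, [/\ open A, K `<=` A, smooth_on A a & forall z, K z -> `|a z - g z| <= d].
Proof.
move=> cK cg d0.
have epsP z : exists e : R, 0 < e /\ (K z -> forall x, `|x - z| < e -> `|g z - g x| < d).
  have [Kz|nK] := pselect (K z); last by exists 1; split.
  have /cvgrPdist_lt/(_ _ d0)/nbhs_ballP[e /= e0 eP] := cg z Kz.
  by exists e; split => // _ x xz; apply: eP; rewrite ball_rowE/= distrC.
have [e eP] := choice epsP.
have e0 z : 0 < e z by case: (eP z).
have [z _|z _|s sK sP] := @compact_sub_cover _ K (fun z => ball z (e z)) cK.
- exact: ball_open.
- exact: ballxx.
pose c (l : 'I_(size s)) := nth 0 s l.
have cs l : K (c l) by apply: sK; exact: mem_nth.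
pose b l x := cube_bump (c l) (e (c l)) x.
pose S x := \sum_l b l x.
pose A : set 'rV[R]_n := [set x | 0 < S x].
have b0 l x : 0 <= b l x by exact: cube_bump_ge0.
have bT l r : Ck_on r setT (b l) by exact: cube_bump_smooth openT r.
have ST r : Ck_on r setT S by exact: Ck_on_sum openT (fun l => bT l r).
have oA : open A.
  have cS : continuous S by move=> x; exact: (Ck_on_continuous openT (ST 0%N)).
  by move/continuousP: cS => /(_ [set t : R | 0 < t]); apply; exact: open_gt.
have KA : K `<=` A.
  move=> z Kz; have [i si] := sP z Kz; rewrite ball_rowE/= distrC => zi.
  have hi : (index i s < size s)%N by rewrite index_mem.
  rewrite /A/= /S (bigD1 (Ordinal hi))//= ltr_wpDr//; first exact: sumr_ge0.
  by apply/cube_bump_gt0 => //; rewrite /c /= nth_index.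
pose a x : 'rV[R]_m := \row_j ((S x)^-1 * \sum_l b l x * g (c l) ord0 j).
exists A, a; split => //.
- move=> r; apply: Ck_on_row => // j.
  apply: (@Ck_on_eq _ _ _ r A (fun x => (S x)^-1 * \sum_l b l x * g (c l) ord0 j)) => //.
    by move=> x _; rewrite mxE.
  apply: (@Ck_onM _ _ r A (fun x => (S x)^-1) (fun x => \sum_l b l x * g (c l) ord0 j)) => //.
    by apply: Ck_onV => // [x Ax|]; [rewrite gt_eqF|exact: (Ck_on_sub oA _ openT (ST r))].
  apply: Ck_on_sum => // l; apply: (@Ck_onM _ _ r A (b l) (cst (g (c l) ord0 j))) => //.
    exact: (Ck_on_sub oA _ openT (bT l r)).
  exact: Ck_on_cst.
- move=> z Kz; apply/row_norm_leP; first exact: ltW.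
  move=> j; rewrite !mxE; have Sz : 0 < S z by exact: KA.
  have -> : (S z)^-1 * (\sum_l b l z * g (c l) ord0 j) - g z ord0 j =
      (S z)^-1 * \sum_l b l z * (g (c l) ord0 j - g z ord0 j).
    under [in RHS]eq_bigr do rewrite mulrBr.
    by rewrite sumrB -mulr_suml -/(S z) mulrBr mulKf// gt_eqF.
  rewrite normrM normfV (gtr0_norm Sz) [X in X <= _]mulrC ler_pdivrMr//.
  apply: (le_trans (ler_norm_sum _ _ _)); rewrite mulr_sumr; apply: ler_sum => l _.
  rewrite normrM ger0_norm// [leRHS]mulrC.
  have [zl|zl] := ltP `|z - c l| (e (c l)).
    apply: ler_wpM2l => //; have [_ /(_ (cs l) z zl) h] := eP (c l).
    by apply: le_trans (ltW h); have := row_coord_le (g (c l) - g z) j; rewrite !mxE.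
  by rewrite /b cube_bump_eq0// !mul0r.
Qed.

Lemma filter_all_seq (T : Type) (I : eqType) (F : set_system T) (s : seq I) (Q : I -> set T) :
  Filter F -> (forall i, i \in s -> F (Q i)) -> F [set x | forall i, i \in s -> Q i x].
Proof.
move=> FF; elim: s => [|i s IH] H; first by apply: filterS filterT => x _ i.
have H1 := H i (mem_head _ _).
have H2 := IH (fun j js => H j (mem_behead (s := i :: s) js)).
by apply: filterS2 H1 H2 => x Qi Qs j; rewrite inE => /orP[/eqP ->|/Qs].
Qed.

(** * Local smoothness of maps from R^n to N *)

Section smooth_at.
Context {R : realType} {n m : nat}.
Variable N : riemData R m.
Hypothesis N_mfd : compact_riemannian N.
Implicit Types (F : 'rV[R]_n -> N) (z : 'rV[R]_n).

(** A pointwise notion with a single chart of the target, convenient for local modification;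
    [smooth_at_chart] shows that any other chart around the image will do. *)
Definition smooth_at F z := exists d V, [/\ atlas N d, open V, V z,
  forall x, V x -> chart_dom d (F x) /\ {for x, continuous F} &
  smooth_on V (chart_coord d \o F)].

Lemma smooth_at_continuous F z : smooth_at F z -> {for z, continuous F}.
Proof. by move=> [d [V [_ _ Vz H _]]]; have [] := H z Vz. Qed.

Lemma smooth_at_chart F z d' : smooth_at F z -> atlas N d' -> chart_dom d' (F z) ->
  exists V, [/\ open V, V z, forall x, V x -> chart_dom d' (F x) &
    smooth_on V (chart_coord d' \o F)].
Proof.
move=> [d [V [ad oV Vz VF sV]]] ad' dz.
have hd := mfd_chart N_mfd ad; have hd' := mfd_chart N_mfd ad'.
have od' : open (chart_dom d') by case: hd'.
pose W := V `&` F @^-1` chart_dom d'.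
have oW : open W.
  rewrite openE => x [Vx dx]; apply: filterI; first exact: open_nbhs_nbhs.
  by have [_ cF] := VF x Vx; apply: cF; exact: open_nbhs_nbhs.
exists W; split => //; first by move=> x [].
have oT : open (transition_dom d d') by exact: open_chart_preimage.
move=> r; have sW : Ck_on r W (chart_coord d \o F).
  by apply: (Ck_on_sub oW _ oV (sV r)) => x [].
have TW x : W x -> transition_dom d d' ((chart_coord d \o F) x).
  by move=> [Vx dx]; exists (F x) => //; split => //; have [] := VF x Vx.
apply: Ck_on_eq oW _ (Ck_on_comp oW oT TW (mfd_smooth N_mfd ad ad' r) sW) => x [Vx _].
by rewrite /transition/= chart_coordK//; have [] := VF x Vx.
Qed.

Lemma smooth_at_eq F G z V : open V -> V z -> (forall x, V x -> F x = G x) ->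
  smooth_at F z -> smooth_at G z.
Proof.
move=> oV Vz FG [d [W [ad oW Wz WF sW]]].
have oVW : open (V `&` W) by exact: openI.
exists d, (V `&` W); split => //.
- move=> x [Vx Wx]; have [dF cF] := WF x Wx; rewrite -FG//; split => //.
  apply: near_eq_continuous cF.
  by apply: filterS (open_nbhs_nbhs (conj oV Vx)) => y; exact: FG.
- move=> r; apply: (Ck_on_eq oVW _ (Ck_on_sub oVW _ oW (sW r))) => [x [Vx _]|x []//].
  by rewrite /= FG.
Qed.

Lemma smooth_at_param d (g : 'rV[R]_n -> 'rV[R]_m) z V : atlas N d -> open V -> V z ->
  (forall x, V x -> chart_img d (g x)) -> smooth_on V g -> smooth_at (chart_param d \o g) z.
Proof.
move=> ad oV Vz gi sg; have hd := mfd_chart N_mfd ad; exists d, V; split => //.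
- move=> x Vx; have [dx _] := chart_imgP hd (gi x Vx); split => //.
  apply: continuous_comp; first exact: (Ck_on_continuous oV (sg 0%N)).
  exact: chart_param_cont (gi x Vx).
- move=> r; apply: (Ck_on_eq oV _ (sg r)) => x Vx /=.
  by have [_ ->] := chart_imgP hd (gi x Vx).
Qed.

Lemma smooth_at_cst (p : N) z : smooth_at (cst p) z.
Proof.
have : setT p by []; rewrite -(mfd_cover N_mfd) => -[d ad dp].
exists d, setT; split => //; first exact: openT.
  by move=> x _; split => //; exact: cst_continuous.
by move=> r; apply: (Ck_on_cst r (chart_coord d p)); exact: openT.
Qed.

Lemma smooth_at_comp F (h : 'rV[R]_n -> 'rV[R]_n) z V : open V -> V z -> smooth_on V h ->
  smooth_at F (h z) -> smooth_at (F \o h) z.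
Proof.
move=> oV Vz sh [d [W [ad oW Wz WF sW]]].
have ch x : V x -> {for x, continuous h} by exact: (Ck_on_continuous oV (sh 0%N)).
have oU : open (V `&` h @^-1` W).
  rewrite openE => x [Vx Wx]; apply: filterI; first exact: open_nbhs_nbhs.
  by apply: (ch x Vx); exact: open_nbhs_nbhs.
exists d, (V `&` h @^-1` W); split => //.
- move=> x [Vx Wx]; have [dx cF] := WF _ Wx; split => //.
  by apply: continuous_comp; [exact: ch|exact: cF].
- move=> r; have := Ck_on_comp oU oW _ (sW r) (Ck_on_sub oU _ oV (sh r)).
  by apply => x [].
Qed.

Lemma smooth_at_emb k (iota : N -> 'rV[R]_k) F z : isometric_embedding iota -> smooth_at F z ->
  exists V, [/\ open V, V z & smooth_on V (iota \o F)].
Proof.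
move=> emb [d [V [ad oV Vz VF sV]]]; have hd := mfd_chart N_mfd ad.
have oi : open (chart_img d) by case: hd.
exists V; split => // r.
apply: (Ck_on_eq oV _ (Ck_on_comp oV oi _ (emb_smooth emb ad r) (sV r))) => x Vx /=.
  by rewrite chart_coordK//; have [] := VF x Vx.
by apply: chart_img_coord; have [] := VF x Vx.
Qed.

End smooth_at.

Section smoothing_step.
Context {R : realType} {n m : nat}.
Variable N : riemData R m.
Hypothesis N_mfd : compact_riemannian N.
Variables (I : eqType) (s : seq I) (zc : I -> 'rV[R]_n) (rc : I -> R) (a : I -> coord_cube N).
Hypotheses (rc_gt0 : forall j, 0 < rc j) (a_good : forall j, good_cube (a j)).

Definition cube_adapted (F : 'rV[R]_n -> N) : Prop :=
  forall j, j \in s -> forall z, `|z - zc j| <= 3 * rc j -> cube_image (a j) (F z).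

(** In target coordinates g becomes g + chi (f - g), with f a smooth approximation and chi a cutoff
    equal to 1 on the cube of radius r. Where F is already smooth, so is this combination, hence
    earlier progress is kept. A close enough f preserves [cube_adapted], which supplies the target
    coordinates for the remaining cubes. *)
Lemma smoothing_step F i : i \in s -> continuous F -> cube_adapted F ->
  exists F', [/\ continuous F', cube_adapted F',
    homotopic_rel R setT [set z | 2 * rc i <= `|z - zc i|] F F',
    forall z, `|z - zc i| < rc i -> smooth_at F' z &
    forall z, smooth_at F z -> smooth_at F' z].
Proof.
move=> si cF adF.
have [] := a_good i; set d := cc_chart (a i); set w := cc_center (a i).
set rho := cc_radius (a i) => ad rho0 Ki; have hd := mfd_chart N_mfd ad.
set z0 := zc i; set r := rc i; have r0 : 0 < r by exact: rc_gt0.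
have ballD z : `|z - w| < rho -> chart_img d z.
  move=> zw; apply: Ki; apply: (le_trans (ltW zw)).
  by rewrite ler_pMl// ler1n.
pose g z := chart_coord d (F z).
have FO z : `|z - z0| <= 3 * r -> chart_dom d (F z) /\ `|g z - w| < rho.
  move=> zr; have [x xw xF] := adF i si z zr.
  have xw' : `|x - w| < rho by move: xw; rewrite ball_rowE/= distrC.
  by have [dx ex] := chart_imgP hd (ballD x xw'); rewrite /g -xF ex.
have cg z : `|z - z0| <= 3 * r -> {for z, continuous g}.
  move=> zr; apply: continuous_comp; first exact: cF.
  by apply: chart_coord_cont => //; case: (FO z zr).
have gK z : `|z - z0| <= 3 * r -> chart_param d (g z) = F z.
  by move=> zr; apply: chart_coordK => //; case: (FO z zr).
pose chi := cutoff z0 r.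
have cchi : continuous chi by exact: cutoff_continuous.
have chi01 z : 0 <= chi z <= 1 by exact: cutoff_itv.
have chi_out z : 2 * r <= `|z - z0| -> chi z = 0 by exact: cutoff_0.
pose K : set 'rV[R]_n := [set z | `|z - z0| <= 2 * r].
have cK : compact K by exact: closed_cube_compact.
have K3 z : K z -> `|z - z0| <= 3 * r.
  by move=> Kz; apply: (le_trans Kz); rewrite ler_pM2r// ler_nat.
pose Psi (zb : 'rV[R]_n * 'rV[R]_m) := chart_param d (g zb.1 + chi zb.1 *: zb.2).
(* Admissible displacements [b] of g z: the point stays in the target cube and in every target cube
   prescribed by [cube_adapted]. These are open conditions at b = 0, and compactness of K yields one
   bound [dl] for all z. *)
pose Pr (b : 'rV[R]_m) (z : 'rV[R]_n) := `|g z - w| + `|b| < rho /\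
  forall j, j \in s -> `|z - zc j| <= 3 * rc j -> cube_image (a j) (Psi (z, b)).
have [dl dl0 dlP] : exists2 dl : R, 0 < dl & forall b, `|b| < dl -> forall z, K z -> Pr b z.
  have /compact_near_coveringP ncK := cK.
  have H : \forall b \near (0 : 'rV[R]_m), K `<=` Pr b.
    apply: (ncK _ (nbhs (0 : 'rV[R]_m)) Pr (nbhs_filter (0 : 'rV[R]_m))) => z Kz.
    have cg1 : {for (z, 0 : 'rV[R]_m), continuous (fun zb : 'rV[R]_n * 'rV[R]_m => g zb.1)}.
      by apply: continuous_comp; [exact: fst_continuous|exact/cg/K3].
    have c2 : continuous (fun zb : 'rV[R]_n * 'rV[R]_m => zb.2) by exact: snd_continuous.
    have n1 : \forall zb \near (z, 0 : 'rV[R]_m), `|g zb.1 - w| + `|zb.2| < rho.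
      have cq : {for (z, 0 : 'rV[R]_m),
          continuous (fun zb : 'rV[R]_n * 'rV[R]_m => `|g zb.1 - w| + `|zb.2|)}.
        apply: (@continuous_comp _ _ _ (fun zb : 'rV[R]_n * 'rV[R]_m => (g zb.1, zb.2))
          (fun xb : 'rV[R]_m * 'rV[R]_m => `|xb.1 - w| + `|xb.2|)).
          by apply: continuous_pair_for; [exact: cg1|exact: c2].
        suff : continuous (fun xb : 'rV[R]_m * 'rV[R]_m => `|xb.1 - w| + `|xb.2|) by apply.
        apply: continuous_add; apply: continuous_norm; last exact: snd_continuous.
        by apply: continuous_sub; [exact: fst_continuous|exact: cst_continuous].
      apply: (cq [set t : R | t < rho]); apply: open_nbhs_nbhs; split; first exact: open_lt.
      by rewrite /= normr0 addr0; case: (FO z (K3 z Kz)).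
    have n2 : \forall zb \near (z, 0 : 'rV[R]_m), forall j, j \in s ->
        `|zb.1 - zc j| <= 3 * rc j -> cube_image (a j) (Psi zb).
      apply: filter_all_seq => j js.
      have [zj|zj] := leP `|z - zc j| (3 * rc j).
        have cPsi : {for (z, 0 : 'rV[R]_m), continuous Psi}.
          apply: (@continuous_comp _ _ _
            (fun zb : 'rV[R]_n * 'rV[R]_m => g zb.1 + chi zb.1 *: zb.2) (chart_param d)).
            apply: (@continuous_comp _ _ _ (fun zb : 'rV[R]_n * 'rV[R]_m => (g zb.1, (chi zb.1, zb.2)))
              (fun xb : 'rV[R]_m * (R * 'rV[R]_m) => xb.1 + xb.2.1 *: xb.2.2)).
              apply: continuous_pair_for => //; apply: continuous_pair_for; last exact: c2.
              by apply: continuous_comp; [exact: fst_continuous|exact: cchi].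
            suff : continuous (fun xb : 'rV[R]_m * (R * 'rV[R]_m) => xb.1 + xb.2.1 *: xb.2.2) by apply.
            apply: continuous_add; first exact: fst_continuous.
            apply: continuous_scale.
              exact: (comp_continuous (@snd_continuous _ _) (@fst_continuous _ _)).
            exact: (comp_continuous (@snd_continuous _ _) (@snd_continuous _ _)).
          apply: chart_param_cont => //; rewrite /= scaler0 addr0; apply: ballD.
          by case: (FO z (K3 z Kz)).
        have oj : open (cube_image (a j)) by exact: open_cube_image.
        have np : \forall zb \near (z, 0 : 'rV[R]_m), cube_image (a j) (Psi zb).
          apply: cPsi; apply: open_nbhs_nbhs; split => //.
          by rewrite /Psi/= scaler0 addr0 (gK _ (K3 z Kz)); exact: adF.
        by apply: filterS np => zb ? _.
      have nz : \forall zb \near (z, 0 : 'rV[R]_m), 3 * rc j < `|zb.1 - zc j|.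
        have cn : continuous (fun zb : 'rV[R]_n * 'rV[R]_m => `|zb.1 - zc j|).
          apply: continuous_norm; apply: continuous_sub; first exact: fst_continuous.
          exact: cst_continuous.
        apply: (cn (z, 0) [set t : R | 3 * rc j < t]); apply: open_nbhs_nbhs.
        by split; first exact: open_gt.
      by apply: filterS nz => zb; rewrite ltNge => /negP.
    apply: filterS2 n1 n2 => -[z' b] h1 h2; split; first exact: h1.
    exact: h2.
  have /nbhs_ballP[dl /= dl0 dlP] := H.
  exists dl => // b bd z Kz; apply: dlP => //.
  by rewrite ball_rowE/= sub0r normrN.
have [A [f [oA KA sf fg]]] := smooth_approx cK (fun z Kz => cg z (K3 z Kz)) (divr_gt0 dl0 (ltr0n R 2)).
have fdl z (t : R) : K z -> `|clamp01 t *: (f z - g z)| < dl.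
  move=> Kz; rewrite normrZ; have /andP[t0 t1] := clamp01_itv t.
  rewrite ger0_norm//; apply: le_lt_trans (_ : dl / 2 < dl).
    by apply: le_trans (fg z Kz); rewrite ler_piMl.
  by rewrite ltr_pdivrMr// ltr_pMr// ltr1n.
pose inner (tz : R * 'rV[R]_n) := g tz.2 + (clamp01 tz.1 * chi tz.2) *: (f tz.2 - g tz.2).
pose H (tz : R * 'rV[R]_n) :=
  if `|tz.2 - z0| <= 2 * r then chart_param d (inner tz) else F tz.2.
have innerK t z : K z -> `|inner (t, z) - w| < rho.
  move=> Kz; have [h _] := dlP _ (fdl z t Kz) z Kz; apply: le_lt_trans h.
  rewrite /inner/= addrAC; apply: (le_trans (ler_normD _ _)); rewrite lerD2l.
  have /andP[c0 c1] := chi01 z.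
  by rewrite mulrC -scalerA normrZ ger0_norm// ler_piMl.
have inner_out t z : 2 * r <= `|z - z0| -> inner (t, z) = g z.
  by move=> zr; rewrite /inner/= chi_out// mulr0 scale0r addr0.
have HE t z : `|z - z0| <= 3 * r -> H (t, z) = chart_param d (inner (t, z)).
  move=> z3; rewrite /H/=; case: leP => // zr.
  by rewrite inner_out ?(ltW zr)// gK.
have Hout t z : 2 * r <= `|z - z0| -> H (t, z) = F z.
  move=> zr; rewrite /H/=; case: leP => // z2.
  by rewrite inner_out// gK// K3.
have ndist (T : topologicalType) (q : T -> 'rV[R]_n) x (e : R) : continuous q -> `|q x - z0| < e ->
    \forall y \near x, `|q y - z0| < e.
  move=> cq xe.
  have cn : continuous (fun y => `|q y - z0|).
    by apply: continuous_norm; apply: continuous_sub => //; exact: cst_continuous.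
  by apply: (cn x [set t : R | t < e]); apply: open_nbhs_nbhs; split; first exact: open_lt.
have ndistg (T : topologicalType) (q : T -> 'rV[R]_n) x (e : R) : continuous q -> e < `|q x - z0| ->
    \forall y \near x, e < `|q y - z0|.
  move=> cq xe.
  have cn : continuous (fun y => `|q y - z0|).
    by apply: continuous_norm; apply: continuous_sub => //; exact: cst_continuous.
  by apply: (cn x [set t : R | e < t]); apply: open_nbhs_nbhs; split; first exact: open_gt.
have K3lt z : K z -> `|z - z0| < 3 * r.
  by move=> Kz; apply: (le_lt_trans Kz); rewrite ltr_pM2r// ltr_nat.
have cH : continuous H.
  move=> [t z]; have [Kz|zr] := leP `|z - z0| (2 * r); last first.
    apply: (@near_eq_continuous _ _ (fun tz => F tz.2)); last first.
      by apply: (@continuous_comp _ _ _ (@snd R 'rV[R]_n) F); [exact: snd_continuous|exact: cF].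
    apply: filterS (@ndistg _ (@snd R 'rV[R]_n) (t, z) _ (@snd_continuous _ _) zr) => -[t' z'] h.
    by rewrite Hout// ltW.
  apply: (@near_eq_continuous _ _ (chart_param d \o inner)).
    apply: filterS (@ndist _ (@snd R 'rV[R]_n) (t, z) _ (@snd_continuous _ _) (K3lt z Kz)) => -[t' z'] h.
    by rewrite HE// ltW.
  apply: continuous_comp; last first.
    by apply: chart_param_cont => //; apply: ballD; exact: innerK.
  apply: (@continuous_comp _ _ _ (fun tz : R * 'rV[R]_n => ((tz.1, chi tz.2), (g tz.2, f tz.2)))
    (fun x : (R * R) * ('rV[R]_m * 'rV[R]_m) =>
       x.2.1 + (clamp01 x.1.1 * x.1.2) *: (x.2.2 - x.2.1))).
    have c2 : continuous (fun tz : R * 'rV[R]_n => tz.2) by exact: snd_continuous.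
    apply: continuous_pair_for; apply: continuous_pair_for.
    - exact: fst_continuous.
    - by apply: (@continuous_comp _ _ _ (@snd R 'rV[R]_n) chi); [exact: c2|exact: cchi].
    - by apply: (@continuous_comp _ _ _ (@snd R 'rV[R]_n) g); [exact: c2|apply/cg/K3].
    - apply: (@continuous_comp _ _ _ (@snd R 'rV[R]_n) f); first exact: c2.
      exact: (Ck_on_continuous oA (sf 0%N) (KA z Kz)).
  suff : continuous (fun x : (R * R) * ('rV[R]_m * 'rV[R]_m) =>
       x.2.1 + (clamp01 x.1.1 * x.1.2) *: (x.2.2 - x.2.1)) by apply.
  have p21 : continuous (fun x : (R * R) * ('rV[R]_m * 'rV[R]_m) => x.2.1).
    exact: (comp_continuous (@snd_continuous _ _) (@fst_continuous _ _)).
  have p22 : continuous (fun x : (R * R) * ('rV[R]_m * 'rV[R]_m) => x.2.2).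
    exact: (comp_continuous (@snd_continuous _ _) (@snd_continuous _ _)).
  have p11 : continuous (fun x : (R * R) * ('rV[R]_m * 'rV[R]_m) => x.1.1).
    exact: (comp_continuous (@fst_continuous _ _) (@fst_continuous _ _)).
  have p12 : continuous (fun x : (R * R) * ('rV[R]_m * 'rV[R]_m) => x.1.2).
    exact: (comp_continuous (@fst_continuous _ _) (@snd_continuous _ _)).
  apply: (continuous_add p21); apply: continuous_scale; last exact: (continuous_sub p22 p21).
  by apply: continuous_mul p12; exact: (comp_continuous p11 continuous_clamp01).
pose F' z := H (1, z).
have cF' : continuous F'.
  apply: comp_continuous cH; apply: continuous_pair; first exact: cst_continuous.
  exact: id_continuous.
exists F'; split => //.
- move=> j js z zj; rewrite /F' /H/=; case: leP => [Kz|_]; last exact: adF.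
  have [_ /(_ j js zj)] := dlP _ (fdl z 1 Kz) z Kz.
  by rewrite /Psi /inner/= clamp01_1 scale1r mul1r.
- exists H; split => //.
  + exact: continuous_subspaceT.
  + move=> z _; rewrite /H/=; case: leP => // Kz.
    by rewrite /inner/= clamp01_0 mul0r scale0r addr0 gK// K3.
  + by move=> t z _; exact: Hout.
- move=> z zr.
  have zK : K z by apply: (le_trans (ltW zr)); rewrite ler_pMl// ler1n.
  pose V : set 'rV[R]_n := ball z0 r.
  have VK : V `<=` K.
    by move=> x; rewrite /V ball_rowE/= distrC => xr; apply: (le_trans (ltW xr)); rewrite ler_pMl// ler1n.
  have oV : open V by exact: ball_open.
  have Vz : V z by rewrite /V ball_rowE/= distrC.
  have inf x : V x -> inner (1, x) = f x.
    rewrite /V ball_rowE/= distrC => xr.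
    by rewrite /inner/= clamp01_1 /chi cutoff_1 ?(ltW xr)// mulr1 scale1r addrC subrK.
  apply: (@smooth_at_eq _ _ _ _ (chart_param d \o f) F' z V) => //.
    by move=> x Vx; rewrite /F' HE ?inf//; exact/K3/VK.
  apply: (smooth_at_param N_mfd ad oV Vz).
    by move=> x Vx; apply: ballD; rewrite -inf//; exact/innerK/VK.
  by move=> l; apply: (Ck_on_sub oV _ oA (sf l)) => x /VK/KA.
- move=> z sz; have [Kz|zr] := leP `|z - z0| (2 * r); last first.
    apply: (@smooth_at_eq _ _ _ _ F F' z [set x | 2 * r < `|x - z0|]) => //.
      have cn : continuous (fun y : 'rV[R]_n => `|y - z0|).
        by apply: continuous_norm; exact: shift_continuous.
      by move/continuousP: cn => /(_ [set t : R | 2 * r < t]); apply; exact: open_gt.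
    by move=> x xr; rewrite /F' Hout// ltW.
  have dFz : chart_dom d (F z) by case: (FO z (K3 z Kz)).
  have [V [oV Vz VF sV]] := smooth_at_chart N_mfd sz ad dFz.
  pose W0 := V `&` (A `&` ball z0 (3 * r)).
  have oW0 : open W0 by apply: openI => //; apply: openI => //; exact: ball_open.
  have W0z : W0 z by split => //; split; [exact: KA|rewrite ball_rowE/= distrC; exact: K3lt].
  have sin : smooth_on W0 (fun x => inner (1, x)).
    have sgW l : Ck_on l W0 g by apply: (Ck_on_sub oW0 _ oV (sV l)) => x [].
    have sfW l : Ck_on l W0 f by apply: (Ck_on_sub oW0 _ oA (sf l)) => x [_ []].
    move=> l; apply: Ck_on_row => // j.
    have gj := Ck_on_row_coord j oW0 (sgW l); have fj := Ck_on_row_coord j oW0 (sfW l).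
    have cj : Ck_on l W0 chi by exact: (cutoff_smooth z0 r oW0 l).
    have m1 := Ck_onM oW0 (Ck_on_cst l (-1 : R) oW0) gj.
    have := Ck_onD oW0 gj (Ck_onM oW0 cj (Ck_onD oW0 fj m1)).
    by apply: Ck_on_eq => // x _; rewrite !mxE/= clamp01_1 mul1r mulN1r.
  pose W := W0 `&` [set x | `|inner (1, x) - w| < rho].
  have oW : open W.
    rewrite openE => x [W0x xw]; apply: filterI; first exact: open_nbhs_nbhs.
    have cx := Ck_on_continuous oW0 (sin 0%N) W0x.
    have cn : continuous (fun y : 'rV[R]_m => `|y - w|).
      by apply: continuous_norm; exact: shift_continuous.
    have := @continuous_comp _ _ _ (fun x => inner (1, x)) (fun y => `|y - w|) x cx (cn _).
    by move=> /(_ [set t : R | t < rho]); apply; apply: open_nbhs_nbhs; split => //; exact: open_lt.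
  have Wz : W z by split => //; exact: innerK.
  apply: (@smooth_at_eq _ _ _ _ (chart_param d \o (fun x => inner (1, x))) F' z W) => //.
    move=> x [[_ [_]]]; rewrite ball_rowE/= distrC => x3 _.
    by rewrite /F' HE// ltW.
  apply: (smooth_at_param N_mfd ad oW Wz).
    by move=> x [_ xw]; exact: ballD.
  by move=> l; apply: (Ck_on_sub oW _ oW0 (sin l)) => x [].
Qed.

End smoothing_step.

Lemma homotopic_rel_sub (R : realType) (X Y : topologicalType) (A B B' : set X) (f g : X -> Y) :
  B' `<=` B -> homotopic_rel R A B f g -> homotopic_rel R A B' f g.
Proof.
by move=> BB [H [cH H0 H1 HB]]; exists H; split => // t x t01 /BB; exact: HB.
Qed.

(** Outside the closed unit disk f is locally constant, so only the disk has to be covered by cubes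
    to smooth in. The radius grows from 1 to 2 because the cutoffs spread beyond the disk. *)
Lemma smoothing (R : realType) n m (N : riemData R m) (f : 'rV[R]_n -> N) (y : N) :
  compact_riemannian N -> continuous f -> (forall z, 1 <= `|z| -> f z = y) ->
  exists f', [/\ forall z, smooth_at f' z, forall z, 2 <= `|z| -> f' z = y &
    homotopic_rel R setT [set z | 2 <= `|z|] f f'].
Proof.
move=> N_mfd cf fy.
have atz z : exists ar : coord_cube N * R, [/\ good_cube ar.1, 0 < ar.2, ar.2 <= 2^-1 &
    forall x, `|x - z| <= 3 * ar.2 -> cube_image ar.1 (f x)].
  have [a [ga az]] := good_cube_at N_mfd (f z).
  have oU : open (f @^-1` cube_image a).
    by move/continuousP: cf; apply; exact: open_cube_image.
  have [e e0 eU] := open_closed_cube oU az.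
  (* With r <= 1/2 a modification centred in the unit disk is supported within distance 2 r <= 1 of
     its centre, so it changes nothing where |z| >= 2. *)
  exists (a, Num.min (e / 3) 2^-1); split => //=.
  - by rewrite lt_min divr_gt0//= invr_gt0.
  - by rewrite ge_min lexx orbT.
  - move=> x xz; apply: eU => /=; apply: (le_trans xz).
    have {2}-> : e = 3 * (e / 3) by field.
    by rewrite ler_pM2l// ge_min lexx.
have [ar arP] := choice atz.
pose a z := (ar z).1; pose r z := (ar z).2.
have a_good z : good_cube (a z) by case: (arP z).
have r0 z : 0 < r z by case: (arP z).
have r2 z : r z <= 2^-1 by case: (arP z).
have cK := @closed_cube_compact R n 0 1.
have [z _|z _|s sK sP] := @compact_sub_cover _ _ (fun z => ball z (r z)) cK.
- exact: ball_open.
- exact: ballxx.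
have adf : cube_adapted s id r a f.
  by move=> z _ x; case: (arP z) => _ _ _; exact.
have ind (t : seq 'rV[R]_n) : {subset t <= s} -> exists F, [/\ continuous F, cube_adapted s id r a F,
    homotopic_rel R setT [set z | 2 <= `|z|] f F &
    forall z, 1 < `|z| \/ (exists2 j, j \in t & `|z - j| < r j) -> smooth_at F z].
  elim: t => [|j t IH] ts.
    exists f; split => //; first exact: homotopic_rel_refl.
    move=> z [z1|[]//]; have oV : open [set x : 'rV[R]_n | 1 < `|x|].
      by move/continuousP: (@norm_rV_continuous R n) => /(_ [set t : R | 1 < t]); apply; exact: open_gt.
    apply: (@smooth_at_eq _ _ _ _ (cst y) f z _ oV) => //.
      by move=> x /= /ltW x1; rewrite fy.
    exact: smooth_at_cst.
  have [|F [cF adF hF sF]] := IH; first by move=> x xt; apply: ts; rewrite inE xt orbT.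
  have js : j \in s by apply: ts; exact: mem_head.
  have [F' [cF' adF' hF' sF1 sF2]] := smoothing_step N_mfd r0 a_good js cF adF.
  exists F'; split => //.
    apply: homotopic_rel_trans hF (homotopic_rel_sub _ hF') => z /= z2.
    have := sK j js; rewrite /= subr0 => j1.
    have h : `|z| <= `|z - j| + `|j| by rewrite -{1}(subrK j z); exact: ler_normD.
    have := r2 j; lra.
  move=> z [z1|[j']]; first by apply: sF2; apply: sF; left.
  rewrite inE => /orP[/eqP -> zj|jt zj]; first exact: sF1.
  by apply: sF2; apply: sF; right; exists j'.
have [F [cF _ hF sF]] := ind s (fun _ => id).
exists F; split => //.
- move=> z; apply: sF; have [z1|z1] := leP `|z| 1; last by left.
  have [|j js] := sP z; first by rewrite /= subr0.
  by rewrite ball_rowE/= distrC => zj; right; exists j.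
- move=> z z2; have [H [_ _ H1 HB]] := hF; rewrite -(H1 z)// HB//.
    by apply: fy; apply: le_trans z2; rewrite ler1n.
  by rewrite ler01 lexx.
Qed.

(** * Maps of the sphere *)

(** The hypotheses on M concern its charts alone, so the lemma applies to [sphere] once
    stereographic coordinates are verified. *)
Lemma smooth_at_smooth_map (R : realType) n m (M : riemData R n) (N : riemData R m) (u : M -> N) :
  compact_riemannian N -> (forall c, atlas M c -> is_chart c) ->
  (forall p, exists2 c, atlas M c & chart_dom c p) ->
  (forall c z, atlas M c -> chart_img c z -> smooth_at (u \o chart_param c) z) ->
  smooth_map u.
Proof.
move=> N_mfd hM covM su.
have cu : continuous u.
  move=> p; have [c ac dp] := covM p; have hc := hM c ac.
  have od : open (chart_dom c) by case: hc.
  apply: (@near_eq_continuous _ _ ((u \o chart_param c) \o chart_coord c)).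
    apply: filterS (open_nbhs_nbhs (conj od dp)) => q dq /=.
    by rewrite chart_coordK.
  apply: continuous_comp; first exact: chart_coord_cont.
  by apply: smooth_at_continuous; apply: su => //; exact: chart_img_coord.
split => // c d ac ad r; have hc := hM c ac.
have od : open (chart_dom d) by case: (mfd_chart N_mfd ad).
have oW : open (chart_coord c @` (chart_dom c `&` u @^-1` chart_dom d)).
  by apply: open_chart_preimage => //; move/continuousP: cu; apply.
apply: Ck_on_local => // z [p [dp up] pz].
have zi : chart_img c z by exists p.
have dz : chart_dom d ((u \o chart_param c) z) by rewrite /= -pz chart_coordK.
have [V [oV Vz _ sV]] := smooth_at_chart N_mfd (su c z ac zi) ad dz.
by exists V; split => //; exact: sV.
Qed.

Lemma continuous_div_for (R : realType) (T : topologicalType) (f g : T -> R) x :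
  {for x, continuous f} -> {for x, continuous g} -> g x != 0 ->
  {for x, continuous (fun x => f x * (g x)^-1)}.
Proof. by move=> cf cg gx; apply: cvgM cf _; exact: cvgV. Qed.

Section sphere_charts.
Context {R : realType} {n : nat}.
Local Notation S := (sphere R n).
Implicit Types (p : S) (y z : 'rV[R]_n).

Definition sval p : 'rV[R]_n.+1 := set_val p.

Lemma sval_continuous : continuous sval.
Proof. exact: initial_continuous. Qed.

Lemma to_sphere_cont_at (T : topologicalType) (f : T -> S) x :
  {for x, continuous (sval \o f)} -> {for x, continuous f}.
Proof.
move=> cf U [V [[W oW WV]] Vx VU].
have Wx : W (sval (f x)) by move: Vx; rewrite -WV.
have h : \forall t \near x, W (sval (f t)) by exact: (cf W (open_nbhs_nbhs (conj oW Wx))).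
by apply: (filterS _ h) => t Wt; apply: VU; rewrite -WV.
Qed.

Lemma sval_inj : injective sval.
Proof. exact: val_inj. Qed.

Lemma sval_norm p : sqnorm (sval p) = 1.
Proof. by have := set_mem (valP p). Qed.

Lemma sqnorm_ge0 k (x : 'rV[R]_k) : 0 <= sqnorm x.
Proof. by apply: sumr_ge0 => i _; rewrite sqr_ge0. Qed.

Lemma sqnorm_coord k (x : 'rV[R]_k) i : x ord0 i ^+ 2 <= sqnorm x.
Proof. by rewrite /sqnorm (bigD1 i)//= lerDl; apply: sumr_ge0 => j _; rewrite sqr_ge0. Qed.

Lemma sqnorm_eq0 k (x : 'rV[R]_k) : sqnorm x = 0 -> x = 0.
Proof.
move=> x0; apply/rowP => i; rewrite mxE; apply/eqP; rewrite -sqrf_eq0 eq_le sqr_ge0 andbT.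
by rewrite -x0 sqnorm_coord.
Qed.

Lemma sqnorm_le k (x : 'rV[R]_k) : sqnorm x <= k%:R * `|x| ^+ 2.
Proof.
rewrite mulr_natl -[X in _ *+ X](card_ord k) -sumr_const; apply: ler_sum => i _.
by rewrite -real_normK ?num_real// lerXn2r ?nnegrE// row_coord_le.
Qed.

Lemma Ck_on_sqnorm k r : Ck_on r setT (fun x : 'rV[R]_k => sqnorm x).
Proof.
apply: Ck_on_sum => [|i]; first exact: openT.
have c := @Ck_on_coord R k r setT i openT.
by apply: Ck_on_eq (Ck_onM openT c c) => [|x _ /=]; [exact: openT|rewrite expr2].
Qed.

Lemma sqnorm_continuous k : continuous (fun x : 'rV[R]_k => sqnorm x).
Proof. by move=> x; exact: (Ck_on_continuous openT (@Ck_on_sqnorm k 0%N)). Qed.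

Lemma sval0 (s : bool) p : sval p ord0 ord0 != (-1) ^+ s ->
  1 - (-1) ^+ s * sval p ord0 ord0 != 0.
Proof.
apply: contra_neq => /eqP; rewrite subr_eq0 => /eqP h.
have e2 : (-1) ^+ s * (-1) ^+ s = 1 :> R by rewrite -expr2 sqrr_sign.
by rewrite -[LHS]mul1r -[X in X * _]e2 -mulrA -h mulr1.
Qed.

Lemma stereo_param0 (s : bool) y : sval (chart_param (stereo_chart R n s) y) ord0 ord0 =
  (-1) ^+ s * (sqnorm y - 1) / (sqnorm y + 1).
Proof. by rewrite /sval/= mxE unlift_none. Qed.

Lemma stereo_paramS (s : bool) y i : sval (chart_param (stereo_chart R n s) y) ord0 (lift ord0 i) =
  2 * y ord0 i / (sqnorm y + 1).
Proof. by rewrite /sval/= mxE liftK. Qed.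

Lemma stereo_coordE (s : bool) p i : chart_coord (stereo_chart R n s) p ord0 i =
  sval p ord0 (lift ord0 i) / (1 - (-1) ^+ s * sval p ord0 ord0).
Proof. by rewrite mxE. Qed.

Lemma sqnorm1_gt0 k (x : 'rV[R]_k) : 0 < sqnorm x + 1.
Proof. by rewrite ltr_wpDl// sqnorm_ge0. Qed.

Lemma stereo_dom_param (s : bool) y :
  chart_dom (stereo_chart R n s) (chart_param (stereo_chart R n s) y).
Proof.
rewrite /= -/(sval (chart_param (stereo_chart R n s) y)) stereo_param0 -mulrA.
have d0 := sqnorm1_gt0 y; rewrite -subr_eq0 -[X in _ - X]mulr1 -mulrBr mulf_neq0 ?signr_eq0//.
rewrite subr_eq0; apply/eqP => /(congr1 (fun t => t * (sqnorm y + 1))).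
by rewrite mulfVK ?gt_eqF// mul1r => ?; lra.
Qed.

Lemma stereo_paramK (s : bool) y :
  chart_coord (stereo_chart R n s) (chart_param (stereo_chart R n s) y) = y.
Proof.
apply/rowP => i; rewrite stereo_coordE stereo_paramS stereo_param0 !mulrA -expr2 sqrr_sign mul1r.
have d0 := sqnorm1_gt0 y; set q := sqnorm y in d0 *.
field; rewrite gt_eqF//=; apply/eqP; lra.
Qed.

Lemma stereo_coordK (s : bool) p : chart_dom (stereo_chart R n s) p ->
  chart_param (stereo_chart R n s) (chart_coord (stereo_chart R n s) p) = p.
Proof.
move=> /sval0 d0; set e := (-1) ^+ s in d0.
have e2 : e * e = 1 by rewrite -expr2 sqrr_sign.
apply: sval_inj; set y := chart_coord _ _; set x0 := sval p ord0 ord0 in d0.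
have qE : sqnorm y = (1 + e * x0) / (1 - e * x0).
  have : sqnorm y * (1 - e * x0) ^+ 2 = 1 - (e * x0) ^+ 2.
    have -> : (e * x0) ^+ 2 = x0 ^+ 2 by rewrite exprMn expr2 e2 mul1r.
    have -> : 1 - x0 ^+ 2 = \sum_(i < n) sval p ord0 (lift ord0 i) ^+ 2.
      by rewrite -(sval_norm p) /sqnorm big_ord_recl -/x0 addrAC subrr add0r.
    rewrite /sqnorm mulr_suml; apply: eq_bigr => i _.
    by rewrite /y stereo_coordE -/x0 -/e expr_div_n mulfVK// expf_neq0.
  move=> h; apply: (@mulIf _ ((1 - e * x0) ^+ 2)); first by rewrite expf_neq0.
  by rewrite h; field.
have q1 : sqnorm y + 1 = 2 / (1 - e * x0) by rewrite qE; field.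
apply/rowP => i; case: (unliftP ord0 i) => [j ->|->].
  rewrite stereo_paramS q1 /y stereo_coordE -/e -/x0; field.
  by rewrite d0.
rewrite stereo_param0 q1 qE -/e -/x0.
have -> : e * ((1 + e * x0) / (1 - e * x0) - 1) / (2 / (1 - e * x0)) = e * e * x0.
  by field; rewrite d0.
by rewrite e2 mul1r.
Qed.

Lemma stereo_img (s : bool) : chart_img (stereo_chart R n s) = setT.
Proof.
apply/seteqP; split => // y _; exists (chart_param (stereo_chart R n s) y).
  exact: stereo_dom_param.
exact: stereo_paramK.
Qed.

Lemma sval_coord_continuous i : continuous (fun p => sval p ord0 i).
Proof. exact: (comp_continuous sval_continuous (@row_coord_continuous R n.+1 i)). Qed.

Lemma stereo_is_chart (s : bool) : is_chart (stereo_chart R n s).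
Proof.
split.
- have := @sval_coord_continuous ord0 => /continuousP/(_ [set t | t != (-1) ^+ s]).
  by apply; exact: open_neq.
- by rewrite stereo_img; exact: openT.
- by move=> p /set_mem; exact: stereo_coordK.
- apply: continuous_in_subspaceT => p /set_mem/sval0 d0; apply: row_continuous => i.
  rewrite (_ : (fun q => _) = fun q : S => sval q ord0 (lift ord0 i) *
      (1 - (-1) ^+ s * sval q ord0 ord0)^-1); last first.
    by apply/funext => q; exact: stereo_coordE.
  apply: continuous_div_for => //; first exact: sval_coord_continuous.
  suff : continuous (fun q : S => 1 - (-1) ^+ s * sval q ord0 ord0) by apply.
  apply: continuous_sub; first exact: cst_continuous.
  by apply: continuous_mul; [exact: cst_continuous|exact: sval_coord_continuous].
- apply: continuous_subspaceT => y; apply: to_sphere_cont_at; apply: row_continuous => i.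
  have cD : continuous (fun y : 'rV[R]_n => (sqnorm y + 1)^-1).
    apply: continuous_inv => [z|]; first by rewrite gt_eqF// sqnorm1_gt0.
    by apply: continuous_add; [exact: sqnorm_continuous|exact: cst_continuous].
  case: (unliftP ord0 i) => [j ->|->].
    rewrite (_ : (fun y => _) = fun y => 2 * y ord0 j * (sqnorm y + 1)^-1); last first.
      by apply/funext => z; exact: stereo_paramS.
    suff : continuous (fun y : 'rV[R]_n => 2 * y ord0 j * (sqnorm y + 1)^-1) by apply.
    apply: (continuous_mul _ cD); apply: continuous_mul; first exact: cst_continuous.
    exact: row_coord_continuous.
  rewrite (_ : (fun y => _) = fun y => (-1) ^+ s * (sqnorm y - 1) * (sqnorm y + 1)^-1); last first.
    by apply/funext => z; exact: stereo_param0.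
  suff : continuous (fun y : 'rV[R]_n => (-1) ^+ s * (sqnorm y - 1) * (sqnorm y + 1)^-1) by apply.
  apply: (continuous_mul _ cD); apply: continuous_mul; first exact: cst_continuous.
  by apply: continuous_sub; [exact: sqnorm_continuous|exact: cst_continuous].
Qed.

End sphere_charts.

(** * Maps of R^n constant near infinity, as maps of the sphere *)

Section sphere_map.
Context {R : realType} {n : nat} {Y : Type}.
Local Notation S := (sphere R n).
Implicit Types (p : S) (z : 'rV[R]_n).
Variables (h : 'rV[R]_n -> Y) (y : Y).

(* The coordinates of the pole are junk, hence the case distinction. *)
Definition sphere_map p : Y :=
  if sval p ord0 ord0 == 1 then y else h (chart_coord (stereo_chart R n false) p).

Lemma sphere_map_false z : sphere_map (chart_param (stereo_chart R n false) z) = h z.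
Proof.
rewrite /sphere_map stereo_paramK ifF//; apply/negbTE.
by have := @stereo_dom_param R n false z; rewrite /= expr0.
Qed.

(** The two stereographic coordinates are related by inversion in the Euclidean unit sphere; the
    origin of this chart is the pole omitted by the other one. *)
Lemma sphere_map_true z : sphere_map (chart_param (stereo_chart R n true) z) =
  if z == 0 then y else h ((sqnorm z)^-1 *: z).
Proof.
rewrite /sphere_map; have d0 := sqnorm1_gt0 z.
have -> : (sval (chart_param (stereo_chart R n true) z) ord0 ord0 == 1) = (z == 0).
  rewrite stereo_param0 expr1 mulN1r opprB; apply/eqP/eqP => [h1|->].
    apply: sqnorm_eq0; move/(congr1 (fun t => t * (sqnorm z + 1))): h1.
    by rewrite mulfVK ?gt_eqF// mul1r => ?; lra.
  have -> : sqnorm (0 : 'rV[R]_n) = 0.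
    by rewrite /sqnorm big1// => i _; rewrite mxE expr0n.
  by rewrite subr0 add0r divr1.
case: eqP => // z0; congr (h _); apply/rowP => i.
rewrite stereo_coordE stereo_paramS stereo_param0 expr0 mul1r expr1 mxE.
have q0 : sqnorm z != 0 by apply/eqP => /sqnorm_eq0.
move: d0 q0; set q := sqnorm z => d0 q0; field.
rewrite q0 gt_eqF//=; apply/eqP => hh; move: q0 => /eqP; apply; lra.
Qed.

(** As [sqnorm z] is at most n |z|^2, inversion sends z to a point of sup norm at least 1 / (n |z|)
    >= rho. *)
Lemma sphere_map_near (rho : R) z : (forall x, rho <= `|x| -> h x = y) ->
  rho * n%:R * `|z| <= 1 -> sphere_map (chart_param (stereo_chart R n true) z) = y.
Proof.
move=> hy zr; rewrite sphere_map_true; case: eqVneq => // z0; apply: hy.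
have q0 : 0 < sqnorm z.
  rewrite lt_def sqnorm_ge0 andbT; apply: contra_neq z0; exact: sqnorm_eq0.
have [r0|r0] := leP rho 0; first exact: le_trans r0 _.
rewrite normrZ gtr0_norm ?invr_gt0// mulrC ler_pdivlMr//.
apply: (@le_trans _ _ (rho * (n%:R * `|z| ^+ 2))).
  by rewrite ler_pM2l// sqnorm_le.
by rewrite expr2 !mulrA -[leRHS]mul1r ler_wpM2r.
Qed.

End sphere_map.

Lemma Ck_on_inversion (R : realType) n r :
  Ck_on r [set z : 'rV[R]_n | z != 0] (fun z : 'rV[R]_n => (sqnorm z)^-1 *: z).
Proof.
have oU : open [set z : 'rV[R]_n | z != 0].
  have : continuous (fun z : 'rV[R]_n => `|z|) by exact: norm_rV_continuous.
  move/continuousP => /(_ [set t : R | t != 0] (@open_neq _ 0)).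
  by congr open; apply/funext => z; rewrite /= normr_eq0.
apply: Ck_on_row => // i.
apply: (@Ck_on_eq _ _ _ r _ (fun z => (sqnorm z)^-1 * z ord0 i)) => //.
  by move=> z _; rewrite mxE.
apply: (@Ck_onM _ _ r _ (fun z => (sqnorm z)^-1) (fun z => z ord0 i)) => //.
  apply: Ck_onV => // [z /= z0|].
    by apply: contra_neq z0; exact: sqnorm_eq0.
  exact: (Ck_on_sub oU _ openT (@Ck_on_sqnorm R n r)).
exact: Ck_on_coord.
Qed.

Lemma smooth_sphere_map (R : realType) n m (N : riemData R m) (h : 'rV[R]_n -> N) (y : N) (rho : R) :
  compact_riemannian N -> (forall z, smooth_at h z) -> 0 < rho ->
  (forall z, rho <= `|z| -> h z = y) -> smooth_map (sphere_map h y).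
Proof.
move=> N_mfd sh rho0 hy; apply: smooth_at_smooth_map => //.
- by move=> _ [s _ <-]; exact: stereo_is_chart.
- move=> p; have [p1|p1] := eqVneq (sval p ord0 ord0) 1.
    exists (stereo_chart R n true); first by exists true.
    by rewrite /= -/(sval p) p1 expr1 -subr_eq0 opprK -[1 + 1]/(2%:R : R) pnatr_eq0.
  by exists (stereo_chart R n false); [exists false|rewrite /= -/(sval p) expr0].
- move=> _ z [[] _ <-] _; last first.
    have -> // : sphere_map h y \o chart_param (stereo_chart R n false) = h.
    by apply/funext => x; exact: sphere_map_false.
  have [->|z0] := eqVneq z 0.
    (* Around the pole the map is constant. The factor n + 1 instead of n keeps the radius positive
       without a condition on n. *)
    pose e := (rho * (n%:R + 1))^-1.
    have n1 : 0 < n%:R + 1 :> R by rewrite ltr_wpDl.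
    have e0 : 0 < e by rewrite invr_gt0 mulr_gt0.
    apply: (@smooth_at_eq _ _ _ _ (cst y) _ _ (ball 0 e)).
    + exact: ball_open.
    + exact: ballxx.
    + move=> x; rewrite ball_rowE/= sub0r normrN => xe.
      rewrite (@sphere_map_near R n N h y rho x hy)//.
      rewrite -mulrA -ler_pdivlMl// mulr1.
      apply: (@le_trans _ _ ((n%:R + 1) * `|x|)); first by rewrite ler_wpM2r// lerDl.
      by rewrite mulrC -ler_pdivlMr// -invfM ltW.
    + exact: smooth_at_cst.
  have oU : open [set x : 'rV[R]_n | x != 0].
    have : continuous (fun z : 'rV[R]_n => `|z|) by exact: norm_rV_continuous.
    move/continuousP => /(_ [set t : R | t != 0] (@open_neq _ 0)).
    by congr open; apply/funext => x; rewrite /= normr_eq0.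
  apply: (@smooth_at_eq _ _ _ _ (h \o (fun x => (sqnorm x)^-1 *: x)) _ z _ oU) => //.
    by move=> x /= x0; rewrite sphere_map_true (negbTE x0).
  by apply: (smooth_at_comp oU) => // r; exact: Ck_on_inversion.
Qed.

(** * From free null-homotopies on the sphere to relative ones on R^n *)

Section sphere_null.
Context {R : realType} {n : nat}.
Local Notation S := (sphere R n).
Implicit Types (p : S) (z : 'rV[R]_n).

Definition enorm k (x : 'rV[R]_k) : R := Num.sqrt (sqnorm x).

Lemma enorm_continuous k : continuous (@enorm k).
Proof. exact: (comp_continuous (@sqnorm_continuous R k) (@sqrt_continuous R)). Qed.

Lemma sqnormZ k (c : R) (x : 'rV[R]_k) : sqnorm (c *: x) = c ^+ 2 * sqnorm x.
Proof. by rewrite /sqnorm mulr_sumr; apply: eq_bigr => i _; rewrite mxE exprMn. Qed.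

(** Radial projection; its value at the origin is arbitrary. *)
Definition sphere_proj (x : 'rV[R]_n.+1) : S :=
  if pselect (unit_sphere ((enorm x)^-1 *: x)) is left h
  then exist _ ((enorm x)^-1 *: x) (mem_set h) else stereo_inv false 0.

Lemma sval_proj x : 0 < enorm x -> sval (sphere_proj x) = (enorm x)^-1 *: x.
Proof.
move=> x0; rewrite /sphere_proj; case: pselect => // -[].
rewrite /unit_sphere/= sqnormZ exprVn sqr_sqrtr ?sqnorm_ge0// mulVf//.
by apply: contraTneq x0 => q0; rewrite /enorm q0 sqrtr0 ltxx.
Qed.

Lemma sphere_proj_cont x : 0 < enorm x -> {for x, continuous sphere_proj}.
Proof.
move=> x0; apply: to_sphere_cont_at.
have oU : open [set x : 'rV[R]_n.+1 | 0 < enorm x].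
  by move/continuousP: (@enorm_continuous n.+1) => /(_ [set t : R | 0 < t]); apply; exact: open_gt.
apply: (@near_eq_continuous _ _ (fun x => (enorm x)^-1 *: x)).
  by apply: filterS (open_nbhs_nbhs (conj oU x0)) => t /= t0; rewrite sval_proj.
apply: (@continuous_comp _ _ _ (fun x : 'rV[R]_n.+1 => ((enorm x)^-1, x))
  (fun tx : R * 'rV[R]_n.+1 => tx.1 *: tx.2)).
  apply: continuous_pair_for; last exact: id_continuous.
  have -> : (fun x : 'rV[R]_n.+1 => (enorm x)^-1) = fun x => 1 * (enorm x)^-1.
    by apply/funext => t; rewrite mul1r.
  apply: continuous_div_for; [exact: cst_continuous|exact: enorm_continuous|].
  by rewrite gt_eqF.
suff : continuous (fun tx : R * 'rV[R]_n.+1 => tx.1 *: tx.2) by apply.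
by apply: continuous_scale; [exact: fst_continuous|exact: snd_continuous].
Qed.

(** [gam] is 1 for |z| <= 2 and 0 for |z| >= 3. Stereographic coordinates reach the pole only at
    infinity; dividing z by [gam] brings everything from radius 3 on exactly to the pole. *)
Let gam z : R := clamp01 (3 - `|z|).
Let den z : R := sqnorm z + gam z ^+ 2.

Let gam_continuous : continuous gam.
Proof.
apply: comp_continuous continuous_clamp01.
by apply: continuous_sub; [exact: cst_continuous|exact: norm_rV_continuous].
Qed.

Let den_gt0 z : 0 < den z.
Proof.
rewrite /den; have [z3|z3] := ltP `|z| 3.
  have : 0 < gam z.
    by rewrite /gam /clamp01 lt_max lt_min ltr01 subr_gt0 z3 orbT.
  by move=> g0; rewrite ltr_wpDl ?sqnorm_ge0// exprn_gt0.
rewrite ltr_wpDr ?sqr_ge0// lt_def sqnorm_ge0 andbT; apply/eqP => /sqnorm_eq0 z0.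
by move: z3; rewrite z0 normr0 leNgt => /negP; apply.
Qed.

(* For gam z != 0 this is the inverse stereographic projection of z / gam z,
   and for gam z = 0 it is the pole. *)
Let sig z : 'rV[R]_n.+1 :=
  \row_i (if unlift ord0 i is Some j then 2 * gam z * z ord0 j / den z
          else (sqnorm z - gam z ^+ 2) / den z).

Let sig0 z : sig z ord0 ord0 = (sqnorm z - gam z ^+ 2) / den z.
Proof. by rewrite mxE unlift_none. Qed.

Let sigS z j : sig z ord0 (lift ord0 j) = 2 * gam z * z ord0 j / den z.
Proof. by rewrite mxE liftK. Qed.

Let sig_norm z : sqnorm (sig z) = 1.
Proof.
have d0 : den z != 0 by rewrite gt_eqF.
rewrite {1}/sqnorm big_ord_recl sig0.
rewrite (eq_bigr (fun i => (2 * gam z / den z) ^+ 2 * z ord0 i ^+ 2)); last first.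
  by move=> i _; rewrite sigS -exprMn; congr (_ ^+ 2); ring.
rewrite -mulr_sumr -/(sqnorm z); move: d0; rewrite /den => d0; field.
by rewrite d0.
Qed.

Let sig_continuous : continuous sig.
Proof.
have cg2 : continuous (fun z => gam z ^+ 2) by exact: continuous_mul.
have cd : continuous (fun z => (den z)^-1).
  apply: continuous_inv => [z|]; first by rewrite gt_eqF.
  by apply: continuous_add cg2; exact: sqnorm_continuous.
move=> z; apply: row_continuous => i; case: (unliftP ord0 i) => [j ->|->].
  rewrite (_ : (fun s => _) = fun z => 2 * gam z * z ord0 j * (den z)^-1); last first.
    by apply/funext => x; exact: sigS.
  suff : continuous (fun z => 2 * gam z * z ord0 j * (den z)^-1) by apply.
  apply: (continuous_mul _ cd); apply: continuous_mul; last exact: row_coord_continuous.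
  by apply: continuous_mul => //; exact: cst_continuous.
rewrite (_ : (fun s => _) = fun z => (sqnorm z - gam z ^+ 2) * (den z)^-1); last first.
  by apply/funext => x; exact: sig0.
suff : continuous (fun z => (sqnorm z - gam z ^+ 2) * (den z)^-1) by apply.
apply: (continuous_mul _ cd); apply: continuous_sub => //.
exact: sqnorm_continuous.
Qed.

Let pole : 'rV[R]_n.+1 := delta_mx ord0 ord0.

Let sig_pole z : 3 <= `|z| -> sig z = pole.
Proof.
move=> z3; have g0 : gam z = 0 by rewrite /gam /clamp01 max_l// ge_min subr_le0 z3 orbT.
have d0 := den_gt0 z; rewrite /den g0 expr0n addr0 in d0.
apply/rowP => i; case: (unliftP ord0 i) => [j ->|->].
  by rewrite sigS g0 mulr0 !mul0r mxE eqxx/=.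
by rewrite sig0 /den g0 expr0n addr0 subr0 mulfV ?gt_eqF// mxE !eqxx.
Qed.

(* A null-homotopy of a map of the sphere extends it to a map E of the space,
   and E composed with segments from sig z to the pole contracts h. *)
Lemma sphere_map_null (Y : topologicalType) (h : 'rV[R]_n -> Y) (y c : Y) :
  (forall z, 2 <= `|z| -> h z = y) -> homotopic R (sphere_map h y) (cst c) ->
  homotopic_rel R setT [set z | 3 <= `|z|] h (cst y).
Proof.
move=> hy /homotopic_relP[H [cH H0 H1 _]].
(* The time runs from 0 at Euclidean radius 1 to 1 at radius 1/2, where H has become the constant c;
   this avoids the projection near the origin. *)
pose E (x : 'rV[R]_n.+1) := if `[< enorm x <= 2^-1 >] then c else
  H (2 - 2 * enorm x, sphere_proj x).
have cE : continuous E.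
  apply: (@glue_closed _ _ [set x | enorm x <= 2^-1] [set x | 2^-1 <= enorm x]).
  - exact: (closed_comp (fun x _ => @enorm_continuous n.+1 x) (@closed_le R _)).
  - exact: (closed_comp (fun x _ => @enorm_continuous n.+1 x) (@closed_ge R _)).
  - apply/seteqP; split => // x _ /=.
    by case: (leP (enorm x) 2^-1) => [|/ltW]; [left|right].
  - by apply: continuous_subspaceT; exact: cst_continuous.
  - apply: continuous_in_subspaceT => x /set_mem/= x2.
    have x0 : 0 < enorm x by apply: lt_le_trans x2; rewrite invr_gt0.
    apply: (@continuous_comp _ _ _ (fun x => (2 - 2 * enorm x, sphere_proj x)) H); last exact: cH.
    apply: continuous_pair_for; last exact: sphere_proj_cont.
    suff : continuous (fun x : 'rV[R]_n.+1 => 2 - 2 * enorm x) by apply.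
    apply: continuous_sub; first exact: cst_continuous.
    by apply: continuous_mul; [exact: cst_continuous|exact: enorm_continuous].
  - move=> x /= x1 x2; rewrite H1//.
    by have -> : enorm x = 2^-1; [apply/eqP; rewrite eq_le x1|lra].
have E1 x : sqnorm x = 1 -> E x = sphere_map h y (sphere_proj x) /\ sval (sphere_proj x) = x.
  move=> x1; have n1 : enorm x = 1 by rewrite /enorm x1 sqrtr1.
  split; last by rewrite sval_proj n1// invr1 scale1r.
  rewrite /E; case: asboolP; rewrite n1; first by move=> ?; exfalso; lra.
  by move=> _; rewrite H0// mulr1 subrr.
have Epole : E pole = y.
  have q1 : sqnorm pole = 1.
    rewrite /sqnorm big_ord_recl !mxE !eqxx/= expr1n big1 ?addr0// => i _.
    by rewrite !mxE/= expr0n.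
  by have [-> ep] := E1 _ q1; rewrite /sphere_map ep mxE !eqxx.
have Esig z : E (sig z) = h z.
  have [-> ez] := E1 _ (sig_norm z); rewrite /sphere_map ez sig0.
  have d0 := den_gt0 z.
  have [z3|z3] := leP 3 `|z|.
    rewrite -sig0 (sig_pole z3) mxE !eqxx hy//; apply: le_trans z3; rewrite ler_nat//.
  have g0 : 0 < gam z by rewrite /gam /clamp01 lt_max lt_min ltr01 subr_gt0 z3 orbT.
  have /andP[_ g1] := clamp01_itv (3 - `|z|); rewrite -/(gam z) in g1.
  rewrite ifF; last first.
    apply/negbTE/eqP => /(congr1 (fun t => t * den z)); rewrite mulfVK ?gt_eqF// mul1r /den.
    by have := exprn_gt0 2 g0; lra.
  have -> : chart_coord (stereo_chart R n false) (sphere_proj (sig z)) = (gam z)^-1 *: z.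
    apply/rowP => j; rewrite stereo_coordE ez sigS sig0 expr0 mul1r mxE.
    move: d0; rewrite /den => d0; field.
    rewrite (gt_eqF g0) (gt_eqF d0)/=.
    have -> : sqnorm z + gam z ^+ 2 - (sqnorm z - gam z ^+ 2) = 2 * gam z ^+ 2 by ring.
    by rewrite mulf_neq0// expf_neq0// gt_eqF.
  (* Up to radius 2 nothing is rescaled, and beyond it both z and z / gam z lie where h is
     constant. *)
  have [z2|z2] := leP `|z| 2.
    suff -> : gam z = 1 by rewrite invr1 scale1r.
    by rewrite /gam /clamp01 min_l ?max_r// lerBrDr; lra.
  rewrite !hy ?(ltW z2)// normrZ gtr0_norm ?invr_gt0//.
  by apply: (le_trans (ltW z2)); rewrite ler_peMl// invf_ge1.
exists (fun tz => E ((1 - tz.1) *: sig tz.2 + tz.1 *: pole)); split.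
- apply: continuous_subspaceT; apply: comp_continuous cE.
  have c1 : continuous (fun tz : R * 'rV[R]_n => tz.1) by exact: fst_continuous.
  apply: continuous_add; apply: continuous_scale => //.
  + by apply: continuous_sub => //; exact: cst_continuous.
  + exact: (comp_continuous (@snd_continuous _ _) sig_continuous).
  + exact: cst_continuous.
- by move=> z _ /=; rewrite subr0 scale1r scale0r addr0.
- by move=> z _ /=; rewrite subrr scale0r scale1r add0r.
- move=> t z _ /= z3; rewrite sig_pole// -scalerDl subrK scale1r Epole hy//.
  by apply: le_trans z3; rewrite ler_nat.
Qed.

End sphere_null.

(** * Concentration at a point *)

Section norm_bounds.
Context {R : realType} {n : nat}.
Implicit Types (V A : set 'rV[R]_n) (F g : 'rV[R]_n -> R).
Local Notation mu := (leb R n).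

Lemma leb_ball0 (t : R) : 0 < t -> mu (ball (0 : 'rV[R]_n) t) = (t ^+ n * @unit_vol R n)%:E.
Proof.
move=> t0; have := leb_outer_dilate (0 : 'rV[R]_n) (ball (0 : 'rV[R]_n) t) t0.
rewrite dilate_ball// => h.
have h2 : ((t ^+ n)%:E * leb_outer (ball (0%R : 'rV[R]_n) 1) = mu (ball (0%R : 'rV[R]_n) t))%E.
  by rewrite h muleA -EFinM mulfV ?mul1e// expf_neq0// gt_eqF.
by rewrite -h2 EFinM -unit_volE.
Qed.

Lemma integral_supp_le V A (f : 'rV[R]_n -> R) (c : R) : open V ->
  measurable (A : set (lebT R n)) -> 0 <= c ->
  measurable_fun (V : set (lebT R n)) (f : lebT R n -> R) ->
  (forall x, V x -> 0 <= f x <= c) -> (forall x, V x -> ~ A x -> f x = 0) ->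
  (\int[mu]_(x in V) (f x)%:E <= c%:E * mu A)%E.
Proof.
move=> oV mA c0 mf fc f0.
have mV : measurable (V : set (lebT R n)) by exact: open_leb_measurable.
have mI : measurable_fun (V : set (lebT R n)) (fun x : lebT R n => (\1_A x)%:E : \bar R).
  by apply/measurable_EFinP; exact: measurable_indic.
apply: (@le_trans _ _ (\int[mu]_(x in V) (c%:E * (\1_A x)%:E))%E).
  apply: (ge0_le_integral mu mV).
  - by move=> x /fc/andP[? _]; rewrite lee_fin.
  - exact/measurable_EFinP.
  - by apply: emeasurable_funM; [exact: measurable_cst|exact: mI].
  - move=> x Vx; rewrite -EFinM lee_fin indicE.
    case: (boolP (x \in A)) => [_|/negP nA]; first by rewrite mulr1; have /andP[] := fc x Vx.
    by rewrite mulr0 f0// => Ax; apply: nA; exact/mem_set.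
have I0 x : V x -> (0 <= (\1_A x : R)%:E)%E by move=> _; rewrite lee_fin.
rewrite (ge0_integralZl mu mV mI I0); last by rewrite lee_fin.
apply: lee_wpmul2l; first by rewrite lee_fin.
by rewrite integral_indic//; apply: le_measure; rewrite ?inE//; exact: measurableI.
Qed.

Variable P : R -> R.
Hypothesis P_young : young_function P.

(** The integrand P(|partial i F| / e) is at most P(L / e) on A and P 0 = 0 off A, so [e] is
    admissible in the infimum that defines the norm. *)
Lemma luxemburg_C1_le V A i F (e L : R) : 0 < e -> 0 <= L -> open V -> Ck_on 1 V F ->
  measurable (A : set (lebT R n)) -> (forall x, V x -> `|partial i F x| <= L) ->
  (forall x, V x -> ~ A x -> partial i F x = 0) ->
  ((P (L / e))%:E * mu A <= 1)%E -> (luxemburg P V (weak_partial V i F) <= e%:E)%E.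
Proof.
move=> e0 L0 oV VF mA dL dA PA; apply: ereal_inf_lbound; exists e => //; split => //.
have mV : measurable (V : set (lebT R n)) by exact: open_leb_measurable.
have wF : is_weak_partial V i F (weak_partial V i F).
  by apply: (xgetPex (fun=> 0)); exists (partial i F); exact: C1_weak_partial.
have aeF := weak_partial_C1_ae oV VF wF.
have mw : measurable_fun (V : set (lebT R n)) (weak_partial V i F : lebT R n -> R).
  by case: wF => -[].
have md : measurable_fun (V : set (lebT R n)) (partial i F : lebT R n -> R).
  by apply: continuous_leb_measurable => // x; exact: (Ck_on_continuous oV (Ck_onS i VF)).
have pos (t : R) : 0 <= P (`|t| / e).
  by apply: (young_ge0 P_young); rewrite divr_ge0// ltW.
rewrite (_ : (\int[mu]_(x in V) _)%E = \int[mu]_(x in V) (P (`|partial i F x| / e))%:E)%E.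
  apply: le_trans PA; apply: (integral_supp_le oV mA _ (young_measurable P_young e0 md)).
  - by apply: (young_ge0 P_young); rewrite divr_ge0// ltW.
  - move=> x Vx; rewrite pos/=; apply: (young_le P_young); first by rewrite divr_ge0// ltW.
    by rewrite ler_pM2r ?invr_gt0//; exact: dL.
  - by move=> x Vx nA; rewrite dA// normr0 mul0r (young0 P_young).
apply: ge0_ae_eq_integral.
- exact: mV.
- by apply/measurable_EFinP; exact: (young_measurable P_young e0 mw).
- by apply/measurable_EFinP; exact: (young_measurable P_young e0 md).
- by move=> x _; rewrite lee_fin.
- by move=> x _; rewrite lee_fin.
- by apply: negligibleS aeF => x; apply: contra_not => H Vx; rewrite H.
Qed.

Lemma W1P_norm_C1_le V A F (e L0 L : R) : 0 < e -> 0 <= L0 -> 0 <= L -> open V -> Ck_on 1 V F ->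
  measurable (A : set (lebT R n)) ->
  (forall x, V x -> `|F x| <= L0) -> (forall x, V x -> ~ A x -> F x = 0) ->
  (forall i x, V x -> `|partial i F x| <= L) ->
  (forall i x, V x -> ~ A x -> partial i F x = 0) ->
  ((P (L / e))%:E * mu A <= 1)%E ->
  (W1P_norm P V F <= L0%:E * mu A + (n%:R * e)%:E)%E.
Proof.
move=> e0 L00 LL0 oV VF mA FL FA dL dA PA; apply: leeD.
  have mF : measurable_fun (V : set (lebT R n)) ((fun x => `|F x|) : lebT R n -> R).
    apply: (measurableT_comp (@normr_measurable R setT)).
    by apply: continuous_leb_measurable => // x; exact: (Ck_on_continuous oV VF).
  apply: (integral_supp_le oV mA L00 mF).
  - by move=> x Vx; rewrite normr_ge0 FL.
  - by move=> x Vx nA; rewrite FA// normr0.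
apply: (@le_trans _ _ (\sum_(i < n) e%:E)%E).
  by apply: lee_sum => i _; apply: (luxemburg_C1_le e0 LL0 oV VF mA) => // x; [exact: dL|exact: dA].
by rewrite sumEFin sumr_const card_ord mulr_natl.
Qed.

Lemma partial_scale i g (k : R) x : Ck_on 1 setT g ->
  partial i (fun z => g (k *: z)) x = partial i g (k *: x) * k.
Proof.
move=> Tg.
have coord l : is_derive x (delta_mx ord0 i) (fun z : 'rV[R]_n => z ord0 l)
    ((delta_mx ord0 i : 'rV[R]_n) ord0 l).
  have /derivable_mxP/(_ ord0 l) H := @derivable_id _ _ x (delta_mx ord0 i).
  apply: DeriveDef => //; have := derive_id x (delta_mx ord0 i).
  by rewrite derive_mx; [move=> /matrixP/(_ ord0 l); rewrite mxE|exact: derivable_id].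
have ds : derivable (fun z : 'rV[R]_n => k *: z) x (delta_mx ord0 i).
  by apply: derivableZ; exact: derivable_id.
have := @is_derive_C1_comp R n _ g (fun z => k *: z) x (delta_mx ord0 i) setT openT I Tg ds.
move=> [_]; rewrite /partial => ->.
rewrite (bigD1 i)//= big1 ?addr0; last first.
  move=> l li.
  have -> : 'D_(delta_mx ord0 i) (fun z : 'rV[R]_n => (k *: z) ord0 l) x = 0; last by rewrite mulr0.
  rewrite (_ : (fun z : 'rV[R]_n => _) = (k \*: (fun z : 'rV[R]_n => z ord0 l))); last first.
    by apply/funext => z; rewrite mxE.
  have [dc ec] := coord l; rewrite deriveZ// ec mxE eqxx/= (negbTE li).
  by rewrite scaler0.
congr (_ * _).
rewrite (_ : (fun z : 'rV[R]_n => _) = (k \*: (fun z : 'rV[R]_n => z ord0 i))); last first.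
  by apply/funext => z; rewrite mxE.
by have [dc ec] := coord i; rewrite deriveZ// ec mxE !eqxx/= [_ *: _]mulr1.
Qed.

End norm_bounds.

Section concentration.
Context {R : realType} {n : nat}.
Variable P : R -> R.
Hypotheses (P_young : young_function P) (n_gt0 : (0 < n)%N).
Hypothesis P_ii : P t / t ^+ n @[t --> +oo%R] --> (0 : R).

Lemma Ck_on_scale r (k : R) U : open U -> Ck_on r U (fun z : 'rV[R]_n => k *: z).
Proof.
move=> oU; apply: Ck_on_row => // l; have := @Ck_on_affine_coord R n r U l k 0 oU.
by apply: Ck_on_eq => // z _; rewrite mxE addr0.
Qed.

Lemma C1_supp_bound (g : 'rV[R]_n -> R) : Ck_on 1 setT g -> (forall z, 2 <= `|z| -> g z = 0) ->
  exists2 B : R, 0 < B & forall z, `|g z| <= B /\ forall i, `|partial i g z| <= B.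
Proof.
move=> Tg g0.
have cK := @closed_cube_compact R n 0 2.
have bnd (f : 'rV[R]_n -> R) : continuous f -> (forall z, 2 < `|z| -> f z = 0) ->
    exists B : R, 0 < B /\ forall z, `|f z| <= B.
  move=> cf f0; have [|B B0 BP] := @compact_fun_bounded R _ _ f cK.
    exact: continuous_subspaceT.
  exists B; split => // z; have [z2|z2] := leP `|z| 2; first by apply: BP; rewrite /= subr0.
  by rewrite f0// normr0 ltW.
have oU : open [set z : 'rV[R]_n | 2 < `|z|].
  by move/continuousP: (@norm_rV_continuous R n) => /(_ [set t : R | 2 < t]); apply; exact: open_gt.
have [|z /ltW|B0 [B00 BP]] := bnd g; [|exact: g0|].
  by move=> z; exact: (Ck_on_continuous openT Tg).
have dB i : exists B : R, 0 < B /\ forall z, `|partial i g z| <= B.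
  apply: bnd => [z|z z2]; first exact: (Ck_on_continuous openT (Ck_onS i Tg)).
  by apply: (partial_eq0 i oU z2) => x /ltW; exact: g0.
have [D DP] := choice dB.
have D0 i : 0 <= D i by apply: ltW; case: (DP i).
exists (B0 + \sum_i D i); first by rewrite ltr_wpDr// sumr_ge0.
move=> z; split; first by apply: (le_trans (BP z)); rewrite lerDl sumr_ge0.
move=> i; have [_ /(_ z) h] := DP i; apply: (le_trans h).
by rewrite (bigD1 i)//= addrCA lerDl addr_ge0 ?sumr_ge0// ltW.
Qed.

Lemma W1P_norm_concentrate (g : 'rV[R]_n -> R) V (eps : R) : Ck_on 1 setT g ->
  (forall z, 2 <= `|z| -> g z = 0) -> open V -> 0 < eps ->
  \forall k \near \oo, (W1P_norm P V (fun z => g (k.+1%:R *: z)) <= eps%:E)%E.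
Proof.
move=> Tg g0 oV eps0.
have [B B0 BP] := C1_supp_bound Tg g0.
have V00 := @unit_vol_gt0 R n; set V0 := @unit_vol R n in V00.
have n10 : 0 < n%:R + 1 :> R by rewrite ltr_wpDl.
pose e := eps / (2 * (n%:R + 1)).
have e0 : 0 < e by rewrite divr_gt0// mulr_gt0.
have ne : n%:R * e <= eps / 2.
  have -> : n%:R * e = eps / 2 * (n%:R / (n%:R + 1)) by rewrite /e; field; rewrite gt_eqF.
  by rewrite ler_piMr ?divr_ge0 ?(ltW eps0)// ler_pdivrMr// mul1r lerDl.
(* With s = B kap / e the modular is at most P(s) (3 / kap)^n V0 = (P(s) / s^n) c, so it is at most
   1 once P(s) / s^n < 1 / c. *)
pose c := (3 * B / e) ^+ n * V0.
have c0 : 0 < c by rewrite mulr_gt0// exprn_gt0// divr_gt0// mulr_gt0.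
have /cvgrPdist_lt/(_ (c^-1)) := P_ii; rewrite invr_gt0 => /(_ c0)[T [_ TP]].
(* Three demands on kap: the radius 3 / kap is at most 1, the argument B kap / e exceeds the
   threshold T from (ii), and the L^1 term is at most eps / 2. *)
pose x := Num.max 3 (Num.max (T * e / B) (6 * B * V0 / eps)).
have H : \forall k \near \oo, x <= k%:R by exact: nbhs_infty_ger.
apply: filterS H => k xk; set kap : R := k.+1%:R.
have xkap : x < kap by apply: le_lt_trans xk _; rewrite ltr_nat.
move: xkap; rewrite !gt_max => /and3P[k3 kT ke].
have kap0 : 0 < kap by exact: lt_trans k3.
(* Radius 3 and not 2: where |kap z| >= 3 the function vanishes on a neighbourhood, so its partial
   derivatives vanish as well. *)
pose t := 3 / kap.
have t0 : 0 < t by rewrite divr_gt0.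
have t1 : t <= 1 by rewrite ler_pdivrMr// mul1r ltW.
have mA : measurable (ball (0 : 'rV[R]_n) t : set (lebT R n)) by exact: ball_leb_measurable.
have VF : Ck_on 1 V (fun z => g (kap *: z)).
  exact: (@Ck_on_comp_real R n n 1 V setT (fun z => kap *: z) g oV openT (fun _ _ => I) Tg (Ck_on_scale _ _ oV)).
have out z : ~ ball (0 : 'rV[R]_n) t z -> 3 <= `|kap *: z|.
  rewrite ball_rowE/= sub0r normrN => /negP; rewrite -leNgt => zt.
  by rewrite normrZ gtr0_norm// mulrC -ler_pdivrMr.
have L0 : 0 <= B * kap by rewrite mulr_ge0// ltW.
have dF i z : `|partial i (fun z => g (kap *: z)) z| <= B * kap.
  rewrite partial_scale// normrM (gtr0_norm kap0) ler_pM2r//.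
  by have [_] := BP (kap *: z).
have oU : open [set z : 'rV[R]_n | 2 < `|z|].
  by move/continuousP: (@norm_rV_continuous R n) => /(_ [set t : R | 2 < t]); apply; exact: open_gt.
apply: (le_trans (W1P_norm_C1_le P_young e0 (ltW B0) L0 oV VF mA _ _ _ _ _)).
- by move=> z _; have [] := BP (kap *: z).
- by move=> z _ /out z3; apply: g0; apply: le_trans z3; rewrite ler_nat.
- by move=> i z _; exact: dF.
- move=> i z _ /out z3; rewrite partial_scale// (partial_eq0 i oU) ?mul0r//=.
    by apply: lt_le_trans z3; rewrite ltr_nat.
  by move=> w /ltW; exact: g0.
- rewrite leb_ball0// -/V0 -EFinM lee_fin.
  have tT : T < B * kap / e.
    by rewrite ltr_pdivlMr// [B * _]mulrC -ltr_pdivrMr.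
  have := TP _ tT; rewrite /= sub0r normrN => h.
  have s0 : 0 < B * kap / e by rewrite divr_gt0// mulr_gt0.
  have {}h : P (B * kap / e) <= c^-1 * (B * kap / e) ^+ n.
    rewrite -ler_pdivrMr ?exprn_gt0//; apply: ltW; apply: le_lt_trans h.
    exact: ler_norm.
  apply: (@le_trans _ _ (c^-1 * (B * kap / e) ^+ n * (t ^+ n * V0))).
    by rewrite ler_pM2r// mulr_gt0// exprn_gt0.
  have -> : c^-1 * (B * kap / e) ^+ n * (t ^+ n * V0) = c^-1 * ((B * kap / e * t) ^+ n * V0).
    by rewrite [(_ * t) ^+ n]exprMn; ring.
  have -> : B * kap / e * t = 3 * B / e by rewrite /t; field; rewrite !gt_eqF.
  by rewrite -/c mulVf// gt_eqF.
- rewrite leb_ball0// -/V0 -EFinM -EFinD lee_fin.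
  have -> : eps = eps / 2 + eps / 2 by field.
  apply: lerD ne.
  apply: (@le_trans _ _ (B * (t * V0))).
    rewrite ler_pM2l// ler_pM2r// -[leRHS]expr1.
    by apply: ler_wiXn2l => //; exact: ltW.
  move: ke; rewrite ltr_pdivrMr// => ke.
  rewrite /t; have -> : B * (3 / kap * V0) = (6 * B * V0) / kap / 2 by field; rewrite gt_eqF.
  by rewrite ler_pM2r ?invr_gt0// ler_pdivrMr// [leRHS]mulrC; exact: ltW.
Qed.

(** Meant for the patches of the sphere on which the concentrated maps have become constant. *)
Lemma W1P_norm_zero (F : 'rV[R]_n -> R) V (eps : R) : open V -> 0 < eps ->
  (forall z, V z -> F z = 0) -> (W1P_norm P V F <= eps%:E)%E.
Proof.
move=> oV eps0 F0; pose e := eps / (n%:R + 1).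
have n10 : 0 < n%:R + 1 :> R by rewrite ltr_wpDl.
have e0 : 0 < e by rewrite divr_gt0.
have VF : Ck_on 1 V F.
  by apply: (Ck_on_eq oV _ (Ck_on_cst 1 (0 : R) oV)) => z Vz; rewrite F0.
have dF i z : V z -> partial i F z = 0 by move=> Vz; exact: (partial_eq0 i oV Vz).
apply: (le_trans (@W1P_norm_C1_le R n P P_young V set0 F e 0 0 e0 (lexx _) (lexx _) oV VF _ _ _ _ _ _)).
- exact: measurable0.
- by move=> z Vz; rewrite F0// normr0.
- by move=> z Vz _; exact: F0.
- by move=> i z Vz; rewrite dF// normr0.
- by move=> i z Vz _; exact: dF.
- by rewrite measure0 mule0 lee_fin.
- rewrite mul0e add0e lee_fin /e mulrCA ler_piMr ?(ltW eps0)//.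
  by rewrite ler_pdivrMr// mul1r lerDl.
Qed.

End concentration.

Lemma homotopic_rel_comp (R : realType) (X X' Y : topologicalType) (B : set X) (f g : X -> Y)
    (phi : X' -> X) : continuous phi -> homotopic_rel R setT B f g ->
  homotopic_rel R setT (phi @^-1` B) (f \o phi) (g \o phi).
Proof.
move=> cphi /homotopic_relP[H [cH H0 H1 HB]]; apply/homotopic_relP.
exists (fun tx => H (tx.1, phi tx.2)); split.
- apply: comp_continuous cH; apply: continuous_pair; first exact: fst_continuous.
  exact: (comp_continuous (@snd_continuous _ _) cphi).
- by move=> t x; exact: H0.
- by move=> t x; exact: H1.
- by move=> t x; exact: HB.
Qed.

Lemma ecvg0_le (R : realType) (f : nat -> \bar R) : (forall k, 0 <= f k)%E ->
  (forall eps : R, 0 < eps -> \forall k \near \oo, (f k <= eps%:E)%E) -> f k @[k --> \oo] --> 0%E.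
Proof.
move=> f0 fe; apply/fine_cvgP; split.
  apply: filterS (fe 1 ltr01) => k fk.
  by rewrite ge0_fin_numE// (le_lt_trans fk)// ltry.
apply/cvgrPdist_le => eps eps0; apply: filterS (fe eps eps0) => k fk.
have fin : f k \is a fin_num by rewrite ge0_fin_numE// (le_lt_trans fk)// ltry.
rewrite sub0r normrN /= ger0_norm; last exact: fine_ge0.
by rewrite -lee_fin fineK.
Qed.

Lemma filter_all_ord (F : set_system nat) k (Q : 'I_k -> nat -> Prop) :
  Filter F -> (forall i, F (Q i)) -> F [set x | forall i, Q i x].
Proof.
move=> FF H; have := @filter_all_seq _ _ F (enum 'I_k) Q FF (fun i _ => H i).
by apply: filterS => x Qx i; apply: Qx; rewrite mem_enum.
Qed.

(** * Homotopically nontrivial maps that converge to a constant *)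

Section part_b.
Context {R : realType} {n m k : nat}.
Variables (N : riemData R m) (iota : N -> 'rV[R]_k) (P : R -> R).
Hypotheses (n_gt0 : (0 < n)%N) (N_mfd : compact_riemannian N).
Hypotheses (iota_emb : isometric_embedding iota) (P_young : young_function P).
Hypothesis P_ii : P t / t ^+ n @[t --> +oo%R] --> (0 : R).

Lemma homotopy_classes_not_defined : ~ pi_trivial R n N ->
  exists (u_ : nat -> sphere R n -> N) (c : N),
    [/\ forall i, smooth_map (u_ i),
        forall C : coord_cover (sphere R n),
          W1P_normM C P (fun x => iota (u_ i x) - iota c)%R @[i --> \oo] --> 0%E &
        forall i (c' : N), ~ homotopic R (u_ i) (cst c')].
Proof.
move=> /existsNP[y /(nontrivial_disk n_gt0)[f0 [cf0 f0y nf0]]].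
have [f [sf fy f0f]] := smoothing N_mfd cf0 f0y.
pose kap i : R := i.+1%:R.
have kap0 i : 0 < kap i by rewrite ltr0n.
have kap1 i : 1 <= kap i by rewrite ler1n.
pose h i (z : 'rV[R]_n) := f (kap i *: z).
have sh i z : smooth_at (h i) z.
  apply: (@smooth_at_comp _ _ _ _ f (fun z => kap i *: z) z setT openT I) => //.
  by move=> r; exact: Ck_on_scale openT.
have hy i z : 2 / kap i <= `|z| -> h i z = y.
  move=> zk; apply: fy; rewrite normrZ gtr0_norm// mulrC -ler_pdivrMr//.
have hy2 i z : 2 <= `|z| -> h i z = y.
  move=> z2; apply: hy; apply: le_trans z2; rewrite ler_pdivrMr// ler_peMr//.
exists (fun i => sphere_map (h i) y), y; split.
- move=> i; apply: (@smooth_sphere_map R n m N (h i) y (2 / kap i)) => //.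
    by rewrite divr_gt0.
  exact: hy.
- move=> C; apply: ecvg0_le.
    move=> i; apply: sume_ge0 => j _; apply: sume_ge0 => a _; exact: W1P_norm_ge0.
  move=> eps eps0.
  pose e := eps / ((cover_size C * k)%:R + 1).
  have d0 : 0 < (cover_size C * k)%:R + 1 :> R by rewrite ltr_wpDl.
  have e0 : 0 < e by rewrite divr_gt0.
  have term (j : 'I_(cover_size C)) (a : 'I_k) : \forall i \near \oo, (W1P_norm P
      (@cover_patch _ _ _ C j) (fun z => (iota (sphere_map (h i) y
        (chart_param (@cover_chart _ _ _ C j) z)) - iota y)%R ord0 a) <= e%:E)%E.
    set V := @cover_patch _ _ _ C j.
    have oV : open V by exact: cover_open.
    (* In the chart [true] the concentration point is at infinity and the patch is bounded, so the
       maps are constant on it for large i; in the chart [false] they are dilations of f. *)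
    have [[] _ <-] := @cover_atlas _ _ _ C j.
      have [rho rho0 rhoP] := compact_sub_ball (@Defs.cover_compact _ _ _ C j).
      have big : \forall i \near \oo, 2 * n%:R * rho <= i%:R by exact: nbhs_infty_ger.
      apply: filterS big => i ik; apply: W1P_norm_zero => // z Vz.
      rewrite (@sphere_map_near R n N (h i) y (2 / kap i) z (hy i)).
        by rewrite subrr mxE.
      have zr : `|z| < rho by apply: rhoP; exact: subset_closure.
      have -> : 2 / kap i * n%:R * `|z| = 2 * n%:R * `|z| / kap i by ring.
      rewrite ler_pdivrMr// mul1r; apply: (@le_trans _ _ (2 * n%:R * rho)).
        by rewrite ler_wpM2l ?mulr_ge0// ltW.
      by apply: (le_trans ik); rewrite ler_nat.
    pose g (z : 'rV[R]_n) := iota (f z) ord0 a - iota y ord0 a.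
    have Tg : Ck_on 1 setT g.
      have fa : Ck_on 1 setT (fun z => iota (f z) ord0 a).
        apply: Ck_on_row_coord; first exact: openT.
        apply: Ck_on_local; first exact: openT.
        move=> z _; have [W [oW Wz sW]] := smooth_at_emb N_mfd iota_emb (sf z).
        by exists W; split => //; exact: (sW 1%N).
      have := Ck_onD openT fa (Ck_on_cst 1 (- iota y ord0 a : R) openT).
      by apply: Ck_on_eq => //; exact: openT.
    have g0 z : 2 <= `|z| -> g z = 0 by move=> z2; rewrite /g fy// subrr.
    have H := W1P_norm_concentrate P_young n_gt0 P_ii Tg g0 oV e0.
    apply: filterS H => i.
    have -> // : (fun z => g (i.+1%:R *: z)) = fun z => (iota (sphere_map (h i) y
        (chart_param (stereo_chart R n false) z)) - iota y)%R ord0 a.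
    by apply/funext => z; rewrite sphere_map_false !mxE.
  have all := @filter_all_ord _ _ _ _ (fun j => @filter_all_ord _ _ _ _ (term j)).
  apply: (filterS _ (all _ _)) => i iP.
  apply: (@le_trans _ _ (\sum_(j < cover_size C) \sum_(a < k) e%:E)%E).
    by apply: lee_sum => j _; apply: lee_sum => a _; exact: iP.
  under eq_bigr do rewrite sumEFin sumr_const card_ord.
  rewrite sumEFin sumr_const card_ord lee_fin -mulrnA -mulr_natl mulnC.
  rewrite /e mulrCA ler_piMr ?(ltW eps0)//.
  by rewrite ler_pdivrMr// mul1r lerDl.
- move=> i c' /(sphere_map_null (hy2 i)) nul; apply: nf0.
  (* The scalings are undone. The null-homotopy is relative to |z| >= 3, so after z -> 3 z it is
     relative to |z| >= 1. Dilations by factors from 1 to 3 kap join f0 to its rescaling and keep it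
     equal to y outside the unit disk. *)
  pose s (c : R) (z : 'rV[R]_n) := c *: z.
  have cs c : continuous (s c).
    by apply: continuous_scale; [exact: cst_continuous|exact: id_continuous].
  have sn c z : 0 <= c -> `|s c z| = c * `|z| by move=> c0; rewrite normrZ ger0_norm.
  have k3 : 1 <= kap i * 3 by apply: mulr_ege1 => //; rewrite ler1n.
  have k30 : 0 <= kap i * 3 by exact: le_trans k3.
  have h1 : homotopic_rel R setT [set z | 1 <= `|z|] (h i \o s 3) (cst y).
    apply: homotopic_rel_sub (homotopic_rel_comp (cs 3) nul) => z /= z1.
    by rewrite sn//; lra.
  have h2 : homotopic_rel R setT [set z | 1 <= `|z|] (f0 \o s (kap i * 3)) (h i \o s 3).
    have := homotopic_rel_comp (cs (kap i * 3)) f0f.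
    have -> : f \o s (kap i * 3) = h i \o s 3.
      by apply/funext => z; rewrite /h /s/= scalerA.
    apply: homotopic_rel_sub => z /= z1; rewrite sn//.
    apply: (@le_trans _ _ (kap i * 3)); last by rewrite ler_peMr.
    by have := kap1 i; lra.
  apply: homotopic_rel_trans (homotopic_rel_trans h2 h1).
  exists (fun tz => f0 ((1 + tz.1 * (kap i * 3 - 1)) *: tz.2)); split.
  + apply: continuous_subspaceT; apply: comp_continuous cf0.
    apply: continuous_scale; last exact: snd_continuous.
    apply: continuous_add; first exact: cst_continuous.
    by apply: continuous_mul; [exact: fst_continuous|exact: cst_continuous].
  + by move=> z _; rewrite mul0r addr0 scale1r.
  + by move=> z _; rewrite mul1r addrC subrK.
  + move=> t z /andP[t0 _] /= z1; rewrite !f0y// normrZ.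
    have q : 1 <= 1 + t * (kap i * 3 - 1) by rewrite lerDl mulr_ge0// subr_ge0.
    by rewrite ger0_norm ?(le_trans ler01 q)// mulr_ege1.
Qed.

End part_b.

Theorem theorem1p3 (R : realType) (n m k : nat)
    (M : riemData R n) (N : riemData R m) (iota : N -> 'rV[R]_k) (P : R -> R)
    (n_ge2 : (2 <= n)%N)
    (M_mfd : compact_riemannian M) (N_mfd : compact_riemannian N)
    (iota_emb : isometric_embedding iota)
    (P_young : young_function P)
    (P_i : (\int[lebesgue_measure]_(t in `[1%R, +oo[) (P t / t ^+ n.+1)%:E = +oo)%E)
    (P_ii : P t / t ^+ n @[t --> +oo%R] --> (0 : R))
    (P_iii : exists2 K : R, 0 < K & forall t, 0 <= t -> P (2 * t) <= K * P t)
    (P_iv : exists2 alpha : R, n%:R - 1 < alpha &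
       forall s t, 0 < s -> s <= t -> s `^ (- alpha) * P s <= t `^ (- alpha) * P t) :
  (pi_trivial R n N ->
     forall (C : coord_cover M) (u : M -> 'rV[R]_k), in_W1PMN C P iota u ->
       exists2 e : R, 0 < e &
         forall u1 u2 : M -> N, smooth_map u1 -> smooth_map u2 ->
           (W1P_normM C P (fun x => u x - iota (u1 x))%R < e%:E)%E ->
           (W1P_normM C P (fun x => u x - iota (u2 x))%R < e%:E)%E ->
           homotopic R u1 u2) /\
  (~ pi_trivial R n N ->
     exists (u_ : nat -> sphere R n -> N) (c : N),
       [/\ forall i, smooth_map (u_ i),
           forall C : coord_cover (sphere R n),
             W1P_normM C P (fun x => iota (u_ i x) - iota c)%R @[i --> \oo] --> 0%E &
           forall i (c' : N), ~ homotopic R (u_ i) (cst c')]).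
Proof.
split; first exact: homotopy_classes_well_defined.
by apply: homotopy_classes_not_defined => //; exact: ltnW.
Qed.
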